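(* Let $\Lambda>0$, $\delta>0$ and let $\mathcal V:\mathbb R\times[0,\Lambda]\to\mathbb R$, $(x,\lambda)\mapsto\mathcal V(x;\lambda)$ (primes denote derivatives in $x$). Suppose that for each $\lambda$: $\mathcal V(\cdot;\lambda)\in C^5(\mathbb R)$; $\mathcal V(0;\lambda)=\mathcal V'(0;\lambda)=0$ and $\mathcal V''(0;\lambda)>0$; and $\pm\mathcal V'(x;\lambda)>0$ for $\pm x>0$. Suppose that for some exponents $p_\pm\ge 0$ and constants $\mathcal V_\pm>0$ we have $\mathcal V(x;\lambda)=\mathcal V_\pm|x|^{p_\pm}(1+o(1))$, $\mathcal V'(x;\lambda)=O(|x|^{p_\pm-1})$ and $\mathcal V''(x;\lambda)=O(|x|^{p_\pm-2})$ as $x\to\pm\infty$, uniformly for small $\lambda$. Let $\lambda_{\max}\in(0,\Lambda]$ and $\delta$ be sufficiently small, and assume that for $m=0,1,2$ and $n=0,\dots,5$ the function $(x,\lambda)\mapsto\partial_\lambda^m\partial_x^n\mathcal V(x;\lambda)$ is continuous on $(-\delta,\delta)\times[0,\lambda_{\max}]$. Then all eigenvalues $\lambda$ in the interval $0<\lambda\le\lambda_{\max}$ of the Schrödinger system $$\epsilon\frac{d\mathbf w}{dx}=\begin{bmatrix}0&1\\ \mathcal V(x;\lambda)-\lambda&0\end{bmatrix}\mathbf w,\qquad x\in\mathbb R,$$ satisfy $$\cos\left(\frac1\epsilon\int_{x_-(\lambda)}^{x_+(\lambda)}\sqrt{\lambda-\mathcal V(x;\lambda)}\,dx\right)=O(\epsilon),\qquad\epsilon\downarrow0,$$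 where $x_-(\lambda)<0<x_+(\lambda)$ are the two preimages of $\lambda$ under $x\mapsto\mathcal V(x;\lambda)$. The error term is uniform given $\lambda_{\max}$: there are constants $C,\epsilon_0>0$ such that for every $\epsilon\in(0,\epsilon_0)$ and every eigenvalue $\lambda\in(0,\lambda_{\max}]$ for that $\epsilon$, the absolute value of the left-hand side is at most $C\epsilon$.
   Context: For given $\epsilon>0$, a real number $\lambda$ is called an eigenvalue of a system $\epsilon\,\mathbf w'(x)=\mathbf B(x;\lambda)\mathbf w(x)$ on $\mathbb R$ if the system has a nontrivial solution $\mathbf w\in L^2(\mathbb R;\mathbb C^2)$. The Schrödinger system with $\mathbf w=(\psi,\epsilon\psi')^\top$ is equivalent to $-\epsilon^2\psi''+\mathcal V(x;\lambda)\psi=\lambda\psi$. The potential is allowed to depend on the spectral parameter $\lambda$; the classical case is $\partial_\lambda\mathcal V=0$. *)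

(* Defs.v *)
From mathcomp Require all_boot all_algebra all_classical all_reals all_analysis.
From mathcomp Require Rstruct Rstruct_topology.
From Stdlib Require Import Reals.
From Coquelicot Require Import Coquelicot.

Open Scope R_scope.

Module RealL2.
Import all_boot all_algebra all_classical all_reals all_analysis.
Import Rstruct Rstruct_topology.

Definition L2_of (T : realType) (f : T -> T) : Prop :=
  f \in Lfun (@lebesgue_measure T) (2%:R%R)%:E%E.

(* Stdlib's R with its instance of realType. *)
Definition L2 (f : R -> R) : Prop := @L2_of _ f.

End RealL2.

(* L^2(R; C^2), through the four real coordinates. *)
Definition L2_C2 (w : R -> C * C) : Prop :=
  RealL2.L2 (fun x => Re (fst (w x))) /\ RealL2.L2 (fun x => Im (fst (w x))) /\
  RealL2.L2 (fun x => Re (snd (w x))) /\ RealL2.L2 (fun x => Im (snd (w x))).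

Record matrix2 : Type := Matrix2 { m11 : C; m12 : C; m21 : C; m22 : C }.

Definition mulmv (A : matrix2) (v : C * C) : C * C :=
  (Cplus (Cmult (m11 A) (fst v)) (Cmult (m12 A) (snd v)),
   Cplus (Cmult (m21 A) (fst v)) (Cmult (m22 A) (snd v))).

(* Here [is_derive] is the derivative of a map from R to the real normed
   space C^2. *)
Definition is_solution (eps : R) (A : R -> matrix2) (w : R -> C * C) : Prop :=
  forall x : R, exists dw : C * C,
    is_derive w x dw /\ scal eps dw = mulmv (A x) (w x).

Definition is_eigenvalue (eps : R) (B : R -> R -> matrix2) (lam : R) : Prop :=
  exists w : R -> C * C,
    is_solution eps (fun x => B x lam) w /\
    (exists x, w x <> (RtoC 0, RtoC 0)) /\
    L2_C2 w.

Definition schrodinger (V : R -> R -> R) (x lam : R) : matrix2 :=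
  Matrix2 (RtoC 0) (RtoC 1) (RtoC (V x lam - lam)) (RtoC 0).

(* [Derive_n] is total, so differentiability is required at every order. *)
Definition class_C (k : nat) (f : R -> R) : Prop :=
  forall n x, (n <= k)%nat -> ex_derive_n f n x /\ continuous (Derive_n f n) x.

(* f(x; lam) = g(x) (1 + o(1)) as x -> e, uniformly for lam in [0, lam0]. *)
Definition unif_equiv (e : Rbar) (lam0 : R) (f : R -> R -> R) (g : R -> R) : Prop :=
  forall eta, 0 < eta ->
    Rbar_locally e (fun x => forall lam, 0 <= lam <= lam0 ->
      Rabs (f x lam - g x) <= eta * Rabs (g x)).

(* f(x; lam) = O(g(x)) as x -> e, uniformly for lam in [0, lam0]. *)
Definition unif_bigO (e : Rbar) (lam0 : R) (f : R -> R -> R) (g : R -> R) : Prop :=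
  exists K,
    Rbar_locally e (fun x => forall lam, 0 <= lam <= lam0 ->
      Rabs (f x lam) <= K * Rabs (g x)).

(* n-th derivative of V in its first argument. *)
Definition dx (n : nat) (V : R -> R -> R) (x lam : R) : R :=
  Derive_n (fun y => V y lam) n x.

(* On (-delta, delta) x [0, lmax] the derivatives d_lam^m d_x^n V, m <= M,
   n <= N, exist and are jointly continuous; D m n is d_lam^m d_x^n V there.
   The derivatives in lam are relative to the interval [0, lmax], hence
   one-sided at its endpoints, V being meaningless for lam < 0. *)
Definition continuous_partials (M N : nat) (delta lmax : R) (V : R -> R -> R) : Prop :=
  let I := fun lam : R => 0 <= lam <= lmax in
  let Q := fun p : R * R => - delta < fst p < delta /\ I (snd p) in
  exists D : nat -> nat -> R -> R -> R,
    (forall n x lam, (n <= N)%nat -> Q (x, lam) -> D 0%nat n x lam = dx n V x lam) /\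
    (forall m n x lam, (m < M)%nat -> (n <= N)%nat -> Q (x, lam) ->
       D_in (D m n x) (D (S m) n x) I lam) /\
    (forall m n, (m <= M)%nat -> (n <= N)%nat ->
       continuous_on Q (fun p => D m n (fst p) (snd p))).

(* Main.v *)
Require Import Defs.
From mathcomp Require all_boot all_order all_algebra all_classical all_reals all_analysis.
From mathcomp Require Rstruct Rstruct_topology.
From Stdlib Require Import Reals.
From Coquelicot Require Import Coquelicot.
From Stdlib Require Import Ranalysis5 Lra Lia Psatz Classical IndefiniteDescription.

(* For small lam the turning points are close to 0, so only V near x = 0
   matters; its growth at infinity plays no role.

   Let -l and l be the turning points after centring. Then
   V - lam = (s^2 - l^2) R(s) with R > 0 of bounded C^{2,1} norm. The Langer
   variable z, with kap^4 z'^2 (z^2 - l^2) = V - lam and kap fixed by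
   int sqrt(lam - V) = (PI / 2) (kap l)^2, turns the equation into the Weber
   equation. The point is that z has C^3 bounds that are uniform as the turning
   points coalesce (l -> 0); they come from the regular solution of the singular
   equation (s^2 - l^2) h' + 3 s h = k, whose right-hand side has mean zero for
   the weight sqrt(l^2 - s^2) exactly by the choice of kap.

   With H_n the Hermite function, Y_n = z'^(-1/2) H_n(kap z / sqrt eps) solves
   the Schroedinger equation with lam shifted by
   kap^2 z'^2 ((2n + 1) eps - (kap l)^2) + O(eps^2).
   Suppose that |(kap l)^2 - (2n + 1) eps| > C eps^2 for all n. By Sturm comparison
   each step of Y_0, ..., Y_{N-1}, psi, Y_N, where psi is the eigenfunction and
   (2N - 1) eps < (kap l)^2 < (2N + 1) eps, gains a zero, so the N-th Hermite
   polynomial has N + 1 zeros. Hence (kap l)^2 = (2n + 1) eps + O(eps^2) for some n,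
   and the cosine of (PI / 2) (kap l)^2 / eps is O(eps). Exponential decay in the
   forbidden region lets the comparison run on a fixed interval. *)

(** * Functions of class C^{n,1} *)

(** Uniformity as l -> 0 dictates the count of derivatives. Five derivatives of V make V - lam of
    class C^{4,1}; dividing by both turning points costs two orders. The Lipschitz second derivative
    that remains leaves a cubic remainder once a quadratic polynomial is removed, which is just what
    gives the singular linear equation a solution with two derivatives bounded independently of l.
    Then z' is expressed algebraically through this solution instead of by differentiating z, so no
    further order is lost: a = z'^(-1/2) has a bounded second derivative, and a''/a is the source of
    the O(eps^2) error.

    The comparison lives on (-b, b), and neither function vanishes at the ends. The boundary
    condition is replaced by a logarithmic derivative of size at least kap1 / eps, pointing inwards,
    for b/2 <= |s| < b; for small eps this makes a potential gap of 1 decisive. The tolerance C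
    eps^2 has to produce this gap of 1 after absorbing a''/a. *)

Ltac derive_subst H :=
  match type of H with
  | is_derive ?f ?x ?l =>
    replace (Derive (fun y : R => f y) x) with l by (symmetry; apply is_derive_unique; exact H)
  end.

Ltac derive_side :=
  repeat match goal with |- _ /\ _ => split end;
  first [exact I | eexists; eassumption | lra].

Lemma derive_continuous (f : R -> R) (x l : R) :
  is_derive f x l -> continuous f x.
Proof.
intros H. apply (ex_derive_continuous (K := R_AbsRing) (V := R_NormedModule)).
now exists l.
Qed.

Lemma mean_value (f f' : R -> R) (a b : R) :
  (forall x, Rmin a b <= x <= Rmax a b -> is_derive f x (f' x)) ->
  exists c, Rmin a b <= c <= Rmax a b /\ f b - f a = f' c * (b - a).
Proof.
intros H. apply MVT_gen.
- intros x Hx. apply H. lra.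
- intros x Hx. apply continuity_pt_filterlim, (derive_continuous f x (f' x)). now apply H.
Qed.

Lemma mean_value_le (f f' : R -> R) (a b : R) :
  a <= b -> (forall x, a <= x <= b -> is_derive f x (f' x)) ->
  exists c, a <= c <= b /\ f b - f a = f' c * (b - a).
Proof.
intros Hab H. destruct (mean_value f f' a b) as [c Hc]; rewrite ?Rmin_left, ?Rmax_right in * by exact Hab;
  [exact H | now exists c].
Qed.

Lemma between_interval (lo hi a b x : R) :
  lo < a < hi -> lo < b < hi -> Rmin a b <= x <= Rmax a b -> lo < x < hi.
Proof.
intros Ha Hb. unfold Rmin, Rmax. destruct (Rle_dec a b); lra.
Qed.

Lemma Rabs_plus_le (x y a b : R) : Rabs x <= a -> Rabs y <= b -> Rabs (x + y) <= a + b.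
Proof.
intros Hx Hy. eapply Rle_trans; [apply Rabs_triang | now apply Rplus_le_compat].
Qed.

Lemma bounded_derive_lipschitz (f f' : R -> R) (lo hi B : R) :
  (forall x, lo < x < hi -> is_derive f x (f' x)) ->
  (forall x, lo < x < hi -> Rabs (f' x) <= B) ->
  forall s t, lo < s < hi -> lo < t < hi -> Rabs (f t - f s) <= B * Rabs (t - s).
Proof.
intros Hd HB s t Hs Ht.
destruct (mean_value f f' s t) as [c [Hc E]].
- intros x Hx. apply Hd. now apply (between_interval lo hi s t).
- rewrite E, Rabs_mult. apply Rmult_le_compat_r; [apply Rabs_pos|].
  apply HB. now apply (between_interval lo hi s t).
Qed.

(* With lip = true: the class C^{n,1} on (-b, b), all norms at most B; with
   lip = false no continuity of the n-th derivative is required. *)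
Fixpoint diff_class (lip : bool) (n : nat) (b B : R) (f : R -> R) : Prop :=
  (forall s, - b < s < b -> Rabs (f s) <= B) /\
  match n with
  | O => if lip
         then forall s t, - b < s < b -> - b < t < b -> Rabs (f t - f s) <= B * Rabs (t - s)
         else True
  | S p => exists f', (forall s, - b < s < b -> is_derive f s (f' s)) /\ diff_class lip p b B f'
  end.

Notation lip_class := (diff_class true).

Lemma diff_class_bound (lip : bool) (n : nat) (b B : R) (f : R -> R) :
  diff_class lip n b B f -> forall s, - b < s < b -> Rabs (f s) <= B.
Proof. destruct n; simpl; tauto. Qed.

Lemma diff_class_forget (n : nat) (b B : R) (f : R -> R) :
  lip_class n b B f -> diff_class false n b B f.
Proof.
revert f. induction n as [|n IH]; simpl; intros f [H1 H2]; split; auto.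
destruct H2 as [f' [Hd Hf']]. exists f'. auto.
Qed.

Lemma diff_class_weaken (lip : bool) (n : nat) (b b' B B' : R) (f : R -> R) :
  b' <= b -> B <= B' -> diff_class lip n b B f -> diff_class lip n b' B' f.
Proof.
intros Hb HB. revert f. induction n as [|n IH]; intros f [H1 H2]; (split; [intros s Hs; specialize (H1 s); lra|]).
- destruct lip; [|exact I]. intros s t Hs Ht. eapply Rle_trans; [apply H2; lra|].
  apply Rmult_le_compat_r; [apply Rabs_pos | assumption].
- destruct H2 as [f' [Hd Hf']]. exists f'. split; [intros s Hs; apply Hd; lra | now apply IH].
Qed.

Lemma lip_class_lipschitz (n : nat) (b B : R) (f : R -> R) :
  lip_class n b B f ->
  forall s t, - b < s < b -> - b < t < b -> Rabs (f t - f s) <= B * Rabs (t - s).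
Proof.
destruct n as [|n]; intros [H1 H2]; [exact H2|].
destruct H2 as [f' [Hd Hf']].
apply (bounded_derive_lipschitz f f'); [exact Hd | now apply (diff_class_bound true n)].
Qed.

Lemma diff_class_pred (lip : bool) (n : nat) (b B : R) (f : R -> R) :
  diff_class lip (S n) b B f -> diff_class lip n b B f.
Proof.
revert f. induction n as [|n IH]; intros f H.
- split; [apply H|]. destruct lip; [now apply (lip_class_lipschitz 1) | exact I].
- destruct H as [H1 [f' [Hd Hf']]]. split; [exact H1|].
  exists f'. split; [exact Hd | now apply IH].
Qed.

Lemma locally_open_interval (lo hi x : R) (P : R -> Prop) :
  lo < x < hi -> (forall y, lo < y < hi -> P y) -> locally x P.
Proof.
intros Hx HP. assert (He : 0 < Rmin (x - lo) (hi - x)) by (apply Rmin_pos; lra).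
exists (mkposreal _ He). intros y Hy. apply HP.
unfold ball in Hy; simpl in Hy; unfold AbsRing_ball, abs, minus, plus, opp in Hy; simpl in Hy.
apply Rabs_def2 in Hy.
pose proof (Rmin_l (x - lo) (hi - x)). pose proof (Rmin_r (x - lo) (hi - x)). lra.
Qed.

Lemma lipschitz_continuous (f : R -> R) (lo hi B x : R) :
  lo < x < hi ->
  (forall s t, lo < s < hi -> lo < t < hi -> Rabs (f t - f s) <= B * Rabs (t - s)) ->
  continuous f x.
Proof.
intros Hx HL. apply continuity_pt_filterlim. intros e He.
assert (HB : 0 < Rabs B + 1) by (pose proof (Rabs_pos B); lra).
set (d := Rmin (Rmin (x - lo) (hi - x)) (e / (Rabs B + 1))).
assert (Hd : 0 < d).
{ repeat apply Rmin_pos; try lra. now apply Rdiv_lt_0_compat. }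
exists d. split; [exact Hd|]. intros y [_ Hy]. unfold Rdist in *. simpl in *. unfold Rdist in *.
assert (H1 : d <= x - lo) by (eapply Rle_trans; [apply Rmin_l | apply Rmin_l]).
assert (H2 : d <= hi - x) by (eapply Rle_trans; [apply Rmin_l | apply Rmin_r]).
assert (H3 : d <= e / (Rabs B + 1)) by apply Rmin_r.
assert (Hy' := Rabs_def2 _ _ Hy).
eapply Rle_lt_trans; [apply HL; lra|].
apply Rle_lt_trans with ((Rabs B) * Rabs (y - x)).
{ apply Rmult_le_compat_r; [apply Rabs_pos | apply Rle_abs]. }
apply Rle_lt_trans with (Rabs B * (e / (Rabs B + 1))).
{ apply Rmult_le_compat_l; [apply Rabs_pos | lra]. }
replace e with ((Rabs B + 1) * (e / (Rabs B + 1))) at 2 by (field; lra).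
apply Rmult_lt_compat_r; [now apply Rdiv_lt_0_compat | lra].
Qed.

Lemma lip_class_continuous (n : nat) (b B : R) (f : R -> R) (s : R) :
  lip_class n b B f -> - b < s < b -> continuous f s.
Proof.
intros H Hs. apply (lipschitz_continuous f (- b) b B); [exact Hs|].
now apply (lip_class_lipschitz n).
Qed.

Lemma diff_class_ext (lip : bool) (n : nat) (b B : R) (f g : R -> R) :
  (forall s, - b < s < b -> f s = g s) -> diff_class lip n b B f -> diff_class lip n b B g.
Proof.
intros E. destruct n as [|n]; intros [H1 H2]; (split; [intros s Hs; rewrite <- E by exact Hs; now apply H1|]).
- destruct lip; [|exact I]. intros s t Hs Ht. rewrite <- !E by assumption. now apply H2.
- destruct H2 as [f' [Hd Hf']]. exists f'. split; [|exact Hf'].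
  intros s Hs. apply (is_derive_ext_loc f); [|now apply Hd].
  now apply (locally_open_interval (- b) b).
Qed.

Lemma diff_class_const (lip : bool) (n : nat) (b B c : R) :
  Rabs c <= B -> diff_class lip n b B (fun _ => c).
Proof.
revert c. induction n as [|n IH]; intros c Hc; (split; [now intros|]).
- destruct lip; [|exact I]. intros s t _ _. rewrite Rminus_diag, Rabs_R0.
  apply Rmult_le_pos; [pose proof (Rabs_pos c); lra | apply Rabs_pos].
- exists (fun _ => 0). split; [intros s _; apply (is_derive_const (V := R_NormedModule)) | apply IH].
  rewrite Rabs_R0. pose proof (Rabs_pos c). lra.
Qed.

Lemma diff_class_plus (lip : bool) (n : nat) (b B B' : R) (f g : R -> R) :
  diff_class lip n b B f -> diff_class lip n b B' g ->
  diff_class lip n b (B + B') (fun s => f s + g s).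
Proof.
revert f g. induction n as [|n IH]; intros f g [F1 F2] [G1 G2];
  (split; [intros s Hs; apply Rabs_plus_le; auto|]).
- destruct lip; [|exact I]. intros s t Hs Ht.
  replace (f t + g t - (f s + g s)) with ((f t - f s) + (g t - g s)) by ring.
  rewrite Rmult_plus_distr_r. apply Rabs_plus_le; auto.
- destruct F2 as [f' [Hf Hf']], G2 as [g' [Hg Hg']]. exists (fun s => f' s + g' s). split.
  + intros s Hs. apply (is_derive_plus (V := R_NormedModule)); auto.
  + now apply IH.
Qed.

(** The product rule doubles the bound at each order, and the Lipschitz estimate of the last
    derivative doubles it once more, hence [2 ^ (S n)]. *)
Lemma diff_class_mult (lip : bool) (n : nat) (b B B' : R) (f g : R -> R) :
  0 <= B -> 0 <= B' -> diff_class lip n b B f -> diff_class lip n b B' g ->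
  diff_class lip n b (2 ^ (S n) * (B * B')) (fun s => f s * g s).
Proof.
intros HB HB'.
assert (Hbd : forall k (f g : R -> R) s, Rabs (f s) <= B -> Rabs (g s) <= B' ->
  Rabs (f s * g s) <= 2 ^ (S k) * (B * B')).
{ intros k f0 g0 s H1 H2. rewrite Rabs_mult.
  apply Rle_trans with (1 * (B * B')).
  - rewrite Rmult_1_l. apply Rmult_le_compat; auto using Rabs_pos.
  - apply Rmult_le_compat_r; [now apply Rmult_le_pos | apply pow_R1_Rle; lra]. }
revert f g. induction n as [|n IH]; intros f g F G; split.
- intros s Hs. apply Hbd; [now apply F | now apply G].
- destruct lip; [|exact I]. intros s t Hs Ht. destruct F as [F1 F2], G as [G1 G2].
  replace (f t * g t - f s * g s) with ((f t - f s) * g t + f s * (g t - g s)) by ring.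
  eapply Rle_trans; [apply Rabs_triang|]. rewrite !Rabs_mult.
  specialize (F2 s t Hs Ht). specialize (G2 s t Hs Ht).
  specialize (F1 s Hs). specialize (G1 t Ht).
  pose proof (Rabs_pos (f t - f s)). pose proof (Rabs_pos (g t - g s)).
  pose proof (Rabs_pos (f s)). pose proof (Rabs_pos (g t)). pose proof (Rabs_pos (t - s)).
  simpl.
  apply Rle_trans with (B * Rabs (t - s) * B' + B * (B' * Rabs (t - s))).
  + apply Rplus_le_compat; apply Rmult_le_compat; auto.
  + apply Req_le. ring.
- intros s Hs. apply Hbd; [now apply (diff_class_bound lip (S n) b) | now apply (diff_class_bound lip (S n) b)].
- pose proof (diff_class_pred _ _ _ _ _ F) as F0. pose proof (diff_class_pred _ _ _ _ _ G) as G0.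
  destruct F as [F1 [f' [Hf Hf']]], G as [G1 [g' [Hg Hg']]].
  exists (fun s => f' s * g s + f s * g' s). split.
  + intros s Hs. specialize (Hf s Hs). specialize (Hg s Hs).
    apply (is_derive_mult (K := R_AbsRing) f g s); auto. intros; apply Rmult_comm.
  + replace (2 ^ S (S n) * (B * B')) with (2 ^ S n * (B * B') + 2 ^ S n * (B * B')) by (simpl; ring).
    apply diff_class_plus; apply IH; auto.
Qed.

Lemma is_derive_rsqrt (f : R -> R) (x l : R) :
  0 < f x -> is_derive f x l ->
  is_derive (fun s => / sqrt (f s)) x (- / 2 * (l * (/ sqrt (f x) * (/ sqrt (f x) * / sqrt (f x))))).
Proof.
intros Hp Hd. assert (Hs := sqrt_lt_R0 _ Hp). auto_derive.
- split; [now exists l|]. split; [exact Hp|]. split; [lra | exact I].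
- rewrite (is_derive_unique (fun x : R => f x) x l Hd). field. lra.
Qed.

(** The derivative of f^(-1/2) is -f' (f^(-1/2))^3 / 2, so order n + 1 follows from order n by
    products. The bound is fixed before [b] and [f], which keeps later estimates uniform in the
    turning points. *)
Lemma diff_class_rsqrt (lip : bool) (n : nat) (B c : R) :
  0 <= B -> 0 < c -> exists B', 0 <= B' /\ forall b f,
    diff_class lip n b B f -> (forall s, - b < s < b -> c <= f s) ->
    diff_class lip n b B' (fun s => / sqrt (f s)).
Proof.
intros HB Hc. assert (Hsc := sqrt_lt_R0 _ Hc).
assert (Hbd : forall y, c <= y -> 0 < / sqrt y <= / sqrt c).
{ intros y Hy. split.
  - apply Rinv_0_lt_compat, sqrt_lt_R0. lra.
  - apply Rinv_le_contravar; [exact Hsc | now apply sqrt_le_1_alt]. }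
induction n as [|n [B' [HB' IH]]].
- exists (/ sqrt c + B * (/ sqrt c * (/ sqrt c * / sqrt c))).
  assert (Hi := Rinv_0_lt_compat _ Hsc). set (q := / sqrt c) in *.
  assert (Hq : 0 <= q * (q * q)) by (apply Rmult_le_pos; nra).
  assert (HBq : 0 <= B * (q * (q * q))) by (now apply Rmult_le_pos).
  split; [lra|]. intros b f [H1 H2] Hf. split.
  + intros s Hs. destruct (Hbd (f s) (Hf s Hs)) as [P1 P2].
    rewrite Rabs_pos_eq by lra. lra.
  + destruct lip; [|exact I]. intros s t Hs Ht.
    assert (Es := Hbd _ (Hf s Hs)). assert (Et := Hbd _ (Hf t Ht)).
    assert (Ps : 0 < sqrt (f s)) by (apply sqrt_lt_R0; specialize (Hf s Hs); lra).
    assert (Pt : 0 < sqrt (f t)) by (apply sqrt_lt_R0; specialize (Hf t Ht); lra).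
    assert (Qs : sqrt (f s) * sqrt (f s) = f s) by (apply sqrt_sqrt; specialize (Hf s Hs); lra).
    assert (Qt : sqrt (f t) * sqrt (f t) = f t) by (apply sqrt_sqrt; specialize (Hf t Ht); lra).
    set (x := sqrt (f s)) in *. set (y := sqrt (f t)) in *.
    assert (Hxy : / (x + y) <= q).
    { apply Rle_trans with (/ y); [apply Rinv_le_contravar; lra | lra]. }
    assert (E : / y - / x = (- (f t - f s)) * (/ x * (/ y * / (x + y)))).
    { rewrite <- Qs, <- Qt. field. lra. }
    rewrite E, Rabs_mult, Rabs_Ropp.
    assert (Pp : 0 < / (x + y)) by (apply Rinv_0_lt_compat; lra).
    rewrite (Rabs_pos_eq (/ x * (/ y * / (x + y)))) by (apply Rmult_le_pos; nra).
    specialize (H2 s t Hs Ht). pose proof (Rabs_pos (f t - f s)). pose proof (Rabs_pos (t - s)).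
    assert (Hprod : / x * (/ y * / (x + y)) <= q * (q * q)).
    { apply Rmult_le_compat; [lra | nra | lra |]. apply Rmult_le_compat; lra. }
    apply Rle_trans with (B * Rabs (t - s) * (q * (q * q))).
    * apply Rmult_le_compat; [lra | apply Rmult_le_pos; nra | lra | lra].
    * nra.
- exists (/ sqrt c + 2 ^ S n * (Rabs (- / 2) * (2 ^ S n * (B * (2 ^ S n * (B' * (2 ^ S n * (B' * B')))))))).
  assert (Hi := Rinv_0_lt_compat _ Hsc).
  assert (P2 : 0 <= 2 ^ S n) by (apply pow_le; lra).
  assert (PB : 0 <= 2 ^ S n * (B' * (2 ^ S n * (B' * B')))) by (repeat (assumption || apply Rmult_le_pos)).
  assert (PC : 0 <= 2 ^ S n * (B * (2 ^ S n * (B' * (2 ^ S n * (B' * B')))))) by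
    (apply Rmult_le_pos; [|apply Rmult_le_pos]; lra).
  assert (PD : 0 <= 2 ^ S n * (Rabs (- / 2) * (2 ^ S n * (B * (2 ^ S n * (B' * (2 ^ S n * (B' * B'))))))))
    by (apply Rmult_le_pos; [|apply Rmult_le_pos; [apply Rabs_pos|]]; lra).
  split; [lra|]. intros b f F Hf. split.
  + intros s Hs. destruct (Hbd (f s) (Hf s Hs)) as [Q1 Q2].
    rewrite Rabs_pos_eq by lra. lra.
  + pose proof (IH b f (diff_class_pred _ _ _ _ _ F) Hf) as G.
    destruct F as [F1 [f' [Hd Hf']]].
    exists (fun s => - / 2 * (f' s * (/ sqrt (f s) * (/ sqrt (f s) * / sqrt (f s))))). split.
    * intros s Hs. apply is_derive_rsqrt; [specialize (Hf s Hs); lra | now apply Hd].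
    * assert (PA : 0 <= 2 ^ S n * (B' * B')) by (repeat (assumption || apply Rmult_le_pos)).
      pose proof (diff_class_mult lip n b B' B' _ _ HB' HB' G G) as G2.
      pose proof (diff_class_mult lip n b B' _ _ _ HB' PA G G2) as G3.
      pose proof (diff_class_mult lip n b B _ f' _ HB PB Hf' G3) as G4.
      pose proof (diff_class_mult lip n b (Rabs (- / 2)) _ (fun _ => - / 2) _ (Rabs_pos _) PC
        (diff_class_const lip n b _ _ (Rle_refl _)) G4) as G5.
      revert G5. apply diff_class_weaken; lra.
Qed.

(** * Averages along segments and division by a zero *)

Lemma segment_interval (lo hi c s t : R) :
  lo < c < hi -> lo < s < hi -> 0 <= t <= 1 -> lo < c + t * (s - c) < hi.
Proof.
intros Hc Hs Ht. destruct (Req_dec t 1) as [->|H1]; [lra|].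
pose proof (Rmult_lt_0_compat (1 - t) (c - lo)). pose proof (Rmult_le_pos t (s - lo)).
pose proof (Rmult_lt_0_compat (1 - t) (hi - c)). pose proof (Rmult_le_pos t (hi - s)).
nra.
Qed.

Lemma ex_RInt_continuous_interval (f : R -> R) (a b : R) :
  a <= b -> (forall x, a <= x <= b -> continuous f x) -> ex_RInt f a b.
Proof.
intros Hab H. apply (ex_RInt_continuous (V := R_CompleteNormedModule)).
intros z. rewrite Rmin_left, Rmax_right by exact Hab. apply H.
Qed.

Lemma continuous_affine (c d t : R) : continuous (fun t => c + t * d) t.
Proof.
apply (derive_continuous _ _ d). auto_derive; [exact I | ring].
Qed.

Lemma continuous_affine_param (lo hi c s : R) (g F : R -> R) :
  lo < c < hi -> lo < s < hi ->
  (forall x, lo < x < hi -> continuous F x) -> (forall t, continuous g t) ->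
  forall t, 0 <= t <= 1 -> continuous (fun t => g t * F (c + t * (s - c))) t.
Proof.
intros Hc Hs HF Hg t Ht.
apply (continuous_mult (K := R_AbsRing)); [apply Hg|].
apply (continuous_comp (fun t => c + t * (s - c)) F); [apply continuous_affine|].
apply HF. now apply segment_interval.
Qed.

Lemma ex_RInt_affine_param (lo hi c s : R) (g F : R -> R) :
  lo < c < hi -> lo < s < hi ->
  (forall x, lo < x < hi -> continuous F x) -> (forall t, continuous g t) ->
  ex_RInt (fun t => g t * F (c + t * (s - c))) 0 1.
Proof.
intros Hc Hs HF Hg. apply ex_RInt_continuous_interval; [lra|].
now apply (continuous_affine_param lo hi).
Qed.

(** The weight [g] is general because two kinds occur: t^j for Hadamard quotients and sqrt(t) t^j
    for the singular equation. *)
Lemma is_derive_affine_param (lo hi c : R) (g F F' : R -> R) :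
  lo < c < hi -> (forall t, continuous g t) ->
  (forall x, lo < x < hi -> is_derive F x (F' x)) ->
  (forall x, lo < x < hi -> continuous F' x) ->
  forall s, lo < s < hi ->
  is_derive (fun s => RInt (fun t => g t * F (c + t * (s - c))) 0 1) s
    (RInt (fun t => g t * (t * F' (c + t * (s - c)))) 0 1).
Proof.
intros Hc Hg HF HF' s Hs.
assert (HFc : forall x, lo < x < hi -> continuous F x).
{ intros x Hx. apply (derive_continuous F x (F' x)). now apply HF. }
assert (Hder : forall u v, lo < c + v * (u - c) < hi ->
  is_derive (fun z => g v * F (c + v * (z - c))) u (g v * (v * F' (c + v * (u - c))))).
{ intros u v Huv. specialize (HF _ Huv). auto_derive.
  - now exists (F' (c + v * (u - c))).
  - replace (c + v * (u + - c)) with (c + v * (u - c)) by ring.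
    derive_subst HF. ring. }
rewrite (RInt_ext (fun t => g t * (t * F' (c + t * (s - c))))
  (fun t => Derive (fun z => g t * F (c + t * (z - c))) s)).
2:{ intros t. rewrite Rmin_left, Rmax_right by lra. intros Ht.
    symmetry. apply is_derive_unique, Hder. apply segment_interval; auto; lra. }
apply (is_derive_RInt_param (fun z t => g t * F (c + t * (z - c)))).
- apply (locally_open_interval lo hi s); [exact Hs|]. intros y Hy t.
  rewrite Rmin_left, Rmax_right by lra. intros Ht.
  eexists. apply Hder. now apply segment_interval.
- intros t. rewrite Rmin_left, Rmax_right by lra. intros Ht.
  assert (Hp : continuity_2d_pt (fun u v => c + v * (u - c)) s t).
  { apply continuity_2d_pt_plus; [apply continuity_2d_pt_const|].
    apply continuity_2d_pt_mult; [apply continuity_2d_pt_id2|].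
    apply continuity_2d_pt_minus; [apply continuity_2d_pt_id1 | apply continuity_2d_pt_const]. }
  assert (Hin := segment_interval lo hi c s t Hc Hs Ht).
  assert (He : 0 < Rmin (c + t * (s - c) - lo) (hi - (c + t * (s - c)))) by (apply Rmin_pos; lra).
  apply continuity_2d_pt_ext_loc with (fun u v => g v * (v * F' (c + v * (u - c)))).
  + destruct (Hp (mkposreal _ He)) as [d Hd]. exists d. intros u v Hu Hv.
    specialize (Hd u v Hu Hv). simpl in Hd. apply Rabs_def2 in Hd.
    pose proof (Rmin_l (c + t * (s - c) - lo) (hi - (c + t * (s - c)))).
    pose proof (Rmin_r (c + t * (s - c) - lo) (hi - (c + t * (s - c)))).
    symmetry. apply is_derive_unique, Hder. lra.
  + apply continuity_2d_pt_mult.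
    * apply (continuity_1d_2d_pt_comp g (fun _ v => v)); [|apply continuity_2d_pt_id2].
      apply continuity_pt_filterlim, Hg.
    * apply continuity_2d_pt_mult; [apply continuity_2d_pt_id2|].
      apply (continuity_1d_2d_pt_comp F' (fun u v => c + v * (u - c))); [|exact Hp].
      apply continuity_pt_filterlim, HF', Hin.
- apply (locally_open_interval lo hi s); [exact Hs|]. intros y Hy.
  now apply (ex_RInt_affine_param lo hi).
Qed.

Lemma abs_RInt_le_interval (f : R -> R) (a b M : R) :
  a <= b -> (forall t, a <= t <= b -> continuous f t) ->
  (forall t, a <= t <= b -> Rabs (f t) <= M) ->
  Rabs (RInt f a b) <= (b - a) * M.
Proof.
intros Hab Hf HM. apply abs_RInt_le_const; auto. now apply ex_RInt_continuous_interval.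
Qed.

Lemma pow_le_1 (t : R) (j : nat) : 0 <= t <= 1 -> 0 <= t ^ j <= 1.
Proof.
intros Ht. induction j as [|j IH]; simpl; [lra | nra].
Qed.

Lemma continuous_pow (j : nat) (t : R) : continuous (fun t => t ^ j) t.
Proof.
apply (derive_continuous _ _ (INR j * t ^ pred j)). auto_derive; [exact I | ring].
Qed.

(** Each derivative in s brings out a factor t, so the induction runs over all [j] at once. The
    weight is at most 1 on an interval of length 1, so the bound [B] does not grow. *)
Lemma lip_class_affine_param (n : nat) (b B c : R) :
  - b < c < b -> forall j F, lip_class n b B F ->
  lip_class n b B (fun s => RInt (fun t => t ^ j * F (c + t * (s - c))) 0 1).
Proof.
intros Hc.
assert (Hbound : forall j F s, - b < s < b -> (forall x, - b < x < b -> continuous F x) ->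
  (forall x, - b < x < b -> Rabs (F x) <= B) ->
  Rabs (RInt (fun t => t ^ j * F (c + t * (s - c))) 0 1) <= B).
{ intros j F s Hs HFc HFb. replace B with ((1 - 0) * B) by ring.
  apply abs_RInt_le_interval; [lra | |].
  - apply (continuous_affine_param (- b) b); auto. apply continuous_pow.
  - intros t Ht. rewrite Rabs_mult. destruct (pow_le_1 t j Ht) as [P1 P2].
    rewrite (Rabs_pos_eq (t ^ j)) by exact P1.
    specialize (HFb _ (segment_interval _ _ _ _ _ Hc Hs Ht)).
    pose proof (Rabs_pos (F (c + t * (s - c)))). nra. }
induction n as [|n IH]; intros j F HF.
- split.
  + intros s Hs. apply Hbound; auto; [intros; now apply (lip_class_continuous 0 b B) | apply HF].
  + intros s u Hs Hu.
    assert (HFc : forall x, - b < x < b -> continuous F x)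
      by (intros; now apply (lip_class_continuous 0 b B)).
    assert (Hex : forall s, - b < s < b -> ex_RInt (fun t => t ^ j * F (c + t * (s - c))) 0 1).
    { intros. apply (ex_RInt_affine_param (- b) b); auto using continuous_pow. }
    assert (E := RInt_minus (V := R_CompleteNormedModule) _ _ 0 1 (Hex u Hu) (Hex s Hs)).
    eapply Rle_trans; [apply Req_le, (f_equal Rabs); symmetry; exact E|].
    replace (B * Rabs (u - s)) with ((1 - 0) * (B * Rabs (u - s))) by ring.
    apply abs_RInt_le_interval; [lra | |].
    * intros t Ht. apply (continuous_minus (V := R_NormedModule)
        (fun t => t ^ j * F (c + t * (u - c))) (fun t => t ^ j * F (c + t * (s - c))));
      apply (continuous_affine_param (- b) b); auto using continuous_pow.
    * intros t Ht. destruct (pow_le_1 t j Ht) as [P1 P2].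
      change (Rabs (t ^ j * F (c + t * (u - c)) - t ^ j * F (c + t * (s - c)))
        <= B * Rabs (u - s)).
      rewrite <- Rmult_minus_distr_l.
      rewrite Rabs_mult, (Rabs_pos_eq (t ^ j)) by exact P1.
      assert (HL := proj2 HF _ _ (segment_interval _ _ _ _ _ Hc Hs Ht)
                                 (segment_interval _ _ _ _ _ Hc Hu Ht)).
      replace (c + t * (u - c) - (c + t * (s - c))) with (t * (u - s)) in HL by ring.
      rewrite Rabs_mult, (Rabs_pos_eq t) in HL by lra.
      assert (HB : 0 <= B) by (eapply Rle_trans; [apply Rabs_pos | apply (proj1 HF s Hs)]).
      pose proof (Rabs_pos (u - s)).
      pose proof (Rabs_pos (F (c + t * (u - c)) - F (c + t * (s - c)))).
      apply Rle_trans with (Rabs (F (c + t * (u - c)) - F (c + t * (s - c)))); [nra|].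
      eapply Rle_trans; [exact HL|]. apply Rmult_le_compat_l; [exact HB | nra].
- split.
  + intros s Hs. apply Hbound; auto;
      [intros; now apply (lip_class_continuous (S n) b B) | apply HF].
  + destruct HF as [F1 [F' [Hd HF']]].
    exists (fun s => RInt (fun t => t ^ S j * F' (c + t * (s - c))) 0 1).
    split; [|now apply IH]. intros s Hs.
    erewrite RInt_ext.
    { apply (is_derive_affine_param (- b) b c (fun t => t ^ j) F F'); auto using continuous_pow.
      intros. now apply (lip_class_continuous n b B). }
    intros t _. simpl. ring.
Qed.

(** The quotient is the average of f' over the segment from c to s. It costs one derivative but no
    constant, wherever the zero c lies in the interval. *)
Lemma hadamard_quotient (n : nat) (b B c : R) (f : R -> R) :
  - b < c < b -> f c = 0 -> lip_class (S n) b B f ->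
  exists A, lip_class n b B A /\ forall s, - b < s < b -> f s = (s - c) * A s.
Proof.
intros Hc H0 [F1 [f' [Hd Hf']]].
exists (fun s => RInt (fun t => t ^ 0 * f' (c + t * (s - c))) 0 1).
split; [now apply lip_class_affine_param|]. intros s Hs.
assert (H : is_RInt (fun t => (s - c) * (t ^ 0 * f' (c + t * (s - c)))) 0 1 (f s - f c)).
{ replace (f s - f c) with (minus (f (c + 1 * (s - c))) (f (c + 0 * (s - c)))).
  2:{ unfold minus, plus, opp; simpl. replace (c + 1 * (s - c)) with s by ring.
      replace (c + 0 * (s - c)) with c by ring. ring. }
  apply (is_RInt_derive (V := R_CompleteNormedModule) (fun t => f (c + t * (s - c)))).
  - intros t. rewrite Rmin_left, Rmax_right by lra. intros Ht.
    specialize (Hd _ (segment_interval _ _ _ _ _ Hc Hs Ht)).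
    auto_derive; [now exists (f' (c + t * (s - c)))|].
    replace (s + - c) with (s - c) by ring.
    derive_subst Hd. simpl. ring.
  - intros t. rewrite Rmin_left, Rmax_right by lra. intros Ht.
    apply (continuous_mult (K := R_AbsRing) (fun _ => s - c)); [apply continuous_const|].
    apply (continuous_affine_param (- b) b c s (fun t => t ^ 0) f'); auto using continuous_pow.
    intros. now apply (lip_class_continuous n b B). }
rewrite H0 in H. replace (f s - 0) with (f s) in H by ring.
rewrite <- (is_RInt_unique _ _ _ _ H). apply (RInt_scal (V := R_CompleteNormedModule)).
apply (ex_RInt_affine_param (- b) b c s (fun t => t ^ 0) f'); auto using continuous_pow.
intros. now apply (lip_class_continuous n b B).
Qed.

(** * The singular linear equation *)

(** Since [sqrt] vanishes on negative numbers, x^(3/2) is differentiable on the whole line, 0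
    included. This lets the fundamental theorem run up to the turning points without improper
    integrals. *)
Lemma is_derive_mult_sqrt (x : R) : is_derive (fun x => x * sqrt x) x (3 / 2 * sqrt x).
Proof.
destruct (Rtotal_order x 0) as [Hx | [-> | Hx]].
- rewrite sqrt_neg_0 by lra. rewrite Rmult_0_r.
  apply (is_derive_ext_loc (fun _ => 0)); [|apply (is_derive_const (V := R_NormedModule))].
  apply (locally_open_interval (x - 1) 0); [lra|]. intros y Hy. rewrite sqrt_neg_0 by lra. now rewrite Rmult_0_r.
- rewrite sqrt_0, Rmult_0_r. apply is_derive_Reals. intros e He.
  assert (He2 : 0 < e * e) by nra. exists (mkposreal _ He2). simpl. intros h Hh Hle.
  replace (((0 + h) * sqrt (0 + h) - 0 * sqrt 0) / h - 0) with (sqrt h)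
    by (rewrite Rplus_0_l; field; exact Hh).
  rewrite Rabs_pos_eq by apply sqrt_pos.
  destruct (Rle_dec h 0) as [H0|H0]; [rewrite sqrt_neg_0; lra|].
  rewrite Rabs_pos_eq in Hle by lra.
  rewrite <- (sqrt_square e) by lra. apply sqrt_lt_1_alt. lra.
- auto_derive; [exact Hx|]. assert (H := sqrt_lt_R0 _ Hx).
  assert (E := sqrt_sqrt x (Rlt_le _ _ Hx)). set (q := sqrt x) in *. rewrite <- E. field. lra.
Qed.

Lemma continuous_sqrt_pow (j : nat) (t : R) : continuous (fun t => sqrt t * t ^ j) t.
Proof.
apply (continuous_mult (K := R_AbsRing)); [apply continuous_sqrt | apply continuous_pow].
Qed.

Lemma Rabs_plus3_le (x y z a b c : R) :
  Rabs x <= a -> Rabs y <= b -> Rabs z <= c -> Rabs (x + y + z) <= a + b + c.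
Proof.
intros. eapply Rle_trans; [apply Rabs_triang|].
apply Rplus_le_compat; [|assumption].
eapply Rle_trans; [apply Rabs_triang|]. now apply Rplus_le_compat.
Qed.

(* Substituting x = l + t (s - l) turns the variation-of-constants formula
   h(s) = (s^2 - l^2)^(-3/2) int_l^s (x^2 - l^2)^(1/2) k(x) dx into an average
   over t in [0, 1], which is regular at s = l. *)
Lemma regular_solution_right (D b l : R) (k k1 k2 : R -> R) :
  0 < l < b -> 0 <= D ->
  (forall s, - b < s < b -> is_derive k s (k1 s)) ->
  (forall s, - b < s < b -> is_derive k1 s (k2 s)) ->
  (forall s, - b < s < b -> continuous k2 s) ->
  (forall s, 0 <= s < b -> Rabs (k s) <= D * (s + l) ^ 3) ->
  (forall s, 0 <= s < b -> Rabs (k1 s) <= D * (s + l) ^ 2) ->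
  (forall s, 0 <= s < b -> Rabs (k2 s) <= D * (s + l)) ->
  exists h h1 h2 : R -> R,
    (forall s, - l < s < b -> is_derive h s (h1 s) /\ is_derive h1 s (h2 s) /\
       (s ^ 2 - l ^ 2) * h1 s + 3 * s * h s = k s) /\
    (forall s, 0 <= s < b -> Rabs (h s) <= 16 * D * (s + l) ^ 2 /\
       Rabs (h1 s) <= 36 * D * (s + l) /\ Rabs (h2 s) <= 105 * D).
Proof.
intros Hl HD Hk Hk1 Hk2c B0 B1 B2.
(* In sqrt(x^2 - l^2) the factor sqrt(x + l), smooth to the right of -l, stays with k, while sqrt(x
   - l) becomes sqrt(t) after the substitution. [M1] and [M2] are the derivatives of [M0]. *)
set (M0 := fun x => sqrt (x + l) * k x).
set (M1 := fun x => k x / (2 * sqrt (x + l)) + sqrt (x + l) * k1 x).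
set (M2 := fun x => - k x / (4 * (x + l) * sqrt (x + l)) + k1 x / sqrt (x + l) + sqrt (x + l) * k2 x).
assert (DM0 : forall x, - l < x < b -> is_derive M0 x (M1 x)).
{ intros x Hx. unfold M0, M1. specialize (Hk x ltac:(lra)).
  assert (Hs : 0 < sqrt (x + l)) by (apply sqrt_lt_R0; lra). auto_derive.
  - split; [lra|]. split; [now exists (k1 x) | exact I].
  - derive_subst Hk. field. lra. }
assert (DM1 : forall x, - l < x < b -> is_derive M1 x (M2 x)).
{ intros x Hx. unfold M1, M2. specialize (Hk x ltac:(lra)). specialize (Hk1 x ltac:(lra)).
  assert (Hs : 0 < sqrt (x + l)) by (apply sqrt_lt_R0; lra). auto_derive.
  - repeat split; try lra; [now exists (k1 x) | now exists (k2 x)].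
  - derive_subst Hk. derive_subst Hk1.
    assert (E := sqrt_sqrt (x + l) ltac:(lra)). set (q := sqrt (x + l)) in *. rewrite <- E.
    field. lra. }
assert (Hcont : forall f f', (forall s, - l < s < b -> is_derive f s (f' s)) ->
  forall s, - l < s < b -> continuous f s)
  by (intros f f' H s Hs; apply (derive_continuous f s (f' s)); auto).
assert (CM0 := Hcont _ _ DM0). assert (CM1 := Hcont _ _ DM1).
assert (Csq : forall x, - l < x < b -> continuous (fun x => sqrt (x + l)) x).
{ intros x Hx. apply (derive_continuous _ _ (/ (2 * sqrt (x + l)))). auto_derive; [lra|].
  field. apply Rgt_not_eq, sqrt_lt_R0. lra. }
assert (Cinv : forall x, - l < x < b -> continuous (fun x => / sqrt (x + l)) x).
{ intros x Hx. apply (continuous_comp (fun x => sqrt (x + l)) Rinv); [now apply Csq|].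
  apply continuous_Rinv. apply Rgt_not_eq, sqrt_lt_R0. lra. }
assert (CM2 : forall s, - l < s < b -> continuous M2 s).
{ intros x Hx. unfold M2.
  assert (Ck : continuous k x) by (apply (derive_continuous k x (k1 x)); apply Hk; lra).
  assert (Ck1 : continuous k1 x) by (apply (derive_continuous k1 x (k2 x)); apply Hk1; lra).
  apply (continuous_plus (V := R_NormedModule)).
  1: apply (continuous_plus (V := R_NormedModule)).
  - unfold Rdiv. apply (continuous_mult (K := R_AbsRing)).
    + now apply (continuous_opp (V := R_NormedModule)).
    + apply (derive_continuous _ _ (- (4 * sqrt (x + l) + 4 * (x + l) * (/ (2 * sqrt (x + l)))) /
        (4 * (x + l) * sqrt (x + l)) ^ 2)).
      assert (Hs : 0 < sqrt (x + l)) by (apply sqrt_lt_R0; lra).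
      auto_derive; [split; [lra | split; [|exact I]; apply Rgt_not_eq; nra]|]. field. split; lra.
  - now apply (continuous_mult (K := R_AbsRing) k1); [|apply Cinv].
  - apply (continuous_mult (K := R_AbsRing)); [now apply Csq | apply Hk2c; lra]. }
set (N := (fun j M s =>
  RInt (fun t => (sqrt t * t ^ j) * M (l + t * (s - l))) 0 1) : nat -> (R -> R) -> R -> R).
assert (DN : forall j M M', (forall s, - l < s < b -> is_derive M s (M' s)) ->
  (forall s, - l < s < b -> continuous M' s) ->
  forall s, - l < s < b -> is_derive (N j M) s (N (S j) M' s)).
{ intros j M M' HM HM' s Hs. unfold N.
  rewrite (RInt_ext (fun t => sqrt t * t ^ S j * M' (l + t * (s - l)))
    (fun t => sqrt t * t ^ j * (t * M' (l + t * (s - l))))) by (intros; simpl; ring).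
  apply (is_derive_affine_param (- l) b l (fun t => sqrt t * t ^ j) M M'); auto;
    [lra | apply continuous_sqrt_pow]. }
assert (DN0 := DN 0%nat M0 M1 DM0 CM1). assert (DN1 := DN 1%nat M1 M2 DM1 CM2).
(* The derivative of t^(3/2) M0(l + t (s - l)) is integrated over [0, 1]. Divided by sqrt(s + l),
   the resulting identity is the differential equation. *)
assert (Hftc : forall s, - l < s < b -> 3 / 2 * N 0%nat M0 s + (s - l) * N 1%nat M1 s = M0 s).
{ intros s Hs.
  assert (H : is_RInt (fun t => 3 / 2 * (sqrt t * t ^ 0 * M0 (l + t * (s - l))) +
    (s - l) * (sqrt t * t ^ 1 * M1 (l + t * (s - l)))) 0 1 (M0 s)).
  { replace (M0 s) with (minus ((1 * sqrt 1) * M0 (l + 1 * (s - l))) ((0 * sqrt 0) * M0 (l + 0 * (s - l)))).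
    2:{ rewrite sqrt_1. unfold minus, plus, opp; simpl.
        replace (l + 1 * (s - l)) with s by ring. ring. }
    apply (is_RInt_derive (V := R_CompleteNormedModule)
      (fun t => (t * sqrt t) * M0 (l + t * (s - l)))).
    - intros t. rewrite Rmin_left, Rmax_right by lra. intros Ht.
      assert (Hseg : - l < l + t * (s - l) < b) by (apply segment_interval; lra).
      assert (Hc : is_derive (fun t => M0 (l + t * (s - l))) t ((s - l) * M1 (l + t * (s - l)))).
      { specialize (DM0 _ Hseg). auto_derive; [now exists (M1 (l + t * (s - l)))|].
        replace (s + - l) with (s - l) by ring. derive_subst DM0. ring. }
      assert (Hm := is_derive_mult_sqrt t).
      pose proof (is_derive_mult (K := R_AbsRing) _ _ t _ _ Hm Hc (fun n m => Rmult_comm n m)) as H.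
      unfold plus, mult in H; simpl in H.
      evar_last; [exact H|]. simpl. ring.
    - intros t. rewrite Rmin_left, Rmax_right by lra. intros Ht.
      apply (continuous_plus (V := R_NormedModule));
        (apply (continuous_mult (K := R_AbsRing)); [apply continuous_const|]).
      + apply (continuous_affine_param (- l) b l s (fun t => sqrt t * t ^ 0) M0); auto;
          [lra | apply continuous_sqrt_pow].
      + apply (continuous_affine_param (- l) b l s (fun t => sqrt t * t ^ 1) M1); auto;
          [lra | apply continuous_sqrt_pow]. }
  rewrite <- (is_RInt_unique _ _ _ _ H).
  assert (E0 : ex_RInt (fun t => sqrt t * t ^ 0 * M0 (l + t * (s - l))) 0 1).
  { apply (ex_RInt_affine_param (- l) b l s (fun t => sqrt t * t ^ 0) M0); auto; [lra | apply continuous_sqrt_pow]. }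
  assert (E1 : ex_RInt (fun t => sqrt t * t ^ 1 * M1 (l + t * (s - l))) 0 1).
  { apply (ex_RInt_affine_param (- l) b l s (fun t => sqrt t * t ^ 1) M1); auto; [lra | apply continuous_sqrt_pow]. }
  symmetry. apply is_RInt_unique.
  apply (is_RInt_plus (V := R_NormedModule));
    apply (is_RInt_scal (V := R_NormedModule)); now apply (RInt_correct (V := R_CompleteNormedModule)). }
(* The remaining factor (s + l)^(-3/2) of the variation-of-constants formula. It is singular at -l,
   so the bounds are stated for s >= 0 only. *)
set (Q := fun s => / ((s + l) * sqrt (s + l))).
assert (DQ : forall s, - l < s < b -> is_derive Q s (- (3 / 2) * (Q s / (s + l)))).
{ intros s Hs. unfold Q. assert (Hq : 0 < sqrt (s + l)) by (apply sqrt_lt_R0; lra).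
  auto_derive; [split; [lra | split; [|exact I]; apply Rgt_not_eq; nra]|].
  assert (E := sqrt_sqrt (s + l) ltac:(lra)). set (q := sqrt (s + l)) in *. rewrite <- E. field. lra. }
exists (fun s => N 0%nat M0 s * Q s),
  (fun s => N 1%nat M1 s * Q s - 3 / 2 * (N 0%nat M0 s * (Q s / (s + l)))),
  (fun s => N 2%nat M2 s * Q s - 3 * (N 1%nat M1 s * (Q s / (s + l))) +
     15 / 4 * (N 0%nat M0 s * (Q s / (s + l) ^ 2))).
split.
- intros s Hs. specialize (DN0 s Hs). specialize (DN1 s Hs). specialize (DQ s Hs).
  split; [|split].
  + revert DN0 DN1 DQ. generalize (N 0%nat M0) (N 1%nat M1) (N 2%nat M2) Q.
    intros n0 n1 n2 q DN0 DN1 DQ.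
    auto_derive; [repeat split; eexists; eassumption|].
    derive_subst DN0. derive_subst DQ. field. lra.
  + revert DN0 DN1 DQ. generalize (N 0%nat M0) (N 1%nat M1) (N 2%nat M2) Q.
    intros n0 n1 n2 q DN0 DN1 DQ.
    auto_derive; [repeat split; try lra; eexists; eassumption|].
    derive_subst DN0. derive_subst DQ.
    derive_subst DN1. field. lra.
  + specialize (Hftc s Hs). unfold M0 at 2 in Hftc. unfold Q.
    assert (Hq : 0 < sqrt (s + l)) by (apply sqrt_lt_R0; lra).
    assert (Hks : k s = (3 / 2 * N 0%nat M0 s + (s - l) * N 1%nat M1 s) / sqrt (s + l)).
    { rewrite Hftc. field. lra. }
    rewrite Hks. field. lra.
- intros s Hs. set (p := s + l). assert (Hp : 0 < p) by (unfold p; lra).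
  assert (Hq : 0 < sqrt p) by now apply sqrt_lt_R0.
  assert (Eq : sqrt p * sqrt p = p) by (apply sqrt_sqrt; lra).
  (* A point x between l and s has x + l <= 2 (s + l), so the growth of k passes to the averages up
     to powers of 2. The constants 16, 12 and 9 obtained below give 36 = 12 + 24 and 105 = 9 + 36 +
     60. *)
  assert (HN : forall j M C, (forall s, - l < s < b -> continuous M s) ->
    (forall x, 0 <= x < b -> x + l <= 2 * p -> Rabs (M x) <= C) -> Rabs (N j M s) <= C).
  { intros j M C HMc HM. unfold N. replace C with ((1 - 0) * C) by ring.
    apply abs_RInt_le_interval; [lra | |].
    - intros t Ht. apply (continuous_affine_param (- l) b l s (fun t => sqrt t * t ^ j) M); auto;
          [lra | lra | apply continuous_sqrt_pow].
    - intros t Ht.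
      assert (Hx : 0 <= l + t * (s - l) < b).
      { assert (-l < l + t * (s - l) < b) by (apply segment_interval; lra). split; [nra | lra]. }
      assert (Hx2 : l + t * (s - l) + l <= 2 * p) by (unfold p; nra).
      specialize (HM _ Hx Hx2). rewrite Rabs_mult.
      destruct (pow_le_1 t j Ht) as [P1 P2].
      assert (S1 : 0 <= sqrt t <= 1).
      { split; [apply sqrt_pos|]. rewrite <- sqrt_1. apply sqrt_le_1_alt. lra. }
      rewrite (Rabs_pos_eq (sqrt t * t ^ j)) by (apply Rmult_le_pos; lra).
      pose proof (Rabs_pos (M (l + t * (s - l)))).
      assert (sqrt t * t ^ j <= 1) by nra. nra. }
  assert (Hsq2 : forall x, 0 <= x < b -> x + l <= 2 * p ->
    0 < x + l /\ 0 < sqrt (x + l) <= 2 * sqrt p /\ sqrt (x + l) * sqrt (x + l) = x + l).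
  { intros x Hx Hxp. split; [lra|]. split; [split|].
    - apply sqrt_lt_R0. lra.
    - apply Rsqr_incr_0_var; [|lra]. unfold Rsqr. rewrite sqrt_sqrt by lra. nra.
    - apply sqrt_sqrt. lra. }
  assert (BN0 : Rabs (N 0%nat M0 s) <= 16 * D * sqrt p * p ^ 3).
  { apply HN; [exact CM0|]. intros x Hx Hxp. destruct (Hsq2 x Hx Hxp) as (U1 & [U2 U3] & U4).
    unfold M0. rewrite Rabs_mult, Rabs_pos_eq by lra. specialize (B0 x Hx).
    apply Rle_trans with (2 * sqrt p * (D * (2 * p) ^ 3)); [|apply Req_le; ring].
    apply Rmult_le_compat; [lra | apply Rabs_pos | lra|].
    eapply Rle_trans; [exact B0|]. apply Rmult_le_compat_l; [lra|]. apply pow_incr; lra. }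
  assert (BN1 : Rabs (N 1%nat M1 s) <= 12 * D * sqrt p * p ^ 2).
  { apply HN; [exact CM1|]. intros x Hx Hxp. destruct (Hsq2 x Hx Hxp) as (U1 & [U2 U3] & U4).
    unfold M1. set (u := sqrt (x + l)) in *. specialize (B0 x Hx). specialize (B1 x Hx).
    eapply Rle_trans; [apply Rabs_triang|].
    apply Rle_trans with (/ 2 * u * (D * (x + l) ^ 2) + u * (D * (x + l) ^ 2)).
    - apply Rplus_le_compat.
      + unfold Rdiv. rewrite Rabs_mult, (Rabs_pos_eq (/ (2 * u))) by (apply Rlt_le, Rinv_0_lt_compat; lra).
        apply Rle_trans with (D * (x + l) ^ 3 * / (2 * u)).
        * apply Rmult_le_compat_r; [apply Rlt_le, Rinv_0_lt_compat; lra | exact B0].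
        * apply Req_le. rewrite <- U4. field. lra.
      + rewrite Rabs_mult, (Rabs_pos_eq u) by lra. apply Rmult_le_compat_l; lra.
    - apply Rle_trans with ((/ 2 + 1) * (2 * sqrt p) * (D * (2 * p) ^ 2)); [|apply Req_le; field].
      replace (/ 2 * u * (D * (x + l) ^ 2) + u * (D * (x + l) ^ 2)) with
        ((/ 2 + 1) * u * (D * (x + l) ^ 2)) by ring.
      assert (0 <= D * (x + l) ^ 2) by (apply Rmult_le_pos; [lra | apply pow_le; lra]).
      apply Rmult_le_compat; [lra | lra | lra |].
      apply Rmult_le_compat_l; [lra | apply pow_incr; lra]. }
  assert (BN2 : Rabs (N 2%nat M2 s) <= 9 * D * sqrt p * p).
  { apply HN; [exact CM2|]. intros x Hx Hxp. destruct (Hsq2 x Hx Hxp) as (U1 & [U2 U3] & U4).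
    unfold M2. set (u := sqrt (x + l)) in *.
    specialize (B0 x Hx). specialize (B1 x Hx). specialize (B2 x Hx).
    apply Rle_trans with (/ 4 * u * (D * (x + l)) + u * (D * (x + l)) + u * (D * (x + l))).
    - apply Rabs_plus3_le.
      + assert (Hi : 0 < / (4 * (x + l) * u)) by (apply Rinv_0_lt_compat; nra).
        unfold Rdiv. rewrite Rabs_mult, Rabs_Ropp, (Rabs_pos_eq (/ (4 * (x + l) * u))) by lra.
        apply Rle_trans with (D * (x + l) ^ 3 * / (4 * (x + l) * u)).
        * apply Rmult_le_compat_r; lra.
        * apply Req_le. rewrite <- U4. field. lra.
      + assert (Hi : 0 < / u) by (apply Rinv_0_lt_compat; lra).
        unfold Rdiv. rewrite Rabs_mult, (Rabs_pos_eq (/ u)) by lra.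
        apply Rle_trans with (D * (x + l) ^ 2 * / u).
        * apply Rmult_le_compat_r; lra.
        * apply Req_le. rewrite <- U4. field. lra.
      + rewrite Rabs_mult, (Rabs_pos_eq u) by lra. apply Rmult_le_compat_l; lra.
    - apply Rle_trans with (9 / 4 * (2 * sqrt p) * (D * (2 * p))); [|apply Req_le; field].
      replace (/ 4 * u * (D * (x + l)) + u * (D * (x + l)) + u * (D * (x + l))) with
        (9 / 4 * u * (D * (x + l))) by field.
      assert (0 <= D * (x + l)) by (apply Rmult_le_pos; lra).
      apply Rmult_le_compat; [lra | lra | lra |].
      apply Rmult_le_compat_l; lra. }
  assert (HQ : 0 < Q s) by (unfold Q; apply Rinv_0_lt_compat; fold p; nra).
  assert (EQ : Q s = / (p * sqrt p)) by reflexivity.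
  assert (HX : forall X e c, 0 <= e -> Rabs X <= c -> Rabs (X * e) <= c * e).
  { intros X e c He HX. rewrite Rabs_mult, (Rabs_pos_eq e) by exact He.
    now apply Rmult_le_compat_r. }
  assert (Hip : 0 < / p) by now apply Rinv_0_lt_compat.
  assert (HQ1 : 0 <= Q s / p) by (apply Rlt_le; unfold Rdiv; nra).
  assert (HQ2 : 0 <= Q s / p ^ 2).
  { apply Rlt_le, Rdiv_lt_0_compat; [lra | apply pow_lt; lra]. }
  repeat split.
  + eapply Rle_trans; [apply HX; [lra | exact BN0]|]. apply Req_le. rewrite EQ. field. lra.
  + eapply Rle_trans; [apply Rabs_triang|]. rewrite Rabs_Ropp.
    apply Rle_trans with (12 * D * sqrt p * p ^ 2 * Q s + 3 / 2 * (16 * D * sqrt p * p ^ 3 * (Q s / p))).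
    * apply Rplus_le_compat; [apply HX; [lra | exact BN1]|].
      rewrite Rabs_mult, (Rabs_pos_eq (3 / 2)) by lra. apply Rmult_le_compat_l; [lra|].
      now apply HX.
    * apply Req_le. rewrite EQ. field. lra.
  + apply Rle_trans with (9 * D * sqrt p * p * Q s + 3 * (12 * D * sqrt p * p ^ 2 * (Q s / p)) +
      15 / 4 * (16 * D * sqrt p * p ^ 3 * (Q s / p ^ 2))).
    * apply Rabs_plus3_le; [apply HX; [lra | exact BN2] | |].
      -- rewrite Rabs_Ropp, Rabs_mult, (Rabs_pos_eq 3) by lra.
         apply Rmult_le_compat_l; [lra|]. now apply HX.
      -- rewrite Rabs_mult, (Rabs_pos_eq (15 / 4)) by lra.
         apply Rmult_le_compat_l; [lra|]. now apply HX.
    * apply Req_le. rewrite EQ. field. lra.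
Qed.

(** The equation says that (l^2 - s^2)^(3/2) h has derivative -sqrt(l^2 - s^2) k. At s = -l and s =
    l the boundary terms vanish: the whole interval yields the solvability condition, and an
    interval ending at one turning point determines the solution regular there. *)
Lemma weighted_integral (l a c : R) (h h1 k : R -> R) :
  a <= c ->
  (forall s, a <= s <= c -> is_derive h s (h1 s)) ->
  (forall s, a <= s <= c -> (s ^ 2 - l ^ 2) * h1 s + 3 * s * h s = k s) ->
  (forall s, a <= s <= c -> continuous k s) ->
  is_RInt (fun s => sqrt (l ^ 2 - s ^ 2) * k s) a c
    ((l ^ 2 - a ^ 2) * sqrt (l ^ 2 - a ^ 2) * h a - (l ^ 2 - c ^ 2) * sqrt (l ^ 2 - c ^ 2) * h c).
Proof.
intros Hac Hd Hode Hk.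
replace ((l ^ 2 - a ^ 2) * sqrt (l ^ 2 - a ^ 2) * h a - (l ^ 2 - c ^ 2) * sqrt (l ^ 2 - c ^ 2) * h c)
  with (minus (- ((l ^ 2 - c ^ 2) * sqrt (l ^ 2 - c ^ 2) * h c)) (- ((l ^ 2 - a ^ 2) * sqrt (l ^ 2 - a ^ 2) * h a)))
  by (unfold minus, plus, opp; simpl; ring).
apply (is_RInt_derive (V := R_CompleteNormedModule)
  (fun s => - ((l ^ 2 - s ^ 2) * sqrt (l ^ 2 - s ^ 2) * h s))).
- intros s. rewrite Rmin_left, Rmax_right by exact Hac. intros Hs.
  assert (H0 := is_derive_mult_sqrt (l ^ 2 - s ^ 2)).
  set (g := fun s => (l ^ 2 - s ^ 2) * sqrt (l ^ 2 - s ^ 2)).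
  assert (H1 : is_derive g s
    (- (2 * s) * (3 / 2 * sqrt (l ^ 2 - s ^ 2)))).
  { apply (is_derive_comp (fun x => x * sqrt x) (fun s => l ^ 2 - s ^ 2)); [exact H0|].
    auto_derive; [exact I | ring]. }
  specialize (Hd s Hs). specialize (Hode s Hs).
  assert (Eg : g s = (l ^ 2 - s ^ 2) * sqrt (l ^ 2 - s ^ 2)) by reflexivity.
  apply (is_derive_ext (fun s => - (g s * h s))); [reflexivity|].
  clearbody g. auto_derive.
  + split; [|split; [|exact I]]; eexists; eassumption.
  + derive_subst H1. derive_subst Hd. rewrite Eg, <- Hode. field.
- intros s. rewrite Rmin_left, Rmax_right by exact Hac. intros Hs.
  apply (continuous_mult (K := R_AbsRing)); [|now apply Hk].
  apply (continuous_comp (fun s => l ^ 2 - s ^ 2) sqrt); [|apply continuous_sqrt].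
  apply (derive_continuous _ _ (- (2 * s))). auto_derive; [exact I | ring].
Qed.

Lemma weight_continuous (l s : R) : continuous (fun s => sqrt (l ^ 2 - s ^ 2)) s.
Proof.
apply (continuous_comp (fun s => l ^ 2 - s ^ 2) sqrt); [|apply continuous_sqrt].
apply (derive_continuous _ _ (- (2 * s))). auto_derive; [exact I | ring].
Qed.

Lemma weight_pos (l : R) : 0 < l -> 0 < RInt (fun s => sqrt (l ^ 2 - s ^ 2)) (- l) l.
Proof.
intros Hl. apply RInt_gt_0; [lra | |].
- intros s Hs. apply sqrt_lt_R0. nra.
- intros s _. apply weight_continuous.
Qed.

Lemma cubic_remainder (b B : R) (f f1 f2 : R -> R) :
  0 <= B ->
  (forall s, - b < s < b -> is_derive f s (f1 s)) ->
  (forall s, - b < s < b -> is_derive f1 s (f2 s)) ->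
  (forall s, - b < s < b -> Rabs (f2 s) <= B * Rabs s) ->
  f1 0 = 0 ->
  forall s, - b < s < b -> Rabs (f1 s) <= B * Rabs s ^ 2 /\ Rabs (f s - f 0) <= B * Rabs s ^ 3.
Proof.
intros HB H0 H1 H2 E0.
assert (Hc : forall s c, - b < s < b -> Rmin 0 s <= c <= Rmax 0 s -> - b < c < b /\ Rabs c <= Rabs s).
{ intros s c Hs. unfold Rmin, Rmax. destruct (Rle_dec 0 s) as [P|P]; intros Hc.
  - split; [lra|]. rewrite !Rabs_pos_eq; lra.
  - split; [lra|]. rewrite !Rabs_left1; lra. }
assert (A1 : forall s, - b < s < b -> Rabs (f1 s) <= B * Rabs s ^ 2).
{ intros s Hs. destruct (mean_value f1 f2 0 s) as [c [Hcs E]].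
  - intros x Hx. apply H1. now apply (Hc s x Hs).
  - destruct (Hc s c Hs Hcs) as [C1 C2]. specialize (H2 c C1).
    replace (f1 s) with (f1 s - f1 0) by (rewrite E0; ring). rewrite E, Rabs_mult.
    replace (s - 0) with s by ring. replace (Rabs s ^ 2) with (Rabs s * Rabs s) by ring.
    rewrite <- Rmult_assoc. apply Rmult_le_compat_r; [apply Rabs_pos|].
    pose proof (Rabs_pos c). nra. }
intros s Hs. split; [now apply A1|].
destruct (mean_value f f1 0 s) as [c [Hcs E]].
- intros x Hx. apply H0. now apply (Hc s x Hs).
- destruct (Hc s c Hs Hcs) as [C1 C2]. specialize (A1 c C1).
  rewrite E, Rabs_mult. replace (s - 0) with s by ring.
  replace (B * Rabs s ^ 3) with (B * Rabs s ^ 2 * Rabs s) by ring.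
  apply Rmult_le_compat_r; [apply Rabs_pos|].
  eapply Rle_trans; [exact A1|]. apply Rmult_le_compat_l; [exact HB|].
  apply pow_incr. split; [apply Rabs_pos | exact C2].
Qed.

(* Removing the quadratic Taylor polynomial of the right-hand side, which is
   solved for by hand, makes the estimates independent of l. *)
Lemma regular_solution (b B l : R) (k : R -> R) :
  0 < l < b -> b <= 1 -> lip_class 2 b B k ->
  RInt (fun s => sqrt (l ^ 2 - s ^ 2) * k s) (- l) l = 0 ->
  exists h h1 h2 : R -> R, forall s, - b < s < b ->
    is_derive h s (h1 s) /\ is_derive h1 s (h2 s) /\
    (s ^ 2 - l ^ 2) * h1 s + 3 * s * h s = k s /\
    Rabs (h s) <= 105 * B /\ Rabs (h1 s) <= 105 * B /\ Rabs (h2 s) <= 105 * B.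
Proof.
intros Hl Hb1 [K0 [k1 [Dk [K1 [k2 [Dk1 [K2 L2]]]]]]] Hmean.
assert (HB : 0 <= B) by (eapply Rle_trans; [apply Rabs_pos | apply (K0 0); lra]).
set (a1 := k1 0). set (a2 := k2 0).
assert (Ha1 : Rabs a1 <= B) by (apply K1; lra).
assert (Ha2 : Rabs a2 <= B) by (apply K2; lra).
(* The affine function a1 / 3 + (a2 / 8) s solves the equation with right-hand side a1 s + (a2 / 2)
   s^2 - a2 l^2 / 8. Subtracting that right-hand side makes the first two derivatives vanish at 0
   and keeps the weighted mean zero. *)
set (q := fun s => k s - a1 * s - a2 / 2 * s ^ 2 + a2 * l ^ 2 / 8).
set (q1 := fun s => k1 s - a1 - a2 * s).
set (q2 := fun s => k2 s - a2).
assert (Dq : forall s, - b < s < b -> is_derive q s (q1 s)).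
{ intros s Hs. unfold q, q1. specialize (Dk s Hs). auto_derive; [now exists (k1 s)|].
  derive_subst Dk. field. }
assert (Dq1 : forall s, - b < s < b -> is_derive q1 s (q2 s)).
{ intros s Hs. unfold q1, q2. specialize (Dk1 s Hs). auto_derive; [now exists (k2 s)|].
  derive_subst Dk1. field. }
assert (Bq2 : forall s, - b < s < b -> Rabs (q2 s) <= B * Rabs s).
{ intros s Hs. unfold q2, a2. specialize (L2 0 s ltac:(lra) Hs).
  now replace (s - 0) with s in L2 by ring. }
assert (Cq2 : forall s, - b < s < b -> continuous q2 s).
{ intros s Hs. apply (lipschitz_continuous q2 (- b) b B); [exact Hs|].
  intros x y Hx Hy. unfold q2. replace (k2 y - a2 - (k2 x - a2)) with (k2 y - k2 x) by ring.
  now apply L2. }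
assert (Cq : forall s, - b < s < b -> continuous q s)
  by (intros s Hs; apply (derive_continuous q s (q1 s)); auto).
assert (Rem := cubic_remainder b B q q1 q2 HB Dq Dq1 Bq2 ltac:(unfold q1, a1; ring)).
assert (Iq : is_RInt (fun s => sqrt (l ^ 2 - s ^ 2) * q s) (- l) l 0).
{ assert (Hp := weighted_integral l (- l) l (fun s => a1 / 3 + a2 / 8 * s) (fun _ => a2 / 8)
    (fun s => a1 * s + a2 / 2 * s ^ 2 - a2 * l ^ 2 / 8) ltac:(lra)).
  replace (_ - _) with 0 in Hp by (simpl; ring).
  assert (Hk : is_RInt (fun s => sqrt (l ^ 2 - s ^ 2) * k s) (- l) l 0).
  { rewrite <- Hmean. apply (RInt_correct (V := R_CompleteNormedModule)).
    apply ex_RInt_continuous_interval; [lra|]. intros s Hs.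
    apply (continuous_mult (K := R_AbsRing)); [apply weight_continuous|].
    apply (derive_continuous k s (k1 s)). apply Dk. lra. }
  replace 0 with (minus 0 0) at 1 by (unfold minus, plus, opp; simpl; ring).
  eapply is_RInt_ext; [|apply (is_RInt_minus (V := R_NormedModule)); [exact Hk | apply Hp]].
  - intros s _. unfold q, minus, plus, opp; simpl. field.
  - intros s _. auto_derive; [exact I | ring].
  - intros s _. field.
  - intros s _. apply (derive_continuous _ _ (a1 + a2 * s)). auto_derive; [exact I | field]. }
assert (Exq : forall x y, - b < x -> x <= y -> y < b -> ex_RInt (fun s => sqrt (l ^ 2 - s ^ 2) * q s) x y).
{ intros x y Hx Hxy Hy. apply ex_RInt_continuous_interval; [exact Hxy|]. intros s Hs.
  apply (continuous_mult (K := R_AbsRing)); [apply weight_continuous | apply Cq; lra]. }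
(* The value at 0 is controlled by the zero mean: q differs from q(0) by at most B l^3 on (-l, l),
   so |q(0)| > B l^3 would give q a constant sign there. *)
assert (Hq0 : Rabs (q 0) <= B * l ^ 3).
{ assert (Hw := weight_pos l ltac:(lra)).
  assert (Ew : ex_RInt (fun s => sqrt (l ^ 2 - s ^ 2)) (- l) l).
  { apply ex_RInt_continuous_interval; [lra|]. intros s _. apply weight_continuous. }
  assert (Hdev : forall s, - l < s < l -> Rabs (q s - q 0) <= B * l ^ 3).
  { intros s Hs. destruct (Rem s ltac:(lra)) as [_ H]. eapply Rle_trans; [exact H|].
    apply Rmult_le_compat_l; [exact HB|]. apply pow_incr. split; [apply Rabs_pos|].
    apply Rabs_le. lra. }
  apply Rabs_le. split.
  - apply Rnot_lt_le. intros Hc.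
    assert (H : RInt (fun s => sqrt (l ^ 2 - s ^ 2) * q s) (- l) l <=
      RInt (fun s => (q 0 + B * l ^ 3) * sqrt (l ^ 2 - s ^ 2)) (- l) l).
    { apply RInt_le; [lra | apply Exq; lra | now apply (ex_RInt_scal (V := R_NormedModule)) |].
      intros s Hs. specialize (Hdev s Hs). apply Rabs_le_between in Hdev.
      pose proof (sqrt_pos (l ^ 2 - s ^ 2)). nra. }
    rewrite (is_RInt_unique _ _ _ _ Iq) in H.
    assert (E := RInt_scal (V := R_CompleteNormedModule) (fun s => sqrt (l ^ 2 - s ^ 2)) (- l) l (q 0 + B * l ^ 3) Ew).
    unfold scal in E; simpl in E; unfold mult in E; simpl in E. simpl in H. rewrite E in H.
    simpl in Hw. nra.
  - apply Rnot_lt_le. intros Hc.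
    assert (H : RInt (fun s => (q 0 - B * l ^ 3) * sqrt (l ^ 2 - s ^ 2)) (- l) l <=
      RInt (fun s => sqrt (l ^ 2 - s ^ 2) * q s) (- l) l).
    { apply RInt_le; [lra | now apply (ex_RInt_scal (V := R_NormedModule)) | apply Exq; lra |].
      intros s Hs. specialize (Hdev s Hs). apply Rabs_le_between in Hdev.
      pose proof (sqrt_pos (l ^ 2 - s ^ 2)). nra. }
    rewrite (is_RInt_unique _ _ _ _ Iq) in H.
    assert (E := RInt_scal (V := R_CompleteNormedModule) (fun s => sqrt (l ^ 2 - s ^ 2)) (- l) l (q 0 - B * l ^ 3) Ew).
    unfold scal in E; simpl in E; unfold mult in E; simpl in E. simpl in H. rewrite E in H.
    simpl in Hw. nra. }
assert (Bq : forall s, - b < s < b -> Rabs (q s) <= B * (Rabs s + l) ^ 3 /\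
  Rabs (q1 s) <= B * (Rabs s + l) ^ 2 /\ Rabs (q2 s) <= B * (Rabs s + l)).
{ intros s Hs. destruct (Rem s Hs) as [R1 R0]. specialize (Bq2 s Hs). pose proof (Rabs_pos s) as Hp.
  split; [|split].
  - replace (q s) with ((q s - q 0) + q 0) by ring. eapply Rle_trans; [apply Rabs_triang|].
    apply Rle_trans with (B * (Rabs s ^ 3 + l ^ 3)); [lra|].
    apply Rmult_le_compat_l; [exact HB|]. simpl.
    assert (0 <= Rabs s * l) by (apply Rmult_le_pos; lra). nra.
  - eapply Rle_trans; [exact R1|]. apply Rmult_le_compat_l; [exact HB|]. apply pow_incr. lra.
  - nra. }
destruct (regular_solution_right B b l q q1 q2 Hl HB Dq Dq1 Cq2) as (f & f1 & f2 & Hf & Bf).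
{ intros s Hs. destruct (Bq s ltac:(lra)) as (H & _ & _). now rewrite (Rabs_pos_eq s) in H by lra. }
{ intros s Hs. destruct (Bq s ltac:(lra)) as (_ & H & _). now rewrite (Rabs_pos_eq s) in H by lra. }
{ intros s Hs. destruct (Bq s ltac:(lra)) as (_ & _ & H). now rewrite (Rabs_pos_eq s) in H by lra. }
destruct (regular_solution_right B b l (fun s => q (- s)) (fun s => - q1 (- s)) (fun s => q2 (- s)))
  as (g & g1 & g2 & Hg & Bg); [exact Hl | exact HB | | | | | | |].
{ intros s Hs. specialize (Dq (- s) ltac:(lra)). auto_derive; [now exists (q1 (- s))|].
  derive_subst Dq. ring. }
{ intros s Hs. specialize (Dq1 (- s) ltac:(lra)). auto_derive; [now exists (q2 (- s))|].
  derive_subst Dq1. ring. }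
{ intros s Hs. apply (continuous_comp Ropp q2); [|apply Cq2; lra].
  apply (continuous_opp (V := R_NormedModule) (fun x => x)). apply continuous_id. }
{ intros s Hs. destruct (Bq (- s) ltac:(lra)) as (H & _ & _). now rewrite (Rabs_Ropp s), (Rabs_pos_eq s) in H by lra. }
{ intros s Hs. destruct (Bq (- s) ltac:(lra)) as (_ & H & _).
  rewrite Rabs_Ropp. now rewrite (Rabs_Ropp s), (Rabs_pos_eq s) in H by lra. }
{ intros s Hs. destruct (Bq (- s) ltac:(lra)) as (_ & _ & H).
  now rewrite (Rabs_Ropp s), (Rabs_pos_eq s) in H by lra. }
(* Reflection turns the solution built for q(-s) into one for q that is regular at -l, whereas [f]
   is regular at l. *)
set (e := fun s => - g (- s)). set (e1 := fun s => g1 (- s)). set (e2 := fun s => - g2 (- s)).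
assert (He : forall s, - b < s < l -> is_derive e s (e1 s) /\ is_derive e1 s (e2 s) /\
       (s ^ 2 - l ^ 2) * e1 s + 3 * s * e s = q s).
{ intros s Hs. destruct (Hg (- s) ltac:(lra)) as (G1 & G2 & G3). unfold e, e1, e2.
  split; [|split].
  - auto_derive; [now exists (g1 (- s))|]. derive_subst G1. ring.
  - auto_derive; [now exists (g2 (- s))|]. derive_subst G2. ring.
  - rewrite Ropp_involutive in G3. rewrite <- G3. ring. }
(* Multiplied by (l^2 - x^2)^(3/2), the difference of the two solutions is the weighted integral of
   q over [-l, l], which is zero. *)
assert (Hint : forall x, - l < x <= 0 -> f x = e x).
{ intros x Hx.
  assert (Wf : forall a c, - l < a -> a <= c -> c < b -> _) by
    (exact (fun a c Ha Hac Hc => weighted_integral l a c f f1 q Hac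
      (fun s Hs => proj1 (Hf s (conj (Rlt_le_trans _ _ _ Ha (proj1 Hs)) (Rle_lt_trans _ _ _ (proj2 Hs) Hc))))
      (fun s Hs => proj2 (proj2 (Hf s (conj (Rlt_le_trans _ _ _ Ha (proj1 Hs)) (Rle_lt_trans _ _ _ (proj2 Hs) Hc)))))
      (fun s Hs => Cq s ltac:(lra)))).
  assert (We : forall a c, - b < a -> a <= c -> c < l -> _) by
    (exact (fun a c Ha Hac Hc => weighted_integral l a c e e1 q Hac
      (fun s Hs => proj1 (He s (conj (Rlt_le_trans _ _ _ Ha (proj1 Hs)) (Rle_lt_trans _ _ _ (proj2 Hs) Hc))))
      (fun s Hs => proj2 (proj2 (He s (conj (Rlt_le_trans _ _ _ Ha (proj1 Hs)) (Rle_lt_trans _ _ _ (proj2 Hs) Hc)))))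
      (fun s Hs => Cq s ltac:(lra)))).
  assert (F1 := Wf 0 l ltac:(lra) ltac:(lra) ltac:(lra)).
  assert (F2 := Wf x 0 ltac:(lra) ltac:(lra) ltac:(lra)).
  assert (E1 := We (- l) 0 ltac:(lra) ltac:(lra) ltac:(lra)).
  assert (E2 := We x 0 ltac:(lra) ltac:(lra) ltac:(lra)).
  assert (S1 := is_RInt_Chasles (V := R_NormedModule) _ _ _ _ _ _ E1 F1).
  assert (U1 := is_RInt_unique _ _ _ _ S1). rewrite (is_RInt_unique _ _ _ _ Iq) in U1.
  assert (U2 := is_RInt_unique _ _ _ _ F2). rewrite (is_RInt_unique _ _ _ _ E2) in U2.
  unfold plus in U1; simpl in U1.
  assert (Hw : 0 < l ^ 2 - x ^ 2) by nra.
  assert (Hws := sqrt_lt_R0 _ Hw).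
  replace (l * (l * 1) - - l * (- l * 1)) with 0 in U1 by ring.
  replace (l * (l * 1) - l * (l * 1)) with 0 in U1 by ring.
  simpl in U2. simpl in Hw, Hws.
  apply Rmult_eq_reg_l with ((l * (l * 1) - x * (x * 1)) * sqrt (l * (l * 1) - x * (x * 1))); [lra|].
  apply Rgt_not_eq. now apply Rmult_lt_0_compat. }
assert (Hint1 : forall x, - l < x < 0 -> f1 x = e1 x).
{ intros x Hx. destruct (Hf x ltac:(lra)) as (_ & _ & F3). destruct (He x ltac:(lra)) as (_ & _ & E3).
  rewrite (Hint x ltac:(lra)) in F3.
  apply Rmult_eq_reg_l with (x ^ 2 - l ^ 2); [lra | nra]. }
(* The switch is at 0, so that each branch is used on the side of its own turning point, where its
   bounds hold. *)
set (glue := fun u v : R -> R => fun s => if Rlt_dec s 0 then u s else v s).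
assert (GL : forall u v s, s < 0 -> locally s (fun y => u y = glue u v y)).
{ intros u v s Hs. apply (locally_open_interval (s - 1) 0); [lra|]. intros y Hy. unfold glue.
  destruct (Rlt_dec y 0); [reflexivity | lra]. }
assert (GR : forall u v s, (forall x, - l < x < 0 -> v x = u x) -> 0 <= s < b ->
  locally s (fun y => v y = glue u v y)).
{ intros u v s E Hs. apply (locally_open_interval (- l) b); [lra|]. intros y Hy. unfold glue.
  destruct (Rlt_dec y 0); [apply E; lra | reflexivity]. }
exists (fun s => glue e f s + (a1 / 3 + a2 / 8 * s)), (fun s => glue e1 f1 s + a2 / 8), (glue e2 f2).
intros s Hs.
assert (Hall : is_derive (glue e f) s (glue e1 f1 s) /\ is_derive (glue e1 f1) s (glue e2 f2 s) /\
  (s ^ 2 - l ^ 2) * glue e1 f1 s + 3 * s * glue e f s = q s /\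
  Rabs (glue e f s) <= 64 * B /\ Rabs (glue e1 f1 s) <= 72 * B /\ Rabs (glue e2 f2 s) <= 105 * B).
{ destruct (Rlt_dec s 0) as [Hn|Hn].
  - destruct (He s ltac:(lra)) as (E1 & E2 & E3). destruct (Bg (- s) ltac:(lra)) as (P0 & P1 & P2).
    assert (V : forall u v, glue u v s = u s) by (intros; unfold glue; now destruct (Rlt_dec s 0)).
    rewrite !V. split; [|split; [|split; [exact E3|]]].
    + apply (is_derive_ext_loc e); [now apply GL | exact E1].
    + apply (is_derive_ext_loc e1); [now apply GL | exact E2].
    + unfold e, e1, e2. rewrite !Rabs_Ropp. assert (0 <= (- s + l) ^ 2 <= 4) by nra.
      split; [nra|]. split; [nra | exact P2].
  - destruct (Hf s ltac:(lra)) as (E1 & E2 & E3). destruct (Bf s ltac:(lra)) as (P0 & P1 & P2).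
    assert (V : forall u v, glue u v s = v s) by (intros; unfold glue; now destruct (Rlt_dec s 0)).
    rewrite !V. split; [|split; [|split; [exact E3|]]].
    + apply (is_derive_ext_loc f); [apply GR; [intros; apply Hint|]; lra | exact E1].
    + apply (is_derive_ext_loc f1); [apply GR; [intros; apply Hint1|]; lra | exact E2].
    + assert (0 <= (s + l) ^ 2 <= 4) by nra.
      split; [nra|]. split; [nra | exact P2]. }
destruct Hall as (A1 & A2 & A3 & A4 & A5 & A6). clearbody glue.
assert (Pa1 := Rabs_le_between a1 B). assert (Pa2 := Rabs_le_between a2 B).
apply Rabs_le_between in A4. apply Rabs_le_between in A5.
assert (- B <= a1 <= B) by tauto. assert (- B <= a2 <= B) by tauto.
split; [|split; [|split; [|split; [|split; [|exact A6]]]]].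
- revert A1. generalize (glue e f). intros u A1. auto_derive; [eexists; eassumption|].
  derive_subst A1. ring.
- revert A2. generalize (glue e1 f1). intros u A2. auto_derive; [eexists; eassumption|].
  derive_subst A2. ring.
- unfold q in A3. lra.
- apply Rabs_le. assert (- B <= a2 * s <= B) by nra. lra.
- apply Rabs_le. lra.
Qed.

(** * The singular nonlinear equation *)

(** The increment of u is that of v times a factor tending to c, as in Caratheodory's form of
    differentiability. Both the total derivative and the implicit derivative below reduce to
    this. *)
Lemma is_derive_factor (u v : R -> R) (s d c : R) :
  v s = 0 -> is_derive v s d ->
  (forall e, 0 < e -> exists del, 0 < del /\
    forall x, Rabs (x - s) < del -> exists q, Rabs (q - c) < e /\ u x - u s = v x * q) ->
  is_derive u s (d * c).
Proof.
intros H0 Hv Hq. apply is_derive_Reals. apply is_derive_Reals in Hv.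
intros e He.
set (K := Rabs c + Rabs d + 2).
assert (HK : 2 <= K) by (unfold K; pose proof (Rabs_pos c); pose proof (Rabs_pos d); lra).
assert (He1 : 0 < Rmin 1 (e / (2 * K))).
{ apply Rmin_pos; [lra | apply Rdiv_lt_0_compat; lra]. }
set (e1 := Rmin 1 (e / (2 * K))) in *.
assert (E1 : e1 <= 1) by apply Rmin_l.
assert (E2 : e1 * (2 * K) <= e).
{ apply Rle_trans with (e / (2 * K) * (2 * K)); [|apply Req_le; field; lra].
  apply Rmult_le_compat_r; [lra | apply Rmin_r]. }
destruct (Hv e1 He1) as [d1 Hd1]. destruct (Hq e1 He1) as [d2 [Hd2 Hq2]].
assert (Hd : 0 < Rmin d1 d2) by (apply Rmin_pos; [apply cond_pos | exact Hd2]).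
exists (mkposreal _ Hd). simpl. intros h Hh Hhd.
specialize (Hd1 h Hh (Rlt_le_trans _ _ _ Hhd (Rmin_l _ _))).
destruct (Hq2 (s + h)) as [q [Q1 Q2]].
{ replace (s + h - s) with h by ring. exact (Rlt_le_trans _ _ _ Hhd (Rmin_r _ _)). }
rewrite H0 in Hd1. rewrite Q2.
replace (v (s + h) * q / h - d * c) with
  (((v (s + h) - 0) / h - d) * q + d * (q - c)) by (field; exact Hh).
set (y := (v (s + h) - 0) / h - d) in *.
eapply Rle_lt_trans; [apply Rabs_triang|]. rewrite !Rabs_mult.
assert (Rabs q <= Rabs c + 1).
{ replace q with (c + (q - c)) by ring. eapply Rle_trans; [apply Rabs_triang|]. lra. }
pose proof (Rabs_pos q). pose proof (Rabs_pos d). pose proof (Rabs_pos y). pose proof (Rabs_pos (q - c)).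
apply Rle_lt_trans with (e1 * (Rabs c + 1) + Rabs d * e1); [apply Rplus_le_compat; apply Rmult_le_compat; lra|].
unfold K in E2. nra.
Qed.

(** The increment splits into a move in x with the second argument frozen and a move in y, treated
    by the mean value theorem. Joint continuity is therefore asked of the y-derivative alone. *)
Lemma is_derive_path (G gw : R -> R -> R) (w : R -> R) (s w1 gs : R) :
  is_derive (fun x => G x (w s)) s gs ->
  locally_2d (fun x y => is_derive (G x) y (gw x y)) s (w s) ->
  continuity_2d_pt gw s (w s) -> is_derive w s w1 ->
  is_derive (fun x => G x (w x)) s (gs + w1 * gw s (w s)).
Proof.
intros Hs Hw Hc Hw1.
apply (is_derive_ext (fun x => G x (w s) + (G x (w x) - G x (w s)))); [intros; simpl; ring|].
apply (is_derive_plus (V := R_NormedModule)); [exact Hs|].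
apply (is_derive_factor _ (fun x => w x - w s)); [ring | |].
- auto_derive; [now exists w1|]. derive_subst Hw1. ring.
- intros e He. destruct Hw as [d1 Hd1]. destruct (Hc (mkposreal e He)) as [d2 Hd2].
  assert (Hd : 0 < Rmin d1 d2) by (apply Rmin_pos; apply cond_pos).
  assert (Hcw := derive_continuous w s w1 Hw1).
  apply continuity_pt_filterlim in Hcw. destruct (Hcw _ Hd) as [d3 [Hd3 Hw3]].
  exists (Rmin d3 (Rmin d1 d2)). split; [now apply Rmin_pos|]. intros x Hx.
  assert (X3 := Rlt_le_trans _ _ _ Hx (Rmin_l _ _)).
  assert (X12 := Rlt_le_trans _ _ _ Hx (Rmin_r _ _)).
  assert (X1 := Rlt_le_trans _ _ _ X12 (Rmin_l _ _)).
  assert (X2 := Rlt_le_trans _ _ _ X12 (Rmin_r _ _)).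
  assert (Hwx : Rabs (w x - w s) < Rmin d1 d2).
  { destruct (Req_dec x s) as [->|Hne]; [now rewrite Rminus_diag, Rabs_R0|].
    apply (Hw3 x). split; [split; [exact I | congruence] | exact X3]. }
  assert (Hy : forall y, Rmin (w s) (w x) <= y <= Rmax (w s) (w x) -> Rabs (y - w s) < Rmin d1 d2).
  { intros y Hy. eapply Rle_lt_trans; [|exact Hwx]. revert Hy.
    unfold Rmin, Rmax, Rabs. destruct (Rle_dec (w s) (w x)), (Rcase_abs (y - w s)), (Rcase_abs (w x - w s)); lra. }
  destruct (mean_value (G x) (gw x) (w s) (w x)) as [y [Y1 Y2]].
  + intros y Hyy. apply Hd1; [exact X1|]. exact (Rlt_le_trans _ _ _ (Hy y Hyy) (Rmin_l _ _)).
  + exists (gw x y). split.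
    * apply (Hd2 x y X2). exact (Rlt_le_trans _ _ _ (Hy y Y1) (Rmin_r _ _)).
    * rewrite Y2. ring.
Qed.

(** Continuity of [w] comes out of the proof: the lower bound [c] on the y-derivative gives |w x - w
    s| <= |v x| / c, where v tends to 0. This suits a [w] that is chosen pointwise. *)
Lemma implicit_derive (G gw : R -> R -> R) (h w : R -> R) (s hs gs c : R) :
  0 < c ->
  locally s (fun x => G x (w x) = h x) ->
  is_derive h s hs -> is_derive (fun x => G x (w s)) s gs ->
  locally s (fun x => forall y, Rmin (w s) (w x) <= y <= Rmax (w s) (w x) ->
    is_derive (G x) y (gw x y) /\ c <= gw x y) ->
  continuity_2d_pt gw s (w s) ->
  is_derive w s ((hs - gs) / gw s (w s)).
Proof.
intros Hc HG Hh Hg Hloc Hcont.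
assert (EG : G s (w s) = h s) by exact (locally_singleton _ _ HG).
set (v := fun x => h x - G x (w s)).
assert (Hv : is_derive v s (hs - gs)) by now apply (is_derive_minus (V := R_NormedModule)).
assert (Hv0 : v s = 0) by (unfold v; rewrite EG; ring).
assert (Hcs : c <= gw s (w s)).
{ apply (locally_singleton _ _ Hloc). unfold Rmin, Rmax. destruct (Rle_dec (w s) (w s)); lra. }
apply (is_derive_factor w v); [exact Hv0 | exact Hv|].
intros e He.
assert (Hinv : continuity_2d_pt (fun x y => / gw x y) s (w s)) by (apply continuity_2d_pt_inv; [exact Hcont | lra]).
destruct (Hinv (mkposreal e He)) as [d1 Hd1].
destruct HG as [d2 Hd2]. destruct Hloc as [d3 Hd3].
assert (Hcd : 0 < c * d1) by (apply Rmult_lt_0_compat; [exact Hc | apply cond_pos]).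
assert (Hvc := derive_continuous v s _ Hv). apply continuity_pt_filterlim in Hvc.
destruct (Hvc _ Hcd) as [d4 [Hd4 Hv4]].
exists (Rmin (Rmin d1 d2) (Rmin d3 d4)).
split; [repeat apply Rmin_pos; try apply cond_pos; exact Hd4|]. intros x Hx.
assert (X12 := Rlt_le_trans _ _ _ Hx (Rmin_l _ _)). assert (X34 := Rlt_le_trans _ _ _ Hx (Rmin_r _ _)).
assert (X1 := Rlt_le_trans _ _ _ X12 (Rmin_l _ _)). assert (X2 := Rlt_le_trans _ _ _ X12 (Rmin_r _ _)).
assert (X3 := Rlt_le_trans _ _ _ X34 (Rmin_l _ _)). assert (X4 := Rlt_le_trans _ _ _ X34 (Rmin_r _ _)).
specialize (Hd2 x X2). specialize (Hd3 x X3).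
destruct (mean_value (G x) (gw x) (w s) (w x)) as [y [Y1 Y2]]; [intros; now apply Hd3|].
destruct (Hd3 y Y1) as [_ Hcy].
assert (Evx : v x = gw x y * (w x - w s)) by (unfold v; rewrite <- Hd2; exact Y2).
assert (Hvx : Rabs (v x) < c * d1).
{ destruct (Req_dec x s) as [->|Hne]; [now rewrite Hv0, Rabs_R0|].
  specialize (Hv4 x). simpl in Hv4. unfold Rdist in Hv4. rewrite Hv0, Rminus_0_r in Hv4.
  apply Hv4. split; [split; [exact I | congruence] | exact X4]. }
exists (/ gw x y). split; [|rewrite Evx; field; lra].
apply (Hd1 x y X1).
apply Rle_lt_trans with (Rabs (w x - w s)).
- revert Y1. unfold Rmin, Rmax, Rabs. destruct (Rle_dec (w s) (w x)), (Rcase_abs (y - w s)), (Rcase_abs (w x - w s)); lra.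
- rewrite Evx, Rabs_mult, (Rabs_pos_eq (gw x y)) in Hvx by lra.
  apply Rmult_lt_reg_l with c; [exact Hc|]. eapply Rle_lt_trans; [|exact Hvx].
  apply Rmult_le_compat_r; [apply Rabs_pos | exact Hcy].
Qed.

Lemma is_derive_RInt_box (b T : R) (f f' : R -> R -> R) (s w : R) :
  (forall x t, - b < x < b -> - T < t < T -> is_derive (fun x => f x t) x (f' x t)) ->
  (forall x t, - b < x < b -> - T < t < T -> continuity_2d_pt f' x t) ->
  (forall x t, - b < x < b -> - T < t < T -> continuous (f x) t) ->
  - b < s < b -> - T < w < T ->
  is_derive (fun x => RInt (f x) 0 w) s (RInt (f' s) 0 w).
Proof.
intros Hd Hc Hf Hs Hw.
assert (HT : 0 < T) by lra.
assert (Hin : forall t, Rmin 0 w <= t <= Rmax 0 w -> - T < t < T)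
  by (intros t Ht; apply (between_interval (- T) T 0 w); lra).
rewrite (RInt_ext (f' s) (fun t => Derive (fun u => f u t) s)).
2:{ intros t Ht. symmetry. apply is_derive_unique, Hd; [exact Hs | apply Hin; lra]. }
apply (is_derive_RInt_param f).
- apply (locally_open_interval (- b) b s); [exact Hs|]. intros y Hy t Ht.
  exists (f' y t). apply Hd; auto.
- intros t Ht. specialize (Hin t Ht).
  apply continuity_2d_pt_ext_loc with f'; [|now apply Hc].
  destruct (locally_open_interval (- b) b s (fun x => - b < x < b) Hs (fun y Hy => Hy)) as [d1 Hd1].
  destruct (locally_open_interval (- T) T t (fun x => - T < x < T) Hin (fun y Hy => Hy)) as [d2 Hd2].
  assert (Hd0 : 0 < Rmin d1 d2) by (apply Rmin_pos; apply cond_pos).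
  exists (mkposreal _ Hd0). simpl. intros u v Hu Hv. symmetry. apply is_derive_unique, Hd.
  + apply Hd1. exact (Rlt_le_trans _ _ _ Hu (Rmin_l _ _)).
  + apply Hd2. exact (Rlt_le_trans _ _ _ Hv (Rmin_r _ _)).
- apply (locally_open_interval (- b) b s); [exact Hs|]. intros y Hy.
  apply (ex_RInt_continuous (V := R_CompleteNormedModule)). intros t Ht. apply Hf; auto.
Qed.

Lemma is_derive_RInt_endpoint (T w : R) (f : R -> R) :
  (forall t, - T < t < T -> continuous f t) -> - T < w < T ->
  is_derive (fun y => RInt f 0 y) w (f w).
Proof.
intros Hf Hw. apply (is_derive_RInt (V := R_NormedModule) f _ 0); [|now apply Hf].
apply (locally_open_interval (- T) T w); [exact Hw|]. intros y Hy.
apply (RInt_correct (V := R_CompleteNormedModule)), (ex_RInt_continuous (V := R_CompleteNormedModule)).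
intros t Ht. apply Hf, (between_interval (- T) T 0 y); lra.
Qed.

Lemma Rabs_RInt_le_bound (T w M : R) (f : R -> R) :
  (forall t, - T < t < T -> continuous f t) -> - T < w < T -> 
  (forall t, Rabs t <= Rabs w -> Rabs (f t) <= M) ->
  Rabs (RInt f 0 w) <= Rabs w * M.
Proof.
intros Hf Hw HM.
assert (Hex : forall a c, - T < a < T -> - T < c < T -> ex_RInt f a c).
{ intros a c Ha Hc. apply (ex_RInt_continuous (V := R_CompleteNormedModule)).
  intros t Ht. apply Hf, (between_interval (- T) T a c); auto. }
destruct (Rle_dec 0 w) as [H|H].
- rewrite (Rabs_pos_eq w) by exact H. replace (w * M) with ((w - 0) * M) by ring.
  apply abs_RInt_le_const; [exact H | apply Hex; lra |]. intros t Ht. apply HM.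
  rewrite !Rabs_pos_eq; lra.
- rewrite (Rabs_left w) by lra. replace (- w * M) with ((0 - w) * M) by ring.
  rewrite <- (opp_RInt_swap (V := R_CompleteNormedModule)) by (apply Hex; lra).
  unfold opp; simpl. rewrite Rabs_Ropp.
  apply abs_RInt_le_const; [lra | apply Hex; lra |]. intros t Ht. apply HM.
  rewrite !Rabs_left1; lra.
Qed.

(* Equal to ((s + (s^2 - l^2) t)^2 - l^2) / (s^2 - l^2). *)
Definition chord (l s t : R) : R := 1 + 2 * s * t + (s ^ 2 - l ^ 2) * t ^ 2.

(** The derivative in s of sqrt(chord), not of [chord] itself; [chord_dss] is the second derivative
    of the same square root. *)
Definition chord_ds (l s t : R) : R := (t + s * t ^ 2) / sqrt (chord l s t).

Definition chord_dss (l s t : R) : R :=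
  t ^ 2 / sqrt (chord l s t) - (t + s * t ^ 2) ^ 2 / (chord l s t * sqrt (chord l s t)).

Lemma chord_bounds (b l T s t : R) :
  0 < l < b -> b * T <= 3 / 100 -> - b < s < b -> - T <= t <= T ->
  9 / 10 <= chord l s t <= 11 / 10.
Proof.
intros Hl HT Hs Ht.
assert (H1 : - (3 / 100) <= s * t <= 3 / 100) by nra.
assert (H2 : - (3 / 100) <= l * t <= 3 / 100) by nra.
unfold chord. replace ((s ^ 2 - l ^ 2) * t ^ 2) with ((s * t) * (s * t) - (l * t) * (l * t)) by ring.
replace (2 * s * t) with (2 * (s * t)) by ring. nra.
Qed.

Lemma sqrt_chord_bounds (b l T s t : R) :
  0 < l < b -> b * T <= 3 / 100 -> - b < s < b -> - T <= t <= T ->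
  9 / 10 <= sqrt (chord l s t) <= 11 / 10.
Proof.
intros Hl HT Hs Ht. assert (H := chord_bounds b l T s t Hl HT Hs Ht).
assert (E : sqrt (chord l s t) * sqrt (chord l s t) = chord l s t) by (apply sqrt_sqrt; lra).
pose proof (sqrt_pos (chord l s t)). nra.
Qed.

Lemma chord_continuity_2d (l x t : R) : continuity_2d_pt (chord l) x t.
Proof.
unfold chord.
repeat (first [ apply continuity_2d_pt_plus | apply continuity_2d_pt_opp
  | apply continuity_2d_pt_const | apply continuity_2d_pt_id1 | apply continuity_2d_pt_id2
  | apply continuity_2d_pt_mult ]).
Qed.

Lemma sqrt_chord_continuity_2d (l x t : R) : continuity_2d_pt (fun x t => sqrt (chord l x t)) x t.
Proof.
apply (continuity_1d_2d_pt_comp sqrt (chord l)); [|apply chord_continuity_2d].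
apply continuity_pt_filterlim, continuous_sqrt.
Qed.

Ltac cont2d := repeat (first [ apply continuity_2d_pt_plus | apply continuity_2d_pt_opp
  | apply continuity_2d_pt_const | apply continuity_2d_pt_id1 | apply continuity_2d_pt_id2
  | apply continuity_2d_pt_inv | apply sqrt_chord_continuity_2d | apply chord_continuity_2d
  | apply continuity_2d_pt_mult ]).

Lemma chord_ds_continuity_2d (l x t : R) :
  0 < chord l x t -> continuity_2d_pt (chord_ds l) x t.
Proof.
intros H. assert (Hs := sqrt_lt_R0 _ H). unfold chord_ds, Rdiv. cont2d. lra.
Qed.

Lemma chord_dss_continuity_2d (l x t : R) :
  0 < chord l x t -> continuity_2d_pt (chord_dss l) x t.
Proof.
intros H. assert (Hs := sqrt_lt_R0 _ H). unfold chord_dss, Rdiv. cont2d; apply Rgt_not_eq; [|apply Rmult_lt_0_compat]; lra.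
Qed.

Lemma continuity_2d_continuous (f : R -> R -> R) (x t : R) :
  continuity_2d_pt f x t -> continuous (f x) t.
Proof.
intros H. apply continuity_pt_filterlim. intros e He.
destruct (H (mkposreal e He)) as [d Hd]. exists d. split; [apply cond_pos|].
intros y [_ Hy]. apply (Hd x y); [rewrite Rminus_diag, Rabs_R0; apply cond_pos | exact Hy].
Qed.

Lemma is_derive_sqrt_chord (l x t : R) :
  0 < chord l x t -> is_derive (fun x => sqrt (chord l x t)) x (chord_ds l x t).
Proof.
intros H. assert (Hs := sqrt_lt_R0 _ H). unfold chord_ds. unfold chord in *. auto_derive.
- lra.
- replace (1 + 2 * x * t + (x * (x * 1) + - (l * (l * 1))) * (t * (t * 1))) with
    (1 + 2 * x * t + (x ^ 2 - l ^ 2) * t ^ 2) by ring. field. lra.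
Qed.

Lemma is_derive_chord_ds (l x t : R) :
  0 < chord l x t -> is_derive (fun x => chord_ds l x t) x (chord_dss l x t).
Proof.
intros H. assert (Hs := sqrt_lt_R0 _ H). assert (Hd := is_derive_sqrt_chord l x t H).
assert (E : sqrt (chord l x t) * sqrt (chord l x t) = chord l x t) by (apply sqrt_sqrt; lra).
assert (K : forall r : R -> R, 0 < r x -> is_derive r x ((t + x * t ^ 2) / r x) ->
  is_derive (fun x => (t + x * t ^ 2) / r x) x
    (t ^ 2 / r x - (t + x * t ^ 2) ^ 2 / (r x * r x * r x))).
{ intros r Hr Hdr. auto_derive; [split; [now exists ((t + x * t ^ 2) / r x) | split; [lra | exact I]]|].
  derive_subst Hdr. field. lra. }
specialize (K _ Hs Hd). cbv beta in K. rewrite E in K. exact K.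
Qed.

(** Both sides vanish at w = 0 and have the same derivative in w. The identity converts int_0^w
    sqrt(chord) = h, differentiated in s and multiplied by s^2 - l^2, into the first-order equation
    for w. *)
Lemma RInt_chord_identity (b l T s w : R) :
  0 < l < b -> b * T <= 3 / 100 -> - b < s < b -> - T < w < T ->
  (1 + 2 * s * w) * sqrt (chord l s w) - 1 =
  3 * s * RInt (fun t => sqrt (chord l s t)) 0 w + (s ^ 2 - l ^ 2) * RInt (chord_ds l s) 0 w.
Proof.
intros Hl HT Hs Hw.
assert (Hpos : forall t, - T < t < T -> 0 < chord l s t).
{ intros t Ht. pose proof (chord_bounds b l T s t Hl HT Hs). lra. }
assert (C0 : forall t, - T < t < T -> continuous (fun t => sqrt (chord l s t)) t)
  by (intros t _; apply (continuity_2d_continuous (fun x t => sqrt (chord l x t))), sqrt_chord_continuity_2d).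
assert (C1 : forall t, - T < t < T -> continuous (chord_ds l s) t)
  by (intros t Ht; apply continuity_2d_continuous, chord_ds_continuity_2d; auto).
assert (D : forall y, Rmin 0 w <= y <= Rmax 0 w ->
  is_derive (fun w => (1 + 2 * s * w) * sqrt (chord l s w) - 1 -
    (3 * s * RInt (fun t => sqrt (chord l s t)) 0 w + (s ^ 2 - l ^ 2) * RInt (chord_ds l s) 0 w)) y ((fun _ => 0) y)).
{ intros y Hy. assert (Hy' := between_interval (- T) T 0 w y ltac:(lra) Hw Hy).
  assert (D0 := is_derive_RInt_endpoint T y _ C0 Hy').
  assert (D1 := is_derive_RInt_endpoint T y _ C1 Hy').
  assert (Hp := Hpos y Hy'). assert (Hq := sqrt_lt_R0 _ Hp).
  assert (E : sqrt (chord l s y) * sqrt (chord l s y) = chord l s y) by (apply sqrt_sqrt; lra).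
  assert (D2 : is_derive (fun w => sqrt (chord l s w)) y ((s + (s ^ 2 - l ^ 2) * y) / sqrt (chord l s y))).
  { unfold chord in *. auto_derive; [lra|].
    replace (1 + 2 * s * y + (s * (s * 1) - l * (l * 1)) * (y * (y * 1))) with
    (1 + 2 * s * y + (s ^ 2 - l ^ 2) * y ^ 2) by ring. field. lra. }
  assert (K : forall r i j : R -> R,
    is_derive r y ((s + (s ^ 2 - l ^ 2) * y) / sqrt (chord l s y)) ->
    is_derive i y (sqrt (chord l s y)) -> is_derive j y (chord_ds l s y) -> r y = sqrt (chord l s y) ->
    is_derive (fun w => (1 + 2 * s * w) * r w - 1 - (3 * s * i w + (s ^ 2 - l ^ 2) * j w)) y 0).
  { intros r i j Hr Hi Hj Er. auto_derive; [repeat split; eexists; eassumption|].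
    derive_subst Hr. derive_subst Hi. derive_subst Hj. rewrite Er. unfold chord_ds.
    set (q := sqrt (chord l s y)) in *.
    assert (E' : q * q = 1 + 2 * s * y + (s ^ 2 - l ^ 2) * y ^ 2) by exact E.
    apply Rmult_eq_reg_r with q; [|lra]. field_simplify; [|lra].
    replace (q ^ 2) with (q * q) by ring. rewrite E'. ring. }
  now apply K. }
destruct (mean_value _ _ 0 w D) as [y [_ E]].
rewrite !RInt_point in E. unfold zero in E; simpl in E. 
replace (chord l s 0) with 1 in E by (unfold chord; ring). rewrite sqrt_1 in E. simpl. lra.
Qed.

Lemma RInt_sqrt_chord_preimage (b l H s y : R) :
  0 < H -> 0 < l < b -> b * H <= / 100 -> - b < s < b -> Rabs y <= H ->
  exists w, - (2 * H) <= w <= 2 * H /\ RInt (fun t => sqrt (chord l s t)) 0 w = y.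
Proof.
intros HH Hl HbH Hs Hy.
assert (C0 : forall t, continuous (fun t => sqrt (chord l s t)) t)
  by (intros t; apply (continuity_2d_continuous (fun x t => sqrt (chord l x t))), sqrt_chord_continuity_2d).
set (J := (fun w => RInt (fun t => sqrt (chord l s t)) 0 w) : R -> R).
assert (DJ : forall w, is_derive J w (sqrt (chord l s w))).
{ intros w. apply (is_derive_RInt_endpoint (Rabs w + 1) w); [auto|].
  apply Rabs_lt_between. pose proof (Rabs_pos w). lra. }
assert (J0 : J 0 = 0) by (unfold J; now rewrite RInt_point).
apply Rabs_le_between in Hy.
assert (HB : forall w, - (2 * H) <= w <= 2 * H -> 9 / 10 <= sqrt (chord l s w)).
{ intros w Hw. apply (sqrt_chord_bounds b l (3 * H)); lra. }
assert (J1 : H <= J (2 * H)).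
{ destruct (mean_value_le J (fun w => sqrt (chord l s w)) 0 (2 * H) ltac:(lra)) as [c [Hc E]]; [auto|].
  specialize (HB c ltac:(lra)). nra. }
assert (J2 : J (- (2 * H)) <= - H).
{ destruct (mean_value J (fun w => sqrt (chord l s w)) 0 (- (2 * H))) as [c [Hc E]]; [auto|].
  rewrite Rmin_right, Rmax_left in Hc by lra. specialize (HB c ltac:(lra)). nra. }
destruct (IVT_gen J (- (2 * H)) (2 * H) y) as [w [Hw E]].
- intros x. apply continuity_pt_filterlim, (derive_continuous J x (sqrt (chord l s x))), DJ.
- unfold Rmin, Rmax. destruct (Rle_dec (J (- (2 * H))) (J (2 * H))); lra.
- rewrite Rmin_left, Rmax_right in Hw by lra. now exists w.
Qed.

(* With z = s + (s^2 - l^2) w, the left-hand side of the final equation is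
   z' sqrt((z^2 - l^2) / (s^2 - l^2)). Integrating it against sqrt(s^2 - l^2)
   reduces the equation to int_0^w sqrt(chord l s t) dt = h(s). *)
Lemma nonlinear_solution (H : R) :
  0 < H -> exists C, 0 <= C /\ forall b l (h h1 h2 rho : R -> R),
  0 < l < b -> b <= 1 -> b * H <= / 100 ->
  (forall s, - b < s < b -> is_derive h s (h1 s) /\ is_derive h1 s (h2 s) /\
    (s ^ 2 - l ^ 2) * h1 s + 3 * s * h s = rho s - 1 /\
    Rabs (h s) <= H /\ Rabs (h1 s) <= H /\ Rabs (h2 s) <= H) ->
  exists w w1 w2 : R -> R, forall s, - b < s < b ->
    is_derive w s (w1 s) /\ is_derive w1 s (w2 s) /\
    Rabs (w s) <= 2 * H /\ Rabs (w1 s) <= C /\ Rabs (w2 s) <= C /\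
    (1 + 2 * s * w s + (s ^ 2 - l ^ 2) * w1 s) * sqrt (chord l s (w s)) = rho s.
Proof.
intros HH.
(* For |t| <= 2 H, [p] bounds t + s t^2 and [g] bounds [chord_dss]; [c1] and [c2] bound w' and w''.
   Each division by sqrt(chord) >= 9/10 is paid for with a factor 2. *)
set (p := 2 * H + 4 * H ^ 2). set (c1 := 2 * (H + 2 * H * (2 * p))).
set (g := 2 * (2 * H) ^ 2 + 2 * p ^ 2).
set (c2 := 2 * (H + (2 * H * g + c1 * (2 * p)) + c1 * (2 * (2 * H + c1 + 4 * H ^ 2 + 2 * H * c1)))).
assert (Hp : 0 <= p) by (unfold p; nra).
assert (Hc1 : 0 <= c1) by (unfold c1; nra).
assert (Hg : 0 <= g) by (unfold g; nra).
assert (Hc2 : 0 <= c2).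
{ unfold c2. assert (0 <= H * g) by nra. assert (0 <= c1 * p) by nra. assert (0 <= c1 * H) by nra.
  assert (0 <= c1 * c1) by nra. assert (0 <= c1 * H ^ 2) by (apply Rmult_le_pos; nra).
  assert (0 <= c1 * (H * c1)) by (apply Rmult_le_pos; nra). nra. }
exists (c1 + c2). split; [lra|].
intros b l h h1 h2 rho Hl Hb1 HbH Hh.
(* The integral equation is solved separately for each s, with the arbitrary value 0 outside (-b,
   b). Smoothness of w follows from the implicit derivative, the integrand being at least 9/10. *)
destruct (functional_choice (fun s w => - b < s < b ->
  - (2 * H) <= w <= 2 * H /\ RInt (fun t => sqrt (chord l s t)) 0 w = h s)) as [w Hw].
{ intros s. destruct (Rlt_dec (- b) s) as [S1|S1]; [|exists 0; intros; lra].
  destruct (Rlt_dec s b) as [S2|S2]; [|exists 0; intros; lra].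
  destruct (RInt_sqrt_chord_preimage b l H s (h s)) as [y Hy]; auto; [apply Hh; lra|].
  now exists y. }
assert (HT : b * (3 * H) <= 3 / 100) by lra.
assert (Hpos : forall x t, - b < x < b -> - (3 * H) < t < 3 * H -> 0 < chord l x t).
{ intros x t Hx Ht. pose proof (chord_bounds b l (3 * H) x t Hl HT Hx). lra. }
assert (Hsq : forall x t, - b < x < b -> - (3 * H) <= t <= 3 * H -> 9 / 10 <= sqrt (chord l x t) <= 11 / 10).
{ intros x t Hx Ht. now apply (sqrt_chord_bounds b l (3 * H)). }
set (Jx := (fun x y => RInt (fun t => sqrt (chord l x t)) 0 y) : R -> R -> R).
set (Bx := (fun x y => RInt (chord_ds l x) 0 y) : R -> R -> R).
set (Ex := (fun x y => RInt (chord_dss l x) 0 y) : R -> R -> R).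
assert (C0 : forall x t, continuous (fun t => sqrt (chord l x t)) t)
  by (intros x t; apply (continuity_2d_continuous (fun x t => sqrt (chord l x t))), sqrt_chord_continuity_2d).
assert (C1 : forall x t, - b < x < b -> - (3 * H) < t < 3 * H -> continuous (chord_ds l x) t)
  by (intros x t Hx Ht; apply continuity_2d_continuous, chord_ds_continuity_2d; auto).
assert (C2 : forall x t, - b < x < b -> - (3 * H) < t < 3 * H -> continuous (chord_dss l x) t)
  by (intros x t Hx Ht; apply continuity_2d_continuous, chord_dss_continuity_2d; auto).
assert (Hws : forall s, - b < s < b -> - (3 * H) < w s < 3 * H)
  by (intros s Hs; destruct (Hw s Hs); lra).
assert (Dw : forall s, - b < s < b ->
  is_derive w s ((h1 s - Bx s (w s)) / sqrt (chord l s (w s)))).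
{ intros s Hs. destruct (Hh s Hs) as [Dh _].
  apply (implicit_derive Jx (fun x t => sqrt (chord l x t)) h w s (h1 s) (Bx s (w s)) (9 / 10)); [lra | | exact Dh | | |].
  - apply (locally_open_interval (- b) b s); [exact Hs|]. intros x Hx. now apply Hw.
  - apply (is_derive_RInt_box b (3 * H) (fun x t => sqrt (chord l x t)) (chord_ds l)); auto.
    + intros x t Hx Ht. apply is_derive_sqrt_chord; auto.
    + intros x t Hx Ht. apply chord_ds_continuity_2d; auto.
  - apply (locally_open_interval (- b) b s); [exact Hs|]. intros x Hx y Hy.
    assert (Hy' := between_interval _ _ _ _ _ (Hws s Hs) (Hws x Hx) Hy).
    split; [|apply Hsq; auto; lra]. now apply (is_derive_RInt_endpoint (3 * H) y (fun t => sqrt (chord l x t))).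
  - apply sqrt_chord_continuity_2d. }
set (w1 := fun s => (h1 s - Bx s (w s)) / sqrt (chord l s (w s))) in *.
assert (Dw' : forall s, - b < s < b -> is_derive w s (w1 s)) by exact Dw. clear Dw.
assert (DB : forall s, - b < s < b ->
  is_derive (fun s => Bx s (w s)) s (Ex s (w s) + w1 s * chord_ds l s (w s))).
{ intros s Hs. apply (is_derive_path Bx (chord_ds l)); [| | |now apply Dw'].
  - apply (is_derive_RInt_box b (3 * H) (chord_ds l) (chord_dss l)); auto.
    + intros x t Hx Ht. apply is_derive_chord_ds; auto.
    + intros x t Hx Ht. apply chord_dss_continuity_2d; auto.
  - destruct (locally_open_interval (- b) b s (fun x => - b < x < b) Hs (fun y Hy => Hy)) as [d1 Hd1].
    destruct (locally_open_interval (- (3 * H)) (3 * H) (w s) (fun x => - (3 * H) < x < 3 * H) (Hws s Hs) (fun y Hy => Hy)) as [d2 Hd2].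
    assert (Hd0 : 0 < Rmin d1 d2) by (apply Rmin_pos; apply cond_pos).
    exists (mkposreal _ Hd0). simpl. intros u v Hu Hv.
    apply (is_derive_RInt_endpoint (3 * H)).
    + intros t Ht. apply C1; auto. apply Hd1. exact (Rlt_le_trans _ _ _ Hu (Rmin_l _ _)).
    + apply Hd2. exact (Rlt_le_trans _ _ _ Hv (Rmin_r _ _)).
  - apply chord_ds_continuity_2d. apply Hpos; auto. }
set (r := fun s => sqrt (chord l s (w s))).
set (r1 := fun s => (w s + s * w1 s + s * w s ^ 2 + (s ^ 2 - l ^ 2) * w s * w1 s) / r s).
assert (Dr : forall s, - b < s < b -> is_derive r s (r1 s)).
{ intros s Hs. specialize (Dw' s Hs). assert (Hp0 := Hpos s (w s) Hs (Hws s Hs)).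
  assert (Hr := sqrt_lt_R0 _ Hp0). unfold r1, r.
  assert (Dc : is_derive (fun s => chord l s (w s)) s
    (2 * (w s + s * w1 s + s * w s ^ 2 + (s ^ 2 - l ^ 2) * w s * w1 s))).
  { unfold chord. auto_derive; [repeat split; eexists; eassumption|]. derive_subst Dw'. ring. }
  evar_last; [exact (is_derive_sqrt _ _ _ Dc Hp0)|]. simpl. field. simpl in Hr. lra. }
set (w2 := fun s => (h2 s - (Ex s (w s) + w1 s * chord_ds l s (w s)) - w1 s * r1 s) / r s).
assert (Hr : forall s, - b < s < b -> 9 / 10 <= r s).
{ intros s Hs. apply Hsq; [exact Hs|]. specialize (Hws s Hs). lra. }
exists w, w1, w2. intros s Hs.
destruct (Hh s Hs) as (Dh & Dh1 & Ode & B0 & B1 & B2).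
specialize (Hr s Hs). destruct (Hw s Hs) as [Bw EJ].
assert (Bw' : Rabs (w s) <= 2 * H) by (apply Rabs_le; lra).
assert (Hq : forall t, Rabs t <= Rabs (w s) -> Rabs t <= 2 * H /\ 9 / 10 <= sqrt (chord l s t) /\ 9 / 10 <= chord l s t).
{ intros t Ht. assert (T : Rabs t <= 2 * H) by lra. split; [exact T|].
  apply Rabs_le_between in T. split; [apply Hsq; auto; lra|].
  apply (chord_bounds b l (3 * H)); auto; lra. }
assert (Hdiv : forall x y, 9 / 10 <= y -> Rabs (x / y) <= 2 * Rabs x).
{ intros x y Hy. unfold Rdiv. rewrite Rabs_mult, Rmult_comm.
  apply Rmult_le_compat_r; [apply Rabs_pos|]. rewrite Rabs_pos_eq.
  - rewrite <- (Rinv_inv 2). apply Rinv_le_contravar; lra.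
  - apply Rlt_le, Rinv_0_lt_compat. lra. }
assert (Hs1 : Rabs s <= 1) by (apply Rabs_le; lra).
assert (Hsl : Rabs (s ^ 2 - l ^ 2) <= 1) by (apply Rabs_le; nra).
assert (Hlin : forall t, Rabs t <= 2 * H -> Rabs (t + s * t ^ 2) <= p).
{ intros t Ht. eapply Rle_trans; [apply Rabs_triang|]. unfold p.
  rewrite Rabs_mult, <- RPow_abs. pose proof (Rabs_pos t). pose proof (Rabs_pos s).
  assert (0 <= Rabs t ^ 2 <= 4 * H ^ 2) by nra. nra. }
assert (Bds : forall t, Rabs t <= Rabs (w s) -> Rabs (chord_ds l s t) <= 2 * p).
{ intros t Ht. destruct (Hq t Ht) as (Q1 & Q2 & Q3). unfold chord_ds.
  eapply Rle_trans; [now apply Hdiv|]. specialize (Hlin t Q1). lra. }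
assert (Bdss : forall t, Rabs t <= Rabs (w s) -> Rabs (chord_dss l s t) <= g).
{ intros t Ht. destruct (Hq t Ht) as (Q1 & Q2 & Q3). unfold chord_dss, g.
  eapply Rle_trans; [apply Rabs_triang|]. rewrite Rabs_Ropp. apply Rplus_le_compat.
  - eapply Rle_trans; [now apply Hdiv|]. apply Rmult_le_compat_l; [lra|].
    rewrite <- RPow_abs. apply pow_incr. split; [apply Rabs_pos | exact Q1].
  - assert (E : (t + s * t ^ 2) ^ 2 / (chord l s t * sqrt (chord l s t)) =
      ((t + s * t ^ 2) ^ 2 / chord l s t) / sqrt (chord l s t)) by (field; lra).
    assert (Q4 : 81 / 100 <= chord l s t * sqrt (chord l s t)) by nra.
    unfold Rdiv. rewrite Rabs_mult, Rmult_comm. rewrite <- RPow_abs.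
    apply Rmult_le_compat; [apply Rabs_pos | apply pow_le, Rabs_pos | |].
    + rewrite Rabs_pos_eq.
      * rewrite <- (Rinv_inv 2). apply Rinv_le_contravar; lra.
      * apply Rlt_le, Rinv_0_lt_compat. lra.
    + apply pow_incr. split; [apply Rabs_pos | now apply Hlin]. }
assert (BB : Rabs (Bx s (w s)) <= 2 * H * (2 * p)).
{ eapply Rle_trans; [apply (Rabs_RInt_le_bound (3 * H) _ (2 * p)); auto|].
  apply Rmult_le_compat_r; lra. }
assert (BE : Rabs (Ex s (w s)) <= 2 * H * g).
{ eapply Rle_trans; [apply (Rabs_RInt_le_bound (3 * H) _ g); auto|].
  apply Rmult_le_compat_r; lra. }
assert (Bw1 : Rabs (w1 s) <= c1).
{ unfold w1. eapply Rle_trans; [now apply Hdiv|]. unfold c1. apply Rmult_le_compat_l; [lra|].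
  eapply Rle_trans; [apply Rabs_triang|]. rewrite Rabs_Ropp. lra. }
assert (Br1 : Rabs (r1 s) <= 2 * (2 * H + c1 + 4 * H ^ 2 + 2 * H * c1)).
{ unfold r1. eapply Rle_trans; [now apply Hdiv|]. apply Rmult_le_compat_l; [lra|].
  pose proof (Rabs_pos s). pose proof (Rabs_pos (w s)). pose proof (Rabs_pos (w1 s)).
  pose proof (Rabs_pos (s ^ 2 - l ^ 2)).
  eapply Rle_trans; [apply Rabs_triang|]. apply Rplus_le_compat.
  - apply Rabs_plus3_le; [exact Bw' | |].
    + rewrite Rabs_mult. nra.
    + rewrite Rabs_mult, <- RPow_abs. assert (0 <= Rabs (w s) ^ 2 <= 4 * H ^ 2) by nra. nra.
  - rewrite Rmult_assoc, 2!Rabs_mult.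
    assert (0 <= Rabs (w s) * Rabs (w1 s) <= 2 * H * c1).
    { split; [nra|]. apply Rmult_le_compat; lra. }
    nra. }
split; [now apply Dw'|]. split; [|split; [exact Bw'|split; [lra|split]]].
- specialize (DB s Hs). specialize (Dr s Hs). unfold w2. unfold w1 at 1.
  change (fun s0 => (h1 s0 - Bx s0 (w s0)) / sqrt (chord l s0 (w s0))) with
    (fun s0 => (h1 s0 - (fun x => Bx x (w x)) s0) / r s0).
  assert (Ew1 : w1 s = (h1 s - (fun x => Bx x (w x)) s) / r s) by reflexivity.
  set (d := Ex s (w s) + w1 s * chord_ds l s (w s)) in *.
  set (f := fun x => Bx x (w x)) in *.
  assert (DB' : is_derive f s d) by exact DB. clear DB. clearbody f.
  revert Dr. generalize (r1 s) (w1 s) Ew1 Hr. clearbody r. clear - Dh1 DB'.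
  intros r' w' E Hr Dr. auto_derive; [derive_side|].
  derive_subst Dh1. derive_subst DB'. derive_subst Dr. rewrite E. field. lra.
- unfold w2. eapply Rle_trans; [now apply Hdiv|]. apply Rle_trans with c2; [|lra].
  unfold c2. apply Rmult_le_compat_l; [lra|].
  eapply Rle_trans; [apply Rabs_triang|]. rewrite Rabs_Ropp. apply Rplus_le_compat.
  + eapply Rle_trans; [apply Rabs_triang|]. rewrite Rabs_Ropp. apply Rplus_le_compat; [exact B2|].
    eapply Rle_trans; [apply Rabs_triang|]. apply Rplus_le_compat; [exact BE|].
    rewrite Rabs_mult. apply Rmult_le_compat; try apply Rabs_pos; [exact Bw1|].
    apply Bds, Rle_refl.
  + rewrite Rabs_mult. apply Rmult_le_compat; try apply Rabs_pos; [exact Bw1 | exact Br1].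
(* The two contributions of [Bx] cancel and leave 1 + 3 s h + (s^2 - l^2) h', which is rho by the
   linear equation. *)
- assert (I := RInt_chord_identity b l (3 * H) s (w s) Hl HT Hs (Hws s Hs)).
  fold (Bx s (w s)) in I. rewrite EJ in I.
  assert (Ew : w1 s * sqrt (chord l s (w s)) = h1 s - Bx s (w s)).
  { unfold w1. field. unfold r in Hr. lra. }
  set (q := sqrt (chord l s (w s))) in *.
  replace ((1 + 2 * s * w s + (s ^ 2 - l ^ 2) * w1 s) * q) with
    ((1 + 2 * s * w s) * q + (s ^ 2 - l ^ 2) * (w1 s * q)) by ring.
  rewrite Ew. lra.
Qed.

(** * The Langer transform *)

Lemma RInt_semicircle (l : R) :
  0 < l -> RInt (fun s => sqrt (l ^ 2 - s ^ 2)) (- l) l = PI / 2 * l ^ 2.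
Proof.
intros Hl. assert (HPI := PI_RGT_0).
assert (E := RInt_comp (V := R_CompleteNormedModule) (fun s => sqrt (l ^ 2 - s ^ 2))
  (fun t => l * sin t) (fun t => l * cos t) (- (PI / 2)) (PI / 2)).
cbv beta in E. rewrite sin_neg, sin_PI2 in E.
replace (l * - (1)) with (- l) in E by ring. rewrite Rmult_1_r in E.
rewrite <- E.
- assert (H : is_RInt (fun t => l ^ 2 * (cos t) ^ 2) (- (PI / 2)) (PI / 2) (PI / 2 * l ^ 2)).
  { replace (PI / 2 * l ^ 2) with
      (minus (l ^ 2 * ((PI / 2) / 2 + sin (PI / 2) * cos (PI / 2) / 2))
             (l ^ 2 * ((- (PI / 2)) / 2 + sin (- (PI / 2)) * cos (- (PI / 2)) / 2))).
    2:{ rewrite cos_neg, cos_PI2. unfold minus, plus, opp; simpl. field. }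
    apply (is_RInt_derive (V := R_CompleteNormedModule)
      (fun t => l ^ 2 * (t / 2 + sin t * cos t / 2))).
    - intros t _. auto_derive; [exact I|].
      assert (S := sin2_cos2 t). unfold Rsqr in S.
      replace (1 * / 2 + (1 * cos t * cos t + sin t * (1 * - sin t)) * / 2)
        with (cos t ^ 2 + (1 - (sin t * sin t + cos t * cos t)) / 2) by (simpl; field).
      rewrite S. simpl. field.
    - intros t _. apply (derive_continuous _ _ (l ^ 2 * (2 * cos t * - sin t))).
      auto_derive; [exact I | simpl; ring]. }
  rewrite <- (is_RInt_unique _ _ _ _ H). apply RInt_ext.
  intros t. rewrite Rmin_left, Rmax_right by lra. intros Ht.
  assert (Hc : 0 <= cos t) by (apply cos_ge_0; lra).
  unfold scal; simpl; unfold mult; simpl.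
  replace (l * (l * 1) - l * sin t * (l * sin t * 1)) with ((l * cos t) * (l * cos t)).
  2:{ assert (S := sin2_cos2 t). unfold Rsqr in S.
      replace (l * (l * 1)) with (l * l * (sin t * sin t + cos t * cos t)) by (rewrite S; ring). ring. }
  rewrite sqrt_square; [ring|]. apply Rmult_le_pos; lra.
- intros t _. apply weight_continuous.
- intros t _. split; [auto_derive; [exact I | ring]|].
  apply (derive_continuous _ _ (- l * sin t)). auto_derive; [exact I | ring].
Qed.

(** After subtraction of (c / 2) (s^2 - l^2) the function is still convex with zeros -l and l, hence
    nonnegative outside them and nonpositive between. Both cases say that the quotient by s^2 - l^2
    is at least c / 2. *)
Lemma convex_two_zeros (b1 c l : R) (f f1 f2 : R -> R) :
  0 < l < b1 -> f (- l) = 0 -> f l = 0 ->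
  (forall s, - b1 < s < b1 -> is_derive f s (f1 s) /\ is_derive f1 s (f2 s) /\ c <= f2 s) ->
  forall s, - b1 < s < b1 ->
    (l < Rabs s -> c / 2 * (s ^ 2 - l ^ 2) <= f s) /\
    (Rabs s < l -> f s <= c / 2 * (s ^ 2 - l ^ 2)).
Proof.
intros Hl Hm Hp Hf s Hs.
set (g := fun s => f s - c / 2 * (s ^ 2 - l ^ 2)). set (g1 := fun s => f1 s - c * s).
assert (Dg : forall s, - b1 < s < b1 -> is_derive g s (g1 s)).
{ intros x Hx. destruct (Hf x Hx) as (D & _ & _). unfold g, g1. auto_derive; [now exists (f1 x)|].
  derive_subst D. simpl. field. }
assert (G0 : g (- l) = 0) by (unfold g; rewrite Hm; ring).
assert (G1 : g l = 0) by (unfold g; rewrite Hp; ring).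
assert (Mon : forall x y, - b1 < x -> x <= y -> y < b1 -> g1 x <= g1 y).
{ intros x y Hx Hxy Hy. destruct (mean_value_le g1 (fun t => f2 t - c) x y ltac:(lra)) as [t [Ht E]].
  - intros t Ht. 
    destruct (Hf t ltac:(lra)) as (_ & D & _). unfold g1. auto_derive; [now exists (f2 t)|].
    derive_subst D. ring.
  - destruct (Hf t ltac:(lra)) as (_ & _ & Hc). nra. }
assert (MV : forall x y, - b1 < x -> x <= y -> y < b1 -> exists t, x <= t <= y /\ g y - g x = g1 t * (y - x)).
{ intros x y Hx Hxy Hy. destruct (mean_value_le g g1 x y ltac:(lra)) as [t [Ht E]].
  - intros t Ht. apply Dg. lra.
  - now exists t. }
destruct (MV (- l) l) as [x [Hx Ex]]; try lra.
assert (Zx : g1 x = 0) by (rewrite G0, G1 in Ex; nra).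
assert (Eg : f s = g s + c / 2 * (s ^ 2 - l ^ 2)) by (unfold g; ring).
rewrite Eg. split; intros HR.
- destruct (Rle_dec 0 s) as [P|P]; [rewrite Rabs_pos_eq in HR by lra | rewrite Rabs_left in HR by lra].
  + destruct (MV l s) as [t [Ht Et]]; try lra. pose proof (Mon x t). nra.
  + destruct (MV s (- l)) as [t [Ht Et]]; try lra. pose proof (Mon t x). nra.
- apply Rabs_def2 in HR. destruct (Rle_dec x s) as [P|P].
  + destruct (MV s l) as [t [Ht Et]]; try lra. pose proof (Mon x t). nra.
  + destruct (MV (- l) s) as [t [Ht Et]]; try lra. pose proof (Mon t x). nra.
Qed.

(** Two Hadamard quotients, at l and then at -l, lose two orders and keep the constant. The lower
    bound on the quotient comes from convexity off the turning points and from continuity at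
    them. *)
Lemma turning_point_factor (b1 K c l : R) (f f1 f2 : R -> R) :
  0 < l < b1 -> f (- l) = 0 -> f l = 0 -> lip_class 4 b1 K f ->
  (forall s, - b1 < s < b1 -> is_derive f s (f1 s) /\ is_derive f1 s (f2 s) /\ c <= f2 s) ->
  exists Q, lip_class 2 b1 K Q /\
    forall s, - b1 < s < b1 -> f s = (s ^ 2 - l ^ 2) * Q s /\ c / 2 <= Q s.
Proof.
intros Hl Hm Hp HK Hf.
destruct (hadamard_quotient 3 b1 K l f ltac:(lra) Hp HK) as [A [HA EA]].
assert (A0 : A (- l) = 0).
{ specialize (EA (- l) ltac:(lra)). rewrite Hm in EA.
  assert (0 = (2 * l) * A (- l)) by lra. apply Rmult_eq_reg_l with (2 * l); lra. }
destruct (hadamard_quotient 2 b1 K (- l) A ltac:(lra) A0 HA) as [Q [HQ EQ]].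
exists Q. split; [exact HQ|]. intros s Hs.
assert (EQf : forall s, - b1 < s < b1 -> f s = (s ^ 2 - l ^ 2) * Q s).
{ intros x Hx. rewrite EA, EQ by assumption. ring. }
split; [now apply EQf|].
assert (Hne : forall x, - b1 < x < b1 -> Rabs x <> l -> c / 2 <= Q x).
{ intros x Hx Hxl. destruct (convex_two_zeros b1 c l f f1 f2 Hl Hm Hp Hf x Hx) as [C1 C2].
  rewrite (EQf x Hx) in C1, C2. destruct (Rlt_dec l (Rabs x)) as [H|H].
  - specialize (C1 H). assert (0 < x ^ 2 - l ^ 2) by (rewrite <- (pow2_abs x); nra). nra.
  - assert (H' : Rabs x < l) by lra. specialize (C2 H'). pose proof (Rabs_pos x).
    assert (x ^ 2 - l ^ 2 < 0) by (rewrite <- (pow2_abs x); nra). nra. }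
destruct (Req_dec (Rabs s) l) as [E|E]; [|now apply Hne].
apply Rnot_lt_le. intros Hlt.
assert (HKp : 0 <= K) by (eapply Rle_trans; [apply Rabs_pos | apply (diff_class_bound true 2 b1 K Q HQ s Hs)]).
assert (Hcont := lip_class_continuous 2 b1 K Q s HQ Hs). apply continuity_pt_filterlim in Hcont.
destruct (Hcont (c / 2 - Q s) ltac:(lra)) as [d [Hd Hcd]].
assert (Hsa : Rabs s = s \/ Rabs s = - s) by (unfold Rabs; destruct (Rcase_abs s); auto).
(* A point slightly closer to 0 than s = l or s = -l: the lower bound is known there, and continuity
   of [Q] carries it to s. *)
set (x := s * (1 - Rmin (1 / 2) (d / (2 * l)))).
assert (Hr : 0 < Rmin (1 / 2) (d / (2 * l))) by (apply Rmin_pos; [lra | apply Rdiv_lt_0_compat; lra]).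
assert (Hr1 := Rmin_l (1 / 2) (d / (2 * l))). assert (Hr2 := Rmin_r (1 / 2) (d / (2 * l))).
set (r := Rmin (1 / 2) (d / (2 * l))) in *.
assert (Hrd : r * l <= d / 2).
{ apply Rle_trans with (d / (2 * l) * l); [apply Rmult_le_compat_r; lra | apply Req_le; field; lra]. }
assert (Hx : Rabs x < l) by (unfold x; rewrite Rabs_mult, E, Rabs_pos_eq by lra; nra).
assert (Hx' := Rabs_def2 _ _ Hx).
specialize (Hne x ltac:(lra) ltac:(lra)).
specialize (Hcd x). simpl in Hcd. unfold Rdist in Hcd.
assert (Hdist : Rabs (x - s) < d).
{ unfold x. replace (s * (1 - r) - s) with (- (s * r)) by ring.
  rewrite Rabs_Ropp, Rabs_mult, E, Rabs_pos_eq by lra. lra. }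
assert (Hxs : x <> s) by (unfold x; intros Heq; destruct Hsa; nra).
specialize (Hcd (conj (conj I (fun e => Hxs (eq_sym e))) Hdist)).
apply Rabs_def2 in Hcd. lra.
Qed.

Lemma weighted_average_bounds (l lo hi : R) (g : R -> R) :
  0 < l -> (forall s, - l <= s <= l -> continuous g s) ->
  (forall s, - l < s < l -> lo <= g s <= hi) ->
  let I := RInt (fun s => sqrt (l ^ 2 - s ^ 2) * g s) (- l) l in
  lo * (PI / 2 * l ^ 2) <= I <= hi * (PI / 2 * l ^ 2).
Proof.
intros Hl Hg Hb. rewrite <- RInt_semicircle by exact Hl. cbv zeta.
assert (Ew : ex_RInt (fun s => sqrt (l ^ 2 - s ^ 2)) (- l) l).
{ apply ex_RInt_continuous_interval; [lra|]. intros s _. apply weight_continuous. }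
assert (Eg : ex_RInt (fun s => sqrt (l ^ 2 - s ^ 2) * g s) (- l) l).
{ apply ex_RInt_continuous_interval; [lra|]. intros s Hs.
  apply (continuous_mult (K := R_AbsRing)); [apply weight_continuous | now apply Hg]. }
assert (Es : forall x, ex_RInt (fun s => x * sqrt (l ^ 2 - s ^ 2)) (- l) l)
  by (intros x; now apply (ex_RInt_scal (V := R_NormedModule))).
assert (Sc : forall x, RInt (fun s => x * sqrt (l ^ 2 - s ^ 2)) (- l) l =
  x * RInt (fun s => sqrt (l ^ 2 - s ^ 2)) (- l) l)
  by (intros x; apply (RInt_scal (V := R_CompleteNormedModule)); exact Ew).
rewrite <- !Sc.
split; (apply RInt_le; [lra | auto | auto |]); intros s Hs;
  specialize (Hb s Hs); pose proof (sqrt_pos (l ^ 2 - s ^ 2)); nra.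
Qed.

(* z is the Langer variable, normalised to fix the turning points -l and l,
   and a = (z')^(-1/2). *)
Lemma langer_transform (K c b1 : R) :
  0 < c -> 0 < b1 -> exists b M, 0 < b <= b1 /\ 1 <= M /\
  forall l (f f1 f2 : R -> R), 0 < l < b -> f (- l) = 0 -> f l = 0 -> lip_class 4 b1 K f ->
  (forall s, - b1 < s < b1 -> is_derive f s (f1 s) /\ is_derive f1 s (f2 s) /\ c <= f2 s) ->
  exists kap (z a a1 a2 : R -> R), / M <= kap <= M /\
    RInt (fun s => sqrt (- f s)) (- l) l = PI / 2 * (kap * l) ^ 2 /\
    forall s, - b < s < b ->
      is_derive z s (/ (a s) ^ 2) /\ is_derive a s (a1 s) /\ is_derive a1 s (a2 s) /\
      / M <= a s <= M /\ Rabs (a1 s) <= M /\ Rabs (a2 s) <= M /\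
      (a s) ^ 4 * f s = kap ^ 4 * ((z s) ^ 2 - l ^ 2) /\
      Rabs (z s - s) <= Rmax (Rabs s) l / 25.
Proof.
intros Hc Hb1.
set (K' := Rabs K + c).
assert (HK' : 0 < K') by (unfold K'; pose proof (Rabs_pos K); lra).
assert (HcK : c / 2 <= K') by (unfold K'; pose proof (Rabs_pos K); lra).
destruct (diff_class_rsqrt true 2 K' (c / 2) ltac:(lra) ltac:(lra)) as [K1 [HK1 Rs]].
assert (Hlo : 0 < sqrt (c / 2)) by (apply sqrt_lt_R0; lra).
assert (Hhi : sqrt (c / 2) <= sqrt K') by (apply sqrt_le_1_alt; lra).
set (lo := sqrt (c / 2)) in *. set (hi := sqrt K') in *.
set (K2 := 2 ^ 3 * (K' * K1)).
assert (HK2 : 0 <= K2) by (unfold K2; nra).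
set (B := 2 ^ 3 * (/ lo * K2) + 1).
assert (Hil : 0 < / lo) by now apply Rinv_0_lt_compat.
assert (HB : 1 <= B) by (unfold B; nra).
set (H := 105 * B).
destruct (nonlinear_solution H ltac:(unfold H; lra)) as [C [HC Nl]].
(* The bound 1 / (100 H) keeps [chord] between 9/10 and 11/10 for all values of w that occur. *)
set (b := Rmin b1 (Rmin 1 (/ (100 * H)))).
assert (Hb : 0 < b).
{ repeat apply Rmin_pos; try lra. apply Rinv_0_lt_compat. unfold H. lra. }
assert (Hbb : b <= b1) by apply Rmin_l.
assert (Hb2 : b <= 1) by (eapply Rle_trans; [apply Rmin_r | apply Rmin_l]).
assert (HbH : b * H <= / 100).
{ apply Rle_trans with (/ (100 * H) * H); [|apply Req_le; field; unfold H; lra].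
  apply Rmult_le_compat_r; [unfold H; lra|]. eapply Rle_trans; [apply Rmin_r | apply Rmin_r]. }
set (W := 2 * H + C).
assert (HW : 0 <= W) by (unfold W, H; lra).
set (F := 1 + 2 ^ 3 * (2 * (2 ^ 3 * (1 * W))) + 2 ^ 3 * (2 * (2 ^ 3 * (W * W)))).
assert (HWW : 0 <= W * W) by now apply Rmult_le_pos.
assert (HF : 0 <= F) by (unfold F; lra).
assert (HKK : 0 <= 2 ^ 3 * (K1 * K1)) by (apply Rmult_le_pos; [lra | now apply Rmult_le_pos]).
assert (Hhi2 : 0 <= hi ^ 2) by apply pow2_ge_0.
set (Y0 := 2 ^ 3 * (hi ^ 2 * (2 ^ 3 * (K1 * K1)))).
assert (HY0 : 0 <= Y0) by (apply Rmult_le_pos; [lra | now apply Rmult_le_pos]).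
set (X0 := 2 ^ 3 * (F * Y0)).
assert (HX0 : 0 <= X0) by (apply Rmult_le_pos; [lra | now apply Rmult_le_pos]).
set (x0 := 9 / 10 * lo ^ 2 * / K').
assert (Hx0 : 0 < x0).
{ unfold x0. apply Rmult_lt_0_compat; [apply Rmult_lt_0_compat; [lra | now apply pow_lt] | now apply Rinv_0_lt_compat]. }
set (x1 := 11 / 10 * hi ^ 2 * / (c / 2)).
destruct (diff_class_rsqrt false 2 X0 x0 HX0 Hx0) as [X1 [HX1 T1]].
assert (Hx1 : 0 < x1).
{ unfold x1. apply Rmult_lt_0_compat; [apply Rmult_lt_0_compat; [lra | apply pow_lt; lra] | apply Rinv_0_lt_compat; lra]. }
assert (Hx1s := sqrt_lt_R0 _ Hx1). assert (Hx1i := Rinv_0_lt_compat _ Hx1s).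
destruct (diff_class_rsqrt false 2 X1 (/ sqrt x1) HX1 Hx1i) as [X2 [_ T2]].
set (amin := / sqrt (/ sqrt x0)).
assert (Hamin : 0 < amin).
{ unfold amin. apply Rinv_0_lt_compat, sqrt_lt_R0, Rinv_0_lt_compat, sqrt_lt_R0, Hx0. }
set (M := 1 + Rabs X2 + / amin + hi + / lo).
assert (HX2 := Rabs_pos X2). assert (Hamin' := Rinv_0_lt_compat _ Hamin).
assert (HM1 : 1 <= M) by (unfold M; lra).
assert (HiM : forall x, 0 < x -> / x <= M -> / M <= x).
{ intros x Hx HxM. rewrite <- (Rinv_inv x). apply Rinv_le_contravar; [now apply Rinv_0_lt_compat | exact HxM]. }
exists b, M. split; [lra|]. split; [exact HM1|].
intros l f f1 f2 Hl Hfm Hfp Hf Df.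
destruct (turning_point_factor b1 K c l f f1 f2 ltac:(lra) Hfm Hfp Hf Df) as [Q [HQ EQ]].
assert (HQ' : lip_class 2 b1 K' Q).
{ revert HQ. apply diff_class_weaken; [lra|]. unfold K'. pose proof (Rle_abs K). lra. }
assert (HQlow : forall s, - b1 < s < b1 -> c / 2 <= Q s) by (intros; now apply EQ).
assert (HQhi : forall s, - b1 < s < b1 -> Q s <= K').
{ intros s Hs. eapply Rle_trans; [apply Rle_abs | now apply (diff_class_bound true 2 b1)]. }
set (P := fun s => / sqrt (Q s)).
assert (HP : lip_class 2 b1 K1 P) by now apply Rs.
set (rho := fun s => sqrt (Q s)).
assert (Hrp : forall s, - b1 < s < b1 -> lo <= rho s <= hi).
{ intros s Hs. unfold rho, lo, hi. split; apply sqrt_le_1_alt; auto. }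
assert (Hrho : lip_class 2 b1 K2 rho).
{ apply (diff_class_ext true 2 b1 K2 (fun s => Q s * P s)).
  - intros s Hs. unfold P, rho. specialize (Hrp s Hs). unfold rho in Hrp.
    rewrite <- (sqrt_sqrt (Q s)) at 1 by (specialize (HQlow s Hs); lra). field. lra.
  - apply diff_class_mult; auto; lra. }
assert (Crho : forall s, - b1 < s < b1 -> continuous rho s)
  by (intros s Hs; now apply (lip_class_continuous 2 b1 K2)).
set (J := RInt (fun s => sqrt (l ^ 2 - s ^ 2) * rho s) (- l) l : R).
assert (HPI := PI_RGT_0). assert (Hl2 : 0 < l ^ 2) by (apply pow_lt; lra).
assert (HS : 0 < PI / 2 * l ^ 2) by (apply Rmult_lt_0_compat; lra).
assert (HI : lo * (PI / 2 * l ^ 2) <= J <= hi * (PI / 2 * l ^ 2)).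
{ apply weighted_average_bounds; [lra | intros; apply Crho; lra | intros; apply Hrp; lra]. }
(* [k2] is kap^2, the average of rho = sqrt(Q) for the semicircle weight. Dividing by it gives rho /
   k2 - 1 zero mean, the solvability condition of the linear equation. *)
set (k2 := J / (PI / 2 * l ^ 2)).
assert (EI : J = k2 * (PI / 2 * l ^ 2)) by (unfold k2; field; lra).
assert (Hk2 : lo <= k2 <= hi).
{ rewrite EI in HI. split; apply Rmult_le_reg_r with (PI / 2 * l ^ 2); lra. }
assert (Hk2i : Rabs (/ k2) <= / lo).
{ rewrite Rabs_pos_eq by (apply Rlt_le, Rinv_0_lt_compat; lra). apply Rinv_le_contravar; lra. }
set (k := fun s => / k2 * rho s + - (1)).
assert (Hk : lip_class 2 b B k).
{ apply (diff_class_weaken true 2 b1 b B B k Hbb (Rle_refl _)). unfold k, B.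
  apply diff_class_plus.
  - apply (diff_class_mult true 2 b1 (/ lo) K2 (fun _ => / k2) rho); [lra | exact HK2 | | exact Hrho].
    now apply diff_class_const.
  - apply diff_class_const. rewrite Rabs_Ropp, Rabs_R1. lra. }
assert (Hmean : RInt (fun s => sqrt (l ^ 2 - s ^ 2) * k s) (- l) l = 0).
{ assert (Ew : is_RInt (fun s => sqrt (l ^ 2 - s ^ 2)) (- l) l (PI / 2 * l ^ 2)).
  { rewrite <- RInt_semicircle by lra. apply (RInt_correct (V := R_CompleteNormedModule)).
    apply ex_RInt_continuous_interval; [lra|]. intros s _. apply weight_continuous. }
  assert (Er : is_RInt (fun s => sqrt (l ^ 2 - s ^ 2) * rho s) (- l) l J).
  { apply (RInt_correct (V := R_CompleteNormedModule)).
    apply ex_RInt_continuous_interval; [lra|]. intros s Hs.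
    apply (continuous_mult (K := R_AbsRing)); [apply weight_continuous | apply Crho; lra]. }
  apply is_RInt_unique.
  replace 0 with (minus (scal (/ k2) J) (PI / 2 * l ^ 2)).
  2:{ unfold minus, plus, opp, scal; simpl; unfold mult; simpl. simpl in EI. rewrite EI. field. lra. }
  eapply is_RInt_ext; [|apply (is_RInt_minus (V := R_NormedModule));
    [apply (is_RInt_scal (V := R_NormedModule)); exact Er | exact Ew]].
  intros s _. unfold minus, plus, opp, scal, k; simpl; unfold mult; simpl. ring. }
destruct (regular_solution b B l k Hl Hb2 Hk Hmean) as (h & h1 & h2 & Hh).
destruct (Nl b l h h1 h2 (fun s => / k2 * rho s) Hl Hb2 HbH) as (w & w1 & w2 & Hw).
{ intros s Hs. destruct (Hh s Hs) as (A1 & A2 & A3 & A4 & A5 & A6).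
  split; [exact A1|]. split; [exact A2|]. split; [rewrite A3; unfold k; ring|]. auto. }
set (z := fun s => s + (s ^ 2 - l ^ 2) * w s).
set (Phi := fun s => chord l s (w s)).
assert (HPhi : forall s, - b < s < b -> 9 / 10 <= Phi s <= 11 / 10).
{ intros s Hs. destruct (Hw s Hs) as (_ & _ & Bw & _). apply Rabs_le_between in Bw.
  apply (chord_bounds b l (2 * H)); auto; lra. }
assert (TS : diff_class false 2 b 1 (fun s => s)).
{ split; [intros s Hs; apply Rabs_le; lra|].
  exists (fun _ => 1). split; [intros s _; apply (is_derive_id (K := R_AbsRing))|].
  apply (diff_class_const false 1). rewrite Rabs_R1. lra. }
assert (TSL : diff_class false 2 b 2 (fun s => s ^ 2 - l ^ 2)).
{ assert (0 <= l ^ 2 <= 1) by nra. split.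
  - intros s Hs. assert (0 <= s ^ 2 <= 1) by nra. apply Rabs_le; lra.
  - exists (fun s => 2 * s). split; [intros s _; auto_derive; [exact I | simpl; ring]|].
    split; [intros s Hs; apply Rabs_le; lra|].
    exists (fun _ => 2). split; [intros s _; auto_derive; [exact I | ring]|].
    apply (diff_class_const false 0). rewrite Rabs_pos_eq; lra. }
assert (TW : diff_class false 2 b W w).
{ assert (0 < H) by (unfold H; lra). unfold W.
  split; [intros s Hs; destruct (Hw s Hs) as (_ & _ & A & _); lra|].
  exists w1. split; [intros s Hs; apply (Hw s Hs)|].
  split; [intros s Hs; destruct (Hw s Hs) as (_ & _ & _ & A & _); lra|].
  exists w2. split; [intros s Hs; apply (Hw s Hs)|].
  split; [intros s Hs; destruct (Hw s Hs) as (_ & _ & _ & _ & A & _); lra | exact I]. }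
assert (TPhi : diff_class false 2 b F Phi).
{ apply (diff_class_ext false 2 b F (fun s => 1 + 2 * (s * w s) + (s ^ 2 - l ^ 2) * (w s * w s))).
  { intros s _. unfold Phi, chord. ring. }
  apply diff_class_plus; [apply (diff_class_plus false 2 b 1 _ (fun _ => 1) (fun s => 2 * (s * w s)))|].
  - apply diff_class_const. rewrite Rabs_R1. lra.
  - apply (diff_class_mult false 2 b 2 _ (fun _ => 2) (fun s => s * w s)); [lra | lra | |].
    + apply diff_class_const. rewrite Rabs_pos_eq; lra.
    + apply (diff_class_mult false 2 b 1 W (fun s => s) w); auto; lra.
  - apply (diff_class_mult false 2 b 2 _ (fun s => s ^ 2 - l ^ 2) (fun s => w s * w s)); auto; [lra | lra|].
    now apply diff_class_mult. }
(* This is a^4 = z'^(-2), written as kap^4 Phi / Q. It involves w but not w', hence has two bounded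
   derivatives; the formula z' = 1 + 2 s w + (s^2 - l^2) w' would yield only one. *)
set (X := fun s => Phi s * (k2 ^ 2 * (P s * P s))).
assert (Hk22 : lo ^ 2 <= k2 ^ 2 <= hi ^ 2) by (split; apply pow_incr; lra).
assert (HPr : forall s, - b1 < s < b1 -> P s * rho s = 1 /\ P s * P s * Q s = 1 /\ 0 < P s /\ 0 < rho s).
{ intros s Hs. specialize (HQlow s Hs). assert (Hq : 0 < sqrt (Q s)) by (apply sqrt_lt_R0; lra).
  assert (E := sqrt_sqrt (Q s) ltac:(lra)).
  unfold P, rho. split; [field; lra|]. split; [rewrite <- E at 3; field; lra|].
  split; [now apply Rinv_0_lt_compat | exact Hq]. }
assert (HXb : forall s, - b < s < b -> x0 <= X s <= x1).
{ intros s Hs. assert (Hs1 : - b1 < s < b1) by lra. specialize (HPhi s Hs).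
  destruct (HPr s Hs1) as (R1 & R2 & R3 & R4).
  assert (EP : P s * P s = / Q s).
  { apply Rmult_eq_reg_r with (Q s); [rewrite R2; field|]; specialize (HQlow s Hs1); lra. }
  assert (Q1 : / K' <= / Q s) by (apply Rinv_le_contravar; [specialize (HQlow s Hs1); lra | now apply HQhi]).
  assert (Q2 : / Q s <= / (c / 2)) by (apply Rinv_le_contravar; [lra | now apply HQlow]).
  assert (Hi : 0 < / K') by now apply Rinv_0_lt_compat.
  assert (Hlo2 : 0 < lo ^ 2) by now apply pow_lt.
  unfold X, x0, x1. rewrite EP, !Rmult_assoc. split.
  - apply Rmult_le_compat; [lra | apply Rmult_le_pos; lra | lra | apply Rmult_le_compat; lra].
  - apply Rmult_le_compat; [lra | apply Rmult_le_pos; lra | lra | apply Rmult_le_compat; lra]. }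
assert (TX : diff_class false 2 b X0 X).
{ apply diff_class_mult; auto.
  apply (diff_class_mult false 2 b (hi ^ 2) _ (fun _ => k2 ^ 2) (fun s => P s * P s)); auto.
  - apply diff_class_const. rewrite Rabs_pos_eq; [lra | apply pow2_ge_0].
  - assert (TP : diff_class false 2 b K1 P).
    { apply diff_class_forget, (diff_class_weaken true 2 b1 b K1 K1); auto. lra. }
    now apply diff_class_mult. }
assert (TX1 := T1 b X TX (fun s Hs => proj1 (HXb s Hs))).
assert (TX2 : diff_class false 2 b X2 (fun s => / sqrt (/ sqrt (X s)))).
{ apply (T2 b _ TX1). intros s Hs. destruct (HXb s Hs) as [H1 H2].
  apply Rinv_le_contravar; [apply sqrt_lt_R0; lra | now apply sqrt_le_1_alt]. }
(* The fourth root of [X], written with two inverse square roots so that [diff_class_rsqrt] applies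
   twice. *)
set (a := fun s => / sqrt (/ sqrt (X s))) in *.
destruct TX2 as [Ta [a1 [Da [Ta1 [a2 [Da1 [Ta2 _]]]]]]].
assert (Hkap := sqrt_lt_R0 k2 ltac:(lra)). assert (Ekap := sqrt_sqrt k2 ltac:(lra)).
set (kap := sqrt k2) in *.
exists kap, z, a, a1, a2.
assert (HkM : kap <= M) by (assert (kap <= 1 + k2) by nra; unfold M; lra).
assert (HkM' : / kap <= M).
{ apply Rle_trans with (1 + / k2).
  - rewrite <- Ekap, Rinv_mult. assert (0 < / kap) by now apply Rinv_0_lt_compat. nra.
  - rewrite Rabs_pos_eq in Hk2i by (apply Rlt_le, Rinv_0_lt_compat; lra). unfold M. lra. }
split; [split; [now apply HiM | exact HkM]|].
split.
- transitivity J; [|transitivity (k2 * (PI / 2 * l ^ 2)); [exact EI|]];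
    [|change (k2 * (PI / 2 * l ^ 2) = PI / 2 * (kap * l) ^ 2); rewrite <- Ekap; ring].
  apply RInt_ext. intros s. rewrite Rmin_left, Rmax_right by lra. intros Hs.
  destruct (EQ s ltac:(lra)) as [E1 E2]. rewrite E1.
  replace (- ((s ^ 2 - l ^ 2) * Q s)) with ((l ^ 2 - s ^ 2) * Q s) by ring.
  unfold rho. apply sqrt_mult; [nra | lra].
- intros s Hs. assert (A3 := Ta s Hs). assert (A4 := Ta1 s Hs). assert (A5 := Ta2 s Hs).
  destruct (HXb s Hs) as [XL XH]. assert (HX : 0 < X s) by lra.
  destruct (HPr s ltac:(lra)) as (R1 & R2 & R3 & R4). specialize (HPhi s Hs).
  assert (HsX := sqrt_lt_R0 _ HX). assert (HisX := Rinv_0_lt_compat _ HsX).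
  assert (HssX := sqrt_lt_R0 _ HisX).
  assert (Ea2 : a s ^ 2 = sqrt (X s)).
  { unfold a. simpl. rewrite Rmult_1_r, <- Rinv_mult, sqrt_sqrt by lra. apply Rinv_inv. }
  assert (Ea4 : a s ^ 4 = X s).
  { replace (a s ^ 4) with (a s ^ 2 * a s ^ 2) by ring. rewrite Ea2. apply sqrt_sqrt. lra. }
  assert (HsPhi : 0 < sqrt (Phi s)) by (apply sqrt_lt_R0; lra).
  assert (EsX : sqrt (X s) = sqrt (Phi s) * (k2 * P s)).
  { rewrite <- (sqrt_square (sqrt (Phi s) * (k2 * P s))) by (apply Rmult_le_pos; [|apply Rmult_le_pos]; lra).
    f_equal. unfold X. rewrite <- (sqrt_sqrt (Phi s)) at 1 by lra. ring. }
  destruct (Hw s Hs) as (W1 & W2 & W3 & W4 & W5 & W6).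
  split.
  { evar_last.
    - unfold z. instantiate (1 := 1 + 2 * s * w s + (s ^ 2 - l ^ 2) * w1 s).
      auto_derive; [now exists (w1 s)|]. derive_subst W1. simpl. ring.
    - rewrite Ea2, EsX. fold (Phi s) in W6.
      apply Rmult_eq_reg_r with (sqrt (Phi s)); [|lra]. rewrite W6.
      assert (ER : rho s = / P s) by (apply Rmult_eq_reg_l with (P s); [rewrite R1; field; lra | lra]).
      rewrite ER. field. lra. }
  split; [now apply Da|]. split; [now apply Da1|].
  assert (Hapos : 0 < a s) by (unfold a; now apply Rinv_0_lt_compat).
  assert (HXM : Rabs X2 <= M) by (unfold M; lra). pose proof (Rle_abs X2).
  assert (Halow : amin <= a s).
  { unfold amin, a. apply Rinv_le_contravar; [exact HssX|]. apply sqrt_le_1_alt.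
    apply Rinv_le_contravar; [now apply sqrt_lt_R0 | now apply sqrt_le_1_alt]. }
  split.
  { split; [|rewrite Rabs_pos_eq in A3; lra]. apply HiM; [exact Hapos|].
    apply Rle_trans with (/ amin); [now apply Rinv_le_contravar | unfold M; lra]. }
  split; [lra|]. split; [lra|]. split.
  + rewrite Ea4. destruct (EQ s ltac:(lra)) as [E1 _]. rewrite E1.
    replace (kap ^ 4) with (k2 ^ 2) by (rewrite <- Ekap; ring).
    transitivity (k2 ^ 2 * ((s ^ 2 - l ^ 2) * Phi s) * (P s * P s * Q s)); [unfold X; ring|].
    rewrite R2. unfold Phi, chord, z. ring.
  + unfold z. replace (s + (s ^ 2 - l ^ 2) * w s - s) with ((s ^ 2 - l ^ 2) * w s) by ring.
    rewrite Rabs_mult. set (m := Rmax (Rabs s) l).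
    assert (Hm1 : Rabs s <= m) by apply Rmax_l. assert (Hm2 : l <= m) by apply Rmax_r.
    assert (Hmb : m <= b).
    { apply Rmax_lub; [apply Rabs_le; lra | lra]. }
    pose proof (Rabs_pos s).
    assert (Hsl : Rabs (s ^ 2 - l ^ 2) <= m ^ 2).
    { assert (Rabs s ^ 2 <= m ^ 2) by (apply pow_incr; lra).
      assert (l ^ 2 <= m ^ 2) by (apply pow_incr; lra).
      pose proof (pow2_ge_0 (Rabs s)). pose proof (pow2_ge_0 l).
      apply Rabs_le. rewrite <- (pow2_abs s). lra. }
    apply Rle_trans with (m ^ 2 * (2 * H)).
    * apply Rmult_le_compat; auto using Rabs_pos.
    * replace (m ^ 2 * (2 * H)) with (m * (m * H) * 2) by ring.
      assert (m * H <= / 100).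
      { apply Rle_trans with (b * H); [apply Rmult_le_compat_r; [unfold H|]; lra | exact HbH]. }
      assert (m * (m * H) <= m * / 100) by (apply Rmult_le_compat_l; lra). lra.
Qed.

(** * Sturm comparison *)

Lemma continuous_pos_near (f : R -> R) (x : R) :
  continuous f x -> 0 < f x -> exists d, 0 < d /\ forall y, Rabs (y - x) < d -> 0 < f y.
Proof.
intros Hc Hp. apply continuity_pt_filterlim in Hc. destruct (Hc (f x) Hp) as [d [Hd H]].
exists d. split; [exact Hd|]. intros y Hy. destruct (Req_dec y x) as [->|Hne]; [exact Hp|].
specialize (H y). simpl in H. unfold Rdist in H.
assert (Hyx : Rabs (f y - f x) < f x) by (apply H; split; [split; [exact I | congruence] | exact Hy]).
apply Rabs_def2 in Hyx. lra.
Qed.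

Lemma nonneg_at_left_end (f : R -> R) (x y : R) :
  x < y -> continuous f x -> (forall t, x < t < y -> 0 < f t) -> 0 <= f x.
Proof.
intros Hxy Hc Hp. apply Rnot_lt_le. intros Hn.
destruct (continuous_pos_near (fun t => - f t) x) as [d [Hd H]].
- now apply (continuous_opp (V := R_NormedModule)).
- lra.
- set (t := x + Rmin (d / 2) ((y - x) / 2)).
  assert (0 < Rmin (d / 2) ((y - x) / 2)) by (apply Rmin_pos; lra).
  pose proof (Rmin_l (d / 2) ((y - x) / 2)). pose proof (Rmin_r (d / 2) ((y - x) / 2)).
  specialize (H t). specialize (Hp t ltac:(unfold t; lra)).
  rewrite Rabs_pos_eq in H by (unfold t; lra). specialize (H ltac:(unfold t; lra)). lra.
Qed.

Lemma derive_nonneg_at_left_end (f f1 : R -> R) (x y : R) :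
  x < y -> (forall t, x <= t < y -> is_derive f t (f1 t)) -> continuous f1 x ->
  f x = 0 -> (forall t, x < t < y -> 0 < f t) -> 0 <= f1 x.
Proof.
intros Hxy Hd Hc H0 Hp. apply Rnot_lt_le. intros Hn.
destruct (continuous_pos_near (fun t => - f1 t) x) as [d [Hdp H]].
- now apply (continuous_opp (V := R_NormedModule)).
- lra.
- set (t := x + Rmin (d / 2) ((y - x) / 2)).
  assert (0 < Rmin (d / 2) ((y - x) / 2)) by (apply Rmin_pos; lra).
  pose proof (Rmin_l (d / 2) ((y - x) / 2)). pose proof (Rmin_r (d / 2) ((y - x) / 2)).
  assert (Ht : x < t < y) by (unfold t; lra).
  destruct (mean_value_le f f1 x t ltac:(lra)) as [c [Hc1 E]].
  + intros u Hu. apply Hd. lra.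
  + specialize (Hp t Ht).
    specialize (H c). rewrite Rabs_pos_eq in H by lra. specialize (H ltac:(unfold t in *; lra)).
    rewrite H0 in E. nra.
Qed.

Lemma constant_sign (f : R -> R) (x y c : R) :
  x < c < y -> (forall t, x < t < y -> continuous f t) -> (forall t, x < t < y -> f t <> 0) ->
  0 < f c -> forall t, x < t < y -> 0 < f t.
Proof.
intros Hc Hf Hn Hp t Ht.
destruct (Rtotal_order (f t) 0) as [H|[H|H]]; [exfalso | now elim (Hn t Ht) | exact H].
destruct (Rtotal_order t c) as [H1|[H1|H1]]; [| subst; lra |].
- destruct (IVT_interv f t c) as [z [Hz Ez]]; auto.
  + intros u Hu. apply continuity_pt_filterlim, Hf. lra.
  + apply (Hn z); [lra | exact Ez].
- destruct (IVT_interv (fun u => - f u) c t) as [z [Hz Ez]]; [|lra|lra|lra|].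
  + intros u Hu. apply continuity_pt_opp, continuity_pt_filterlim, Hf. lra.
  + apply (Hn z); [lra | lra].
Qed.

Lemma last_zero (g : R -> R) (x c : R) :
  x < c -> (forall t, x <= t <= c -> continuous g t) -> g x = 0 -> g c <> 0 ->
  exists a, x <= a < c /\ g a = 0 /\ forall t, a < t <= c -> g t <> 0.
Proof.
intros Hxc Hg Hx Hc.
destruct (completeness (fun t => x <= t <= c /\ g t = 0)) as [a [Ha1 Ha2]].
- exists c. intros t Ht. lra.
- exists x. split; [lra | exact Hx].
- assert (Hxa : x <= a) by (apply Ha1; split; [lra | exact Hx]).
  assert (Hac : a <= c) by (apply Ha2; intros t Ht; lra).
  assert (Hga : g a = 0).
  { apply NNPP. intros Hne.
    destruct (continuous_pos_near (fun t => g t * g t) a) as [d [Hd H]].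
    - apply (continuous_mult (K := R_AbsRing)); apply Hg; lra.
    - nra.
    - assert (Hub : a <= a - d / 2).
      { apply Ha2. intros t [Ht Et]. apply Rnot_lt_le. intros Hlt.
        assert (Hta : t <= a) by (apply Ha1; auto).
        specialize (H t). rewrite Rabs_left1 in H by lra. specialize (H ltac:(lra)).
        rewrite Et in H. lra. }
      lra. }
  exists a. split; [|split; [exact Hga|]].
  + split; [exact Hxa|]. destruct Hac as [H|H]; [exact H | congruence].
  + intros t Ht Et. assert (t <= a) by (apply Ha1; split; [lra | exact Et]). lra.
Qed.

(** * Wronskians and the two basic comparisons *)

Definition solves (q : R -> R) (b : R) (f f1 : R -> R) : Prop :=
  forall x, - b < x < b -> is_derive f x (f1 x) /\ is_derive f1 x (q x * f x).

Lemma solves_opp (q : R -> R) (b : R) (f f1 : R -> R) :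
  solves q b f f1 -> solves q b (fun x => - f x) (fun x => - f1 x).
Proof.
intros H x Hx. destruct (H x Hx) as [H1 H2]. split.
- now apply (is_derive_opp (V := R_NormedModule)).
- replace (q x * - f x) with (- (q x * f x)) by ring.
  now apply (is_derive_opp (V := R_NormedModule)).
Qed.

Lemma solves_reflect (q : R -> R) (b : R) (f f1 : R -> R) :
  solves q b f f1 -> solves (fun x => q (- x)) b (fun x => f (- x)) (fun x => - f1 (- x)).
Proof.
intros H x Hx. destruct (H (- x) ltac:(lra)) as [H1 H2]. split.
- auto_derive; [now exists (f1 (- x))|]. derive_subst H1. ring.
- auto_derive; [now exists (q (- x) * f (- x))|]. derive_subst H2. ring.
Qed.

Lemma solves_continuous (q : R -> R) (b : R) (f f1 : R -> R) :
  solves q b f f1 -> forall x, - b < x < b -> continuous f x.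
Proof. intros H x Hx. exact (derive_continuous f x _ (proj1 (H x Hx))). Qed.

Lemma solves_continuous' (q : R -> R) (b : R) (f f1 : R -> R) :
  solves q b f f1 -> forall x, - b < x < b -> continuous f1 x.
Proof. intros H x Hx. exact (derive_continuous f1 x _ (proj2 (H x Hx))). Qed.

(** Gronwall's argument: (f^2 + f'^2) exp(-(1 + L) t) is nonincreasing. *)
Lemma cauchy_zero_right (q : R -> R) (b L : R) (f f1 : R -> R) (x0 : R) :
  solves q b f f1 -> (forall x, - b < x < b -> Rabs (q x) <= L) -> - b < x0 < b ->
  f x0 = 0 -> f1 x0 = 0 -> forall x, x0 <= x < b -> f x = 0.
Proof.
intros Hs HL Hx0 E0 E1 x Hx.
destruct (mean_value_le (fun t => (f t ^ 2 + f1 t ^ 2) * exp (- ((1 + L) * t)))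
  (fun t => (2 * (f t * f1 t) * (1 + q t) - (1 + L) * (f t ^ 2 + f1 t ^ 2)) * exp (- ((1 + L) * t)))
  x0 x ltac:(lra)) as [c [Hc E]].
- intros t Ht.
  destruct (Hs t ltac:(lra)) as [D1 D2].
  auto_derive; [derive_side|].
  derive_subst D1. derive_subst D2. simpl. ring.
- 
  rewrite E0, E1 in E. specialize (HL c ltac:(lra)). apply Rabs_le_between in HL.
  assert (Hneg : 2 * (f c * f1 c) * (1 + q c) - (1 + L) * (f c ^ 2 + f1 c ^ 2) <= 0).
  { assert (- (f c ^ 2 + f1 c ^ 2) <= 2 * (f c * f1 c) <= f c ^ 2 + f1 c ^ 2).
    { pose proof (pow2_ge_0 (f c + f1 c)). pose proof (pow2_ge_0 (f c - f1 c)). simpl in *. lra. }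
    set (u := f c ^ 2 + f1 c ^ 2) in *. set (v := 2 * (f c * f1 c)) in *.
    destruct (Rle_dec 0 (1 + q c)); nra. }
  pose proof (exp_pos (- ((1 + L) * c))) as P1. pose proof (exp_pos (- ((1 + L) * x))) as P2.
  assert (Hprod : (2 * (f c * f1 c) * (1 + q c) - (1 + L) * (f c ^ 2 + f1 c ^ 2)) * exp (- ((1 + L) * c)) <= 0) by nra.
  assert (Hle : (f x ^ 2 + f1 x ^ 2) * exp (- ((1 + L) * x)) <= 0).
  { replace ((0 ^ 2 + 0 ^ 2) * exp (- ((1 + L) * x0))) with 0 in E by ring.
    rewrite Rminus_0_r in E. rewrite E. assert (0 <= x - x0) by lra. nra. }
  assert (f x ^ 2 + f1 x ^ 2 <= 0) by nra.
  pose proof (pow2_ge_0 (f1 x)). pose proof (pow2_ge_0 (f x)).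
  assert (Ef : f x * f x = 0) by (simpl in *; lra). now apply Rsqr_0_uniq.
Qed.

Lemma cauchy_zero (q : R -> R) (b L : R) (f f1 : R -> R) (x0 : R) :
  solves q b f f1 -> (forall x, - b < x < b -> Rabs (q x) <= L) -> - b < x0 < b ->
  f x0 = 0 -> f1 x0 = 0 -> forall x, - b < x < b -> f x = 0.
Proof.
intros Hs HL Hx0 E0 E1 x Hx.
destruct (Rle_dec x0 x) as [H|H]; [apply (cauchy_zero_right q b L f f1 x0); auto; lra|].
rewrite <- (Ropp_involutive x).
apply (cauchy_zero_right (fun x => q (- x)) b L (fun x => f (- x)) (fun x => - f1 (- x)) (- x0)); try lra.
- now apply solves_reflect.
- intros t Ht. apply HL. lra.
- now rewrite Ropp_involutive.
- rewrite Ropp_involutive, E1. ring.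
Qed.

Lemma wronskian_derive (qf qg : R -> R) (b : R) (f f1 g g1 : R -> R) (x : R) :
  solves qf b f f1 -> solves qg b g g1 -> - b < x < b ->
  is_derive (fun x => g x * f1 x - g1 x * f x) x ((qf x - qg x) * (f x * g x)).
Proof.
intros Hf Hg Hx. destruct (Hf x Hx) as [F1 F2]. destruct (Hg x Hx) as [G1 G2].
auto_derive; [derive_side|].
derive_subst F1. derive_subst F2. derive_subst G1. derive_subst G2. ring.
Qed.

Lemma wronskian_decreasing (qf qg : R -> R) (b m : R) (f f1 g g1 : R -> R) (x y : R) :
  solves qf b f f1 -> solves qg b g g1 -> (forall t, - b < t < b -> qf t + m <= qg t) ->
  - b < x -> x <= y -> y < b ->
  forall p, 0 <= p -> 0 <= m -> (forall t, x <= t <= y -> p <= f t * g t) ->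
  g y * f1 y - g1 y * f y <= g x * f1 x - g1 x * f x - m * p * (y - x).
Proof.
intros Hf Hg Hq Hx Hxy Hy p Hp Hm Hpp.
destruct (mean_value_le (fun x => g x * f1 x - g1 x * f x) (fun x => (qf x - qg x) * (f x * g x)) x y ltac:(lra))
  as [c [Hc E]].
- intros t Ht.
  apply (wronskian_derive qf qg b); auto. lra.
- specialize (Hq c ltac:(lra)). specialize (Hpp c Hc).
  assert ((qf c - qg c) * (f c * g c) <= - (m * p)) by nra. nra.
Qed.

(** The Wronskian g f' - g' f equals -g' f at x and at y, so it is at most 0 at x and at least 0 at
    y; but its derivative (qf - qg) f g is negative in between. *)
Lemma sturm_between_core (qf qg : R -> R) (b m : R) (f f1 g g1 : R -> R) (x y : R) :
  solves qf b f f1 -> solves qg b g g1 -> 0 < m -> (forall t, - b < t < b -> qf t + m <= qg t) ->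
  - b < x -> x < y -> y < b -> g x = 0 -> g y = 0 ->
  (forall t, x < t < y -> 0 < f t) -> (forall t, x < t < y -> 0 < g t) -> False.
Proof.
intros Hf Hg Hm Hq Hx Hxy Hy Gx Gy Pf Pg.
assert (Hfx : 0 <= f x).
{ apply (nonneg_at_left_end f x y); auto. apply (solves_continuous qf b f f1); auto; lra. }
assert (Hfy : 0 <= f y).
{ rewrite <- (Ropp_involutive y).
  apply (nonneg_at_left_end (fun t => f (- t)) (- y) (- x)); [lra | | intros; apply Pf; lra].
  apply (solves_continuous _ b _ _ (solves_reflect _ _ _ _ Hf)); lra. }
assert (Hgx : 0 <= g1 x).
{ apply (derive_nonneg_at_left_end g g1 x y); auto.
  - intros t Ht. apply Hg. lra.
  - apply (solves_continuous' qg b g g1); auto; lra. }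
assert (Hgy : g1 y <= 0).
{ assert (Hr := solves_reflect _ _ _ _ Hg).
  assert (H : 0 <= (fun t => - g1 (- t)) (- y)).
  { apply (derive_nonneg_at_left_end (fun t => g (- t)) (fun t => - g1 (- t)) (- y) (- x)); [lra | | | |].
    - intros t Ht. apply Hr. lra.
    - apply (solves_continuous' _ b _ _ Hr); lra.
    - now rewrite Ropp_involutive.
    - intros; apply Pg; lra. }
  cbv beta in H. rewrite Ropp_involutive in H. lra. }
set (x' := x + (y - x) / 3). set (y' := x + 2 * (y - x) / 3).
assert (Pfg : forall t, x <= t <= y -> 0 <= f t * g t).
{ intros t Ht. destruct (Req_dec t x) as [->|H1]; [rewrite Gx; lra|].
  destruct (Req_dec t y) as [->|H2]; [rewrite Gy; lra|].
  specialize (Pf t ltac:(lra)). specialize (Pg t ltac:(lra)). nra. }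
assert (W1 := wronskian_decreasing qf qg b m f f1 g g1 x x' Hf Hg Hq Hx ltac:(unfold x'; lra)
  ltac:(unfold x'; lra) 0 ltac:(lra) ltac:(lra) ltac:(intros t Ht; apply Pfg; unfold x' in Ht; lra)).
assert (W3 := wronskian_decreasing qf qg b m f f1 g g1 y' y Hf Hg Hq ltac:(unfold y'; lra) ltac:(unfold y'; lra)
  Hy 0 ltac:(lra) ltac:(lra) ltac:(intros t Ht; apply Pfg; unfold y' in Ht; lra)).
assert (W2 : g y' * f1 y' - g1 y' * f y' < g x' * f1 x' - g1 x' * f x').
{ destruct (mean_value_le (fun x => g x * f1 x - g1 x * f x) (fun x => (qf x - qg x) * (f x * g x)) x' y' ltac:(unfold x', y'; lra))
    as [c [Hc E]].
  - intros t Ht.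
    apply (wronskian_derive qf qg b); auto. unfold x', y' in Ht. lra.
  - 
    assert (Hc' : x < c < y) by (unfold x', y' in Hc; lra).
    specialize (Pf c Hc'). specialize (Pg c Hc'). specialize (Hq c ltac:(lra)).
    assert (0 < f c * g c) by nra. assert (0 < y' - x') by (unfold x', y'; lra).
    assert ((qf c - qg c) * (f c * g c) < 0) by nra. nra. }
rewrite Gx in W1. rewrite Gy in W3. nra.
Qed.

(** With no zero at the end b, the quotient f / g is used instead. On [b0, b0 + d] the Wronskian
    becomes negative by a definite amount; this drives f / g down on [b0 + 2 d, b0 + 3 d], the more
    so as g has decayed. For large K the quotient would become negative. The three steps of length d
    separate gaining the Wronskian, letting g decay and using both. *)
Lemma sturm_end_core (qf qg : R -> R) (b b0 d K m : R) (f f1 g g1 : R -> R) (x : R) :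
  solves qf b f f1 -> solves qg b g g1 -> 0 < m -> (forall t, - b < t < b -> qf t + m <= qg t) ->
  0 < d -> b0 + 3 * d < b -> 0 <= K -> 1 < m * d ^ 2 * (1 + 2 * K * d) ->
  (forall t, b0 <= t < b -> f t * f1 t <= - K * f t ^ 2) ->
  (forall t, b0 <= t < b -> g t * g1 t <= - K * g t ^ 2) ->
  - b < x -> x < b0 -> g x * f1 x - g1 x * f x <= 0 ->
  (forall t, x < t < b -> 0 < f t) -> (forall t, x < t < b -> 0 < g t) -> False.
Proof.
intros Hf Hg Hm Hq Hd Hb HK HKd Df Dg Hx Hxb HW Pf Pg.
assert (Pfg : forall t, x <= t <= b0 -> 0 <= f t * g t).
{ intros t Ht.
  assert (Hfx : 0 <= f x).
  { apply (nonneg_at_left_end f x b0); [lra | | intros; apply Pf; lra].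
    apply (solves_continuous qf b f f1); auto; lra. }
  assert (Hgx : 0 <= g x).
  { apply (nonneg_at_left_end g x b0); [lra | | intros; apply Pg; lra].
    apply (solves_continuous qg b g g1); auto; lra. }
  destruct (Req_dec t x) as [->|H1]; [nra|].
  specialize (Pf t ltac:(lra)). specialize (Pg t ltac:(lra)). nra. }
assert (W0 := wronskian_decreasing qf qg b m f f1 g g1 x b0 Hf Hg Hq Hx ltac:(lra) ltac:(lra) 0
  ltac:(lra) ltac:(lra) Pfg).
assert (Dec : forall (q h h1 : R -> R), solves q b h h1 -> (forall t, x < t < b -> 0 < h t) ->
  (forall t, b0 <= t < b -> h t * h1 t <= - K * h t ^ 2) ->
  forall u v, b0 <= u -> u <= v -> v < b -> h v <= h u).
{ intros q h h1 Hh Ph Dh u v Hu Huv Hv.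
  destruct (mean_value_le h h1 u v ltac:(lra)) as [c [Hc E]].
  - intros t Ht. apply Hh. lra.
  - specialize (Ph c ltac:(lra)). specialize (Dh c ltac:(lra)).
    assert (0 <= K * h c ^ 2) by (apply Rmult_le_pos; [exact HK | apply pow2_ge_0]).
    assert (h1 c <= 0) by nra. nra. }
set (b1 := b0 + d). set (b2 := b0 + 2 * d). set (b3 := b0 + 3 * d).
assert (F1 : 0 < f b1) by (apply Pf; unfold b1; lra).
assert (G1 : 0 < g b1) by (apply Pg; unfold b1; lra).
assert (G2 : 0 < g b2) by (apply Pg; unfold b2; lra).
set (p := f b1 * g b1). assert (Hp : 0 < p) by (unfold p; nra).
assert (W1 := wronskian_decreasing qf qg b m f f1 g g1 b0 b1 Hf Hg Hq ltac:(lra) ltac:(unfold b1; lra)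
  ltac:(unfold b1; lra) p ltac:(lra) ltac:(lra)
  ltac:(intros t Ht; apply Rmult_le_compat; [lra | lra | apply (Dec qf f f1); auto; unfold b1 in *; lra
    | apply (Dec qg g g1); auto; unfold b1 in *; lra])).
assert (W2 : forall t, b1 <= t < b -> g t * f1 t - g1 t * f t <= - (m * p * d)).
{ intros t Ht.
  assert (H := wronskian_decreasing qf qg b m f f1 g g1 b1 t Hf Hg Hq ltac:(unfold b1; lra) ltac:(lra)
    ltac:(lra) 0 ltac:(lra) ltac:(lra)).
  assert (Hpos : forall u, b1 <= u <= t -> 0 <= f u * g u).
  { intros u Hu. specialize (Pf u ltac:(unfold b1 in *; lra)). specialize (Pg u ltac:(unfold b1 in *; lra)). nra. }
  specialize (H Hpos). unfold b1 in *. nra. }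
assert (Dr : forall u v, b1 <= u -> u <= v -> v < b -> exists c, u <= c <= v /\
  f v / g v - f u / g u = (g c * f1 c - g1 c * f c) / g c ^ 2 * (v - u)).
{ intros u v Hu Huv Hv.
  destruct (mean_value_le (fun t => f t / g t) (fun t => (g t * f1 t - g1 t * f t) / g t ^ 2) u v ltac:(lra)) as [c [Hc E]].
  - intros t Ht.
    assert (Ht' : x < t < b) by (unfold b1 in *; lra).
    destruct (Hf t ltac:(lra)) as [A1 _]. destruct (Hg t ltac:(lra)) as [A2 _]. specialize (Pg t Ht').
    auto_derive; [derive_side|].
    derive_subst A1. derive_subst A2. field. lra.
  - now exists c. }
assert (Hmp : 0 < m * p * d) by (apply Rmult_lt_0_compat; [nra | exact Hd]).
assert (R12 : f b2 / g b2 <= f b1 / g b1).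
{ destruct (Dr b1 b2) as [c [Hc E]]; try (unfold b1, b2; lra).
  specialize (W2 c ltac:(unfold b1, b2 in *; lra)). specialize (Pg c ltac:(unfold b1, b2 in *; lra)).
  assert (Hi : 0 < / g c ^ 2) by (apply Rinv_0_lt_compat, pow_lt; lra).
  assert ((g c * f1 c - g1 c * f c) / g c ^ 2 <= 0) by (unfold Rdiv; nra).
  assert (0 < b2 - b1) by (unfold b1, b2; lra). nra. }
assert (R23 : f b3 / g b3 <= f b2 / g b2 - m * p * d * / g b2 ^ 2 * d).
{ destruct (Dr b2 b3) as [c [Hc E]]; try (unfold b1, b2, b3; lra).
  specialize (W2 c ltac:(unfold b1, b2, b3 in *; lra)). 
  assert (Hgc : g c <= g b2) by (apply (Dec qg g g1); auto; unfold b2, b3 in *; lra).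
  specialize (Pg c ltac:(unfold b1, b2, b3 in *; lra)).
  assert (Hi : / g b2 ^ 2 <= / g c ^ 2) by (apply Rinv_le_contravar; [apply pow_lt; lra | apply pow_incr; lra]).
  assert (Hi0 : 0 < / g b2 ^ 2) by (apply Rinv_0_lt_compat, pow_lt; lra).
  assert ((g c * f1 c - g1 c * f c) / g c ^ 2 <= - (m * p * d * / g b2 ^ 2)) by (unfold Rdiv; nra).
  replace (b3 - b2) with d in E by (unfold b3, b2; ring). nra. }
assert (R3 : 0 < f b3 / g b3).
{ apply Rdiv_lt_0_compat; [apply Pf | apply Pg]; unfold b3; lra. }
assert (Hg12 : g b2 ^ 2 * (1 + 2 * K * d) <= g b1 ^ 2).
{ destruct (mean_value_le (fun t => g t ^ 2) (fun t => 2 * (g t * g1 t)) b1 b2 ltac:(unfold b1, b2; lra)) as [c [Hc E]].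
  - intros t Ht.
    destruct (Hg t ltac:(unfold b1, b2 in *; lra)) as [A _].
    auto_derive; [eexists; eassumption|]. derive_subst A. simpl. ring.
  - 
    assert (Hgc : g b2 <= g c) by (apply (Dec qg g g1); auto; unfold b1, b2 in *; lra).
    specialize (Dg c ltac:(unfold b1, b2 in *; lra)).
    replace (b2 - b1) with d in E by (unfold b2, b1; ring).
    assert (Hsq : g b2 ^ 2 <= g c ^ 2) by (apply pow_incr; lra).
    assert (K * g b2 ^ 2 <= K * g c ^ 2) by (apply Rmult_le_compat_l; lra).
    assert (2 * (g c * g1 c) * d <= - (2 * (K * g b2 ^ 2)) * d) by (apply Rmult_le_compat_r; lra). lra. }
(* the two bounds on the ratio [f / g] give [m d^2 (g b1)^2 <= (g b2)^2] *)
assert (Hfin : m * p * d * / g b2 ^ 2 * d < f b1 / g b1) by lra.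
apply (Rmult_lt_compat_r (g b2 ^ 2 * / p)) in Hfin.
2:{ apply Rmult_lt_0_compat; [apply pow_lt; lra | now apply Rinv_0_lt_compat]. }
replace (m * p * d * / g b2 ^ 2 * d * (g b2 ^ 2 * / p)) with (m * d ^ 2) in Hfin by (field; split; lra).
replace (f b1 / g b1 * (g b2 ^ 2 * / p)) with (g b2 ^ 2 * / g b1 ^ 2) in Hfin by (unfold p; field; split; lra).
assert (Hg1p : 0 < g b1 ^ 2) by (apply pow_lt; lra). assert (Hg2p : 0 < g b2 ^ 2) by (apply pow_lt; lra).
apply (Rmult_lt_compat_r (g b1 ^ 2)) in Hfin; [|exact Hg1p].
replace (g b2 ^ 2 * / g b1 ^ 2 * g b1 ^ 2) with (g b2 ^ 2) in Hfin by (field; lra).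
assert (0 < m * d ^ 2) by (apply Rmult_lt_0_compat; [exact Hm | now apply pow_lt]).
assert (m * d ^ 2 * (g b2 ^ 2 * (1 + 2 * K * d)) <= m * d ^ 2 * g b1 ^ 2) by (apply Rmult_le_compat_l; lra).
nra.
Qed.

(** * Comparison of solutions that decay towards both ends *)

(** The condition f' / f <= -K, multiplied by f^2 so that it is unaffected by the sign of f. It
    stands in for a boundary condition at b. *)
Definition decays (b0 b K : R) (f f1 : R -> R) : Prop :=
  forall t, b0 <= t < b -> f t <> 0 /\ f t * f1 t <= - K * f t ^ 2.

(** The left end is expressed through reflection. The bound on [q] serves uniqueness for the Cauchy
    problem. *)
Definition confined (q : R -> R) (b b0 K : R) (f f1 : R -> R) : Prop :=
  solves q b f f1 /\ decays b0 b K f f1 /\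
  decays b0 b K (fun x => f (- x)) (fun x => - f1 (- x)) /\
  exists L, forall x, - b < x < b -> Rabs (q x) <= L.

Lemma confined_opp (q : R -> R) (b b0 K : R) (f f1 : R -> R) :
  confined q b b0 K f f1 -> confined q b b0 K (fun x => - f x) (fun x => - f1 x).
Proof.
intros (Hs & Hr & Hl & HL). split; [now apply solves_opp|].
split; [|split; [|exact HL]]; intros t Ht.
- destruct (Hr t Ht) as [H1 H2]. split; [lra|].
  replace (- f t * - f1 t) with (f t * f1 t) by ring.
  replace ((- f t) ^ 2) with (f t ^ 2) by ring. exact H2.
- destruct (Hl t Ht) as [H1 H2]. split; [lra|].
  replace (- f (- t) * - - f1 (- t)) with (f (- t) * - f1 (- t)) by ring.
  replace ((- f (- t)) ^ 2) with (f (- t) ^ 2) by ring. exact H2.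
Qed.

Lemma confined_reflect (q : R -> R) (b b0 K : R) (f f1 : R -> R) :
  confined q b b0 K f f1 ->
  confined (fun x => q (- x)) b b0 K (fun x => f (- x)) (fun x => - f1 (- x)).
Proof.
intros (Hs & Hr & Hl & L & HL). split; [now apply solves_reflect|].
split; [exact Hl|]. split.
- intros t Ht. rewrite Ropp_involutive. destruct (Hr t Ht) as [H1 H2]. split; [exact H1 | lra].
- exists L. intros x Hx. apply HL. lra.
Qed.

Lemma confined_pos (q : R -> R) (b b0 K : R) (f f1 : R -> R) (x y : R) :
  confined q b b0 K f f1 -> - b <= x -> x < y -> y <= b -> (forall t, x < t < y -> f t <> 0) ->
  exists g g1, confined q b b0 K g g1 /\ (forall t, x < t < y -> 0 < g t) /\
    forall t, g t = 0 <-> f t = 0.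
Proof.
intros Hf Hx Hxy Hy Hne. destruct (Rdichotomy _ _ (Hne ((x + y) / 2) ltac:(lra))) as [H|H].
- exists (fun t => - f t), (fun t => - f1 t). split; [now apply confined_opp|].
  split; [|intros t; split; lra].
  apply (constant_sign (fun t => - f t) x y ((x + y) / 2)); [lra | | | lra].
  + intros t Ht. apply (continuous_opp (V := R_NormedModule) f).
    apply (solves_continuous q b f f1); [apply Hf | lra].
  + intros t Ht. specialize (Hne t Ht). lra.
- exists f, f1. split; [exact Hf|]. split; [|tauto].
  apply (constant_sign f x y ((x + y) / 2)); [lra | | exact Hne | lra].
  intros t Ht. apply (solves_continuous q b f f1); [apply Hf | lra].
Qed.

Lemma confined_not_zero (q : R -> R) (b b0 K : R) (f f1 : R -> R) (x y : R) :
  b0 < b -> - b < b0 -> confined q b b0 K f f1 -> - b < x -> x < y -> y < b ->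
  exists c, x < c < y /\ f c <> 0.
Proof.
intros Hb Hb0 (Hs & Hr & _ & L & HL) Hx Hxy Hy. apply NNPP. intros Hn.
assert (Hz : forall t, x < t < y -> f t = 0).
{ intros t Ht. apply NNPP. intros Hne. apply Hn. now exists t. }
set (c := (x + y) / 2). assert (Hc : x < c < y) by (unfold c; lra).
assert (E1 : f1 c = 0).
{ assert (D : is_derive f c 0).
  { apply (is_derive_ext_loc (fun _ => 0)); [|apply (is_derive_const (V := R_NormedModule))].
    apply (locally_open_interval x y); [exact Hc|]. intros t Ht. now rewrite Hz. }
  destruct (Hs c ltac:(lra)) as [D1 _].
  rewrite <- (is_derive_unique _ _ _ D1). now apply is_derive_unique. }
destruct (Hr b0 ltac:(lra)) as [Hnz _]. apply Hnz.
apply (cauchy_zero q b L f f1 c); auto; lra.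
Qed.

(** The zeros x and y need not be consecutive: g is nonzero at some point between them, and the
    nearest zeros on both sides of that point are used. *)
Lemma sturm_between (qf qg : R -> R) (b b0 K m : R) (f f1 g g1 : R -> R) (x y : R) :
  b0 < b -> - b < b0 ->
  confined qf b b0 K f f1 -> confined qg b b0 K g g1 -> 0 < m ->
  (forall t, - b < t < b -> qf t + m <= qg t) ->
  - b < x -> x < y -> y < b -> g x = 0 -> g y = 0 -> exists z, x < z < y /\ f z = 0.
Proof.
intros Hb Hb0 Hf Hg Hm Hq Hx Hxy Hy Gx Gy. apply NNPP. intros Hn.
assert (Hne : forall t, x < t < y -> f t <> 0) by (intros t Ht E; apply Hn; now exists t).
destruct (confined_not_zero qg b b0 K g g1 x y Hb Hb0 Hg Hx Hxy Hy) as [c [Hc Gc]].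
destruct (last_zero g x c) as [u [Hu [Gu Nu]]]; [lra | | exact Gx | exact Gc |].
{ intros t Ht. apply (solves_continuous qg b g g1); [apply Hg | lra]. }
destruct (last_zero (fun t => g (- t)) (- y) (- c)) as [v' [Hv [Gv Nv]]]; [lra | | | |].
{ intros t Ht. apply (solves_continuous _ b _ _ (solves_reflect _ _ _ _ (proj1 Hg))). lra. }
{ now rewrite Ropp_involutive. }
{ now rewrite Ropp_involutive. }
set (v := - v').
assert (Hne' : forall t, u < t < v -> g t <> 0).
{ intros t Ht. destruct (Rle_dec t c) as [P|P]; [apply Nu; lra|].
  rewrite <- (Ropp_involutive t). apply Nv. unfold v in Ht. lra. }
destruct (confined_pos qg b b0 K g g1 u v) as (G & G1 & HG & PG & ZG); auto; try (unfold v; lra).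
destruct (confined_pos qf b b0 K f f1 u v) as (F & F1 & HF & PF & ZF); auto; try (unfold v; lra).
{ intros t Ht. apply Hne. unfold v in Ht. lra. }
apply (sturm_between_core qf qg b m F F1 G G1 u v); auto; try (unfold v; lra).
- apply HF.
- apply HG.
- now apply ZG.
- now apply ZG.
Qed.

Lemma sturm_right (qf qg : R -> R) (b b0 d K m : R) (f f1 g g1 : R -> R) (x : R) :
  0 < d -> b0 + 3 * d < b -> - b < b0 -> 0 <= K -> 1 < m * d ^ 2 * (1 + 2 * K * d) ->
  confined qf b b0 K f f1 -> confined qg b b0 K g g1 -> 0 < m ->
  (forall t, - b < t < b -> qf t + m <= qg t) ->
  - b < x < b -> g x = 0 -> exists z, x < z < b /\ f z = 0.
Proof.
intros Hd Hb Hb0 HK HKd Hf Hg Hm Hq Hx Gx. apply NNPP. intros Hn.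
assert (Hne : forall t, x < t < b -> f t <> 0) by (intros t Ht E; apply Hn; now exists t).
assert (Hxb : x < b0).
{ apply Rnot_le_lt. intros H. destruct (proj1 (proj2 Hg) x ltac:(lra)) as [H1 _]. now apply H1. }
destruct (last_zero g x b0) as [u [Hu [Gu Nu]]]; [lra | | exact Gx | |].
{ intros t Ht. apply (solves_continuous qg b g g1); [apply Hg | lra]. }
{ apply (proj1 (proj2 Hg)). lra. }
assert (Hne' : forall t, u < t < b -> g t <> 0).
{ intros t Ht. destruct (Rle_dec t b0) as [P|P]; [apply Nu; lra|]. apply (proj1 (proj2 Hg)). lra. }
destruct (confined_pos qg b b0 K g g1 u b) as (G & G1 & HG & PG & ZG); auto; try lra.
destruct (confined_pos qf b b0 K f f1 u b) as (F & F1 & HF & PF & ZF); auto; try lra.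
{ intros t Ht. apply Hne. lra. }
assert (G0 : G u = 0) by now apply ZG.
apply (sturm_end_core qf qg b b0 d K m F F1 G G1 u); auto; try lra.
- apply HF.
- apply HG.
- intros t Ht. now apply (proj1 (proj2 HF)).
- intros t Ht. now apply (proj1 (proj2 HG)).
(* At the last zero u of g the Wronskian is -G1 F, and both factors are nonnegative: this is the
   initial sign that [sturm_end_core] asks for. *)
- assert (0 <= F u).
  { apply (nonneg_at_left_end F u b); [lra | | exact PF].
    apply (solves_continuous qf b F F1); [apply HF | lra]. }
  assert (0 <= G1 u).
  { apply (derive_nonneg_at_left_end G G1 u b); [lra | | | exact G0 | exact PG].
    - intros t Ht. apply (proj1 HG). lra.
    - apply (solves_continuous' qg b G G1); [apply HG | lra]. }
  rewrite G0. nra.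
Qed.

Lemma sturm_left (qf qg : R -> R) (b b0 d K m : R) (f f1 g g1 : R -> R) (x : R) :
  0 < d -> b0 + 3 * d < b -> - b < b0 -> 0 <= K -> 1 < m * d ^ 2 * (1 + 2 * K * d) ->
  confined qf b b0 K f f1 -> confined qg b b0 K g g1 -> 0 < m ->
  (forall t, - b < t < b -> qf t + m <= qg t) ->
  - b < x < b -> g x = 0 -> exists z, - b < z < x /\ f z = 0.
Proof.
intros Hd Hb Hb0 HK HKd Hf Hg Hm Hq Hx Gx.
destruct (sturm_right (fun t => qf (- t)) (fun t => qg (- t)) b b0 d K m
  (fun t => f (- t)) (fun t => - f1 (- t)) (fun t => g (- t)) (fun t => - g1 (- t)) (- x)) as [z [Hz Ez]]; auto.
- now apply confined_reflect.
- now apply confined_reflect.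
- intros t Ht. apply Hq. lra.
- lra.
- now rewrite Ropp_involutive.
- exists (- z). split; [lra | exact Ez].
Qed.

(** If f had no zero, neither would g. Reflection changes the sign of the Wronskian at 0, so
    [sturm_end_core] applies on one of the two halves. *)
Lemma sturm_whole (qf qg : R -> R) (b b0 d K m : R) (f f1 g g1 : R -> R) :
  0 < d -> b0 + 3 * d < b -> 0 < b0 -> 0 <= K -> 1 < m * d ^ 2 * (1 + 2 * K * d) ->
  confined qf b b0 K f f1 -> confined qg b b0 K g g1 -> 0 < m ->
  (forall t, - b < t < b -> qf t + m <= qg t) ->
  exists z, - b < z < b /\ f z = 0.
Proof.
intros Hd Hb Hb0 HK HKd Hf Hg Hm Hq. apply NNPP. intros Hn.
assert (Hne : forall t, - b < t < b -> f t <> 0) by (intros t Ht E; apply Hn; now exists t).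
assert (Hne' : forall t, - b < t < b -> g t <> 0).
{ intros t Ht E. destruct (sturm_right qf qg b b0 d K m f f1 g g1 t) as [z [Hz Ez]]; auto; [lra|].
  apply (Hne z); [lra | exact Ez]. }
destruct (confined_pos qg b b0 K g g1 (- b) b) as (G & G1 & HG & PG & ZG); auto; try lra.
destruct (confined_pos qf b b0 K f f1 (- b) b) as (F & F1 & HF & PF & ZF); auto; try lra.
destruct (Rle_dec (G 0 * F1 0 - G1 0 * F 0) 0) as [H|H].
- apply (sturm_end_core qf qg b b0 d K m F F1 G G1 0); auto; try lra.
  + apply HF.
  + apply HG.
  + intros t Ht. now apply (proj1 (proj2 HF)).
  + intros t Ht. now apply (proj1 (proj2 HG)).
  + intros t Ht. apply PF. lra.
  + intros t Ht. apply PG. lra.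
- assert (HF' := confined_reflect _ _ _ _ _ _ HF). assert (HG' := confined_reflect _ _ _ _ _ _ HG).
  apply (sturm_end_core (fun t => qf (- t)) (fun t => qg (- t)) b b0 d K m
    (fun t => F (- t)) (fun t => - F1 (- t)) (fun t => G (- t)) (fun t => - G1 (- t)) 0); auto; try lra.
  + apply HF'.
  + apply HG'.
  + intros t Ht. apply Hq. lra.
  + intros t Ht. now apply (proj1 (proj2 HF')).
  + intros t Ht. now apply (proj1 (proj2 HG')).
  + rewrite Ropp_0. lra.
  + intros t Ht. apply PF. lra.
  + intros t Ht. apply PG. lra.
Qed.

(** * Counting zeros *)

(** At least n zeros in (x, b), listed in increasing order. Counting in this way presupposes neither
    finiteness nor simplicity of the zeros. *)
Fixpoint zero_chain (f : R -> R) (b : R) (n : nat) (x : R) : Prop :=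
  match n with
  | O => True
  | S n => exists y, x < y < b /\ f y = 0 /\ zero_chain f b n y
  end.

Lemma zero_chain_weaken (f : R -> R) (b : R) (n : nat) (x y : R) :
  x <= y -> zero_chain f b n y -> zero_chain f b n x.
Proof.
intros Hxy. destruct n as [|n]; simpl; [auto|]. intros (z & Hz & Ez & H). exists z.
split; [lra | auto].
Qed.

(** There is a zero of f before the first listed zero of g, one in each gap and one after the last.
    For n = 0 the zero is that of [sturm_whole]. *)
Lemma sturm_interlacing (qf qg : R -> R) (b b0 d K m : R) (f f1 g g1 : R -> R) (n : nat) :
  0 < d -> b0 + 3 * d < b -> 0 < b0 -> 0 <= K -> 1 < m * d ^ 2 * (1 + 2 * K * d) ->
  confined qf b b0 K f f1 -> confined qg b b0 K g g1 -> 0 < m ->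
  (forall t, - b < t < b -> qf t + m <= qg t) ->
  zero_chain g b n (- b) -> zero_chain f b (S n) (- b).
Proof.
intros Hd Hb Hb0 HK HKd Hf Hg Hm Hq.
assert (Hstep : forall n x, - b < x < b -> g x = 0 -> zero_chain g b n x -> zero_chain f b (S n) x).
{ clear n. intros n. induction n as [|n IH]; intros x Hx Gx Hc.
  - destruct (sturm_right qf qg b b0 d K m f f1 g g1 x) as [z [Hz Ez]]; auto; [lra|].
    exists z. simpl. auto.
  - destruct Hc as (y & Hy & Gy & Hc).
    destruct (sturm_between qf qg b b0 K m f f1 g g1 x y) as [z [Hz Ez]]; auto; try lra.
    exists z. split; [lra|]. split; [exact Ez|].
    apply (zero_chain_weaken f b (S n) z y); [lra|]. apply IH; auto. lra. }
destruct n as [|n]; intros Hc.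
- destruct (sturm_whole qf qg b b0 d K m f f1 g g1) as [z [Hz Ez]]; auto.
  exists z. simpl. auto.
- destruct Hc as (y & Hy & Gy & Hc).
  destruct (sturm_left qf qg b b0 d K m f f1 g g1 y) as [z [Hz Ez]]; auto; [lra|].
  exists z. split; [lra|]. split; [exact Ez|].
  apply (zero_chain_weaken f b (S n) z y); [lra|]. apply Hstep; auto.
Qed.

(** * Hermite functions *)

(* The function p = f (f' + k f) is nondecreasing. If p were positive
   somewhere, boundedness of f would force p to grow linearly, and then f^2
   as well. *)
Lemma bounded_solution_decays (q f f1 : R -> R) (beta k B : R) :
  0 < k ->
  (forall t, beta <= t -> is_derive f t (f1 t) /\ is_derive f1 t (q t * f t) /\
     k ^ 2 <= q t /\ Rabs (f t) <= B) ->
  (forall t0, beta <= t0 -> exists t, t0 <= t /\ f t <> 0) ->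
  forall t, beta <= t -> f t <> 0 /\ f t * f1 t <= - k * f t ^ 2.
Proof.
intros Hk Hf Hnz.
set (p := fun t => f t * (f1 t + k * f t)).
assert (HB : forall t, beta <= t -> f t ^ 2 <= B ^ 2).
{ intros t Ht. rewrite <- (pow2_abs (f t)). apply pow_incr. split; [apply Rabs_pos | now apply Hf]. }
assert (Dp : forall t, beta <= t -> is_derive p t ((f1 t + k * f t) ^ 2 + (q t - k ^ 2) * f t ^ 2)).
{ intros t Ht. destruct (Hf t Ht) as (D1 & D2 & _). unfold p.
  auto_derive; [derive_side|].
  derive_subst D1. derive_subst D2. ring. }
assert (D2 : forall t, beta <= t -> is_derive (fun t => f t ^ 2) t (2 * (p t - k * f t ^ 2))).
{ intros t Ht. destruct (Hf t Ht) as (D1 & _). unfold p.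
  auto_derive; [eexists; eassumption|]. derive_subst D1. simpl. ring. }
assert (Mp : forall s t, beta <= s -> s <= t -> p s <= p t).
{ intros s t Hs Hst.
  destruct (mean_value_le p (fun t => (f1 t + k * f t) ^ 2 + (q t - k ^ 2) * f t ^ 2) s t ltac:(lra)) as [c [Hc E]].
  - intros u Hu. apply Dp. lra.
  - destruct (Hf c ltac:(lra)) as (_ & _ & Hq & _).
    pose proof (pow2_ge_0 (f1 c + k * f c)). pose proof (pow2_ge_0 (f c)).
    assert (0 <= (q c - k ^ 2) * f c ^ 2) by (apply Rmult_le_pos; lra).
    assert (0 <= ((f1 c + k * f c) ^ 2 + (q c - k ^ 2) * f c ^ 2) * (t - s)) by (apply Rmult_le_pos; lra).
    lra. }
assert (Np : forall t, beta <= t -> p t <= 0).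
{ intros t0 Ht0. apply Rnot_lt_le. intros Hp0. set (p0 := p t0) in *.
  assert (HBp : 0 < B ^ 2).
  { specialize (HB t0 Ht0). destruct (Req_dec (f t0) 0) as [E|E].
    - exfalso. unfold p0, p in Hp0. rewrite E, Rmult_0_l in Hp0. lra.
    - pose proof (Rlt_0_sqr _ E). unfold Rsqr in *. nra. }
  set (r := p0 ^ 2 / B ^ 2). assert (Hr : 0 < r) by (apply Rdiv_lt_0_compat; [now apply pow_lt | exact HBp]).
  assert (Lp : forall t, t0 <= t -> p0 + r * (t - t0) <= p t).
  { intros t Ht.
    destruct (mean_value_le p (fun t => (f1 t + k * f t) ^ 2 + (q t - k ^ 2) * f t ^ 2) t0 t ltac:(lra)) as [c [Hc E]].
    - intros u Hu. apply Dp. lra.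
    - destruct (Hf c ltac:(lra)) as (_ & _ & Hq & _).
      assert (Hpc : p0 <= p c) by (apply Mp; lra). specialize (HB c ltac:(lra)).
      set (g := f1 c + k * f c) in *.
      assert (Hg : r <= g ^ 2).
      { unfold r. apply Rmult_le_reg_r with (B ^ 2); [exact HBp|].
        replace (p0 ^ 2 / B ^ 2 * B ^ 2) with (p0 ^ 2)
          by (unfold Rdiv; rewrite Rmult_assoc, Rinv_l by lra; ring).
        apply Rle_trans with ((p c) ^ 2); [apply pow_incr; lra|].
        replace (p c ^ 2) with (g ^ 2 * f c ^ 2) by (unfold p, g; ring).
        apply Rmult_le_compat_l; [apply pow2_ge_0 | exact HB]. }
      pose proof (pow2_ge_0 (f c)).
      assert (0 <= (q c - k ^ 2) * f c ^ 2) by (apply Rmult_le_pos; lra).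
      assert (r * (t - t0) <= (g ^ 2 + (q c - k ^ 2) * f c ^ 2) * (t - t0)) by (apply Rmult_le_compat_r; lra).
      unfold p0. lra. }
  set (t1 := t0 + (k * B ^ 2 + 1) / r).
  assert (HkB : 0 < k * B ^ 2) by (now apply Rmult_lt_0_compat).
  assert (Ht1 : t0 < t1) by (unfold t1; assert (0 < (k * B ^ 2 + 1) / r) by (apply Rdiv_lt_0_compat; lra); lra).
  assert (Hp1 : k * B ^ 2 + 1 <= p t1).
  { specialize (Lp t1 ltac:(lra)). unfold t1 in Lp at 1.
    replace (r * (t0 + (k * B ^ 2 + 1) / r - t0)) with (k * B ^ 2 + 1) in Lp by (field; lra). lra. }
  set (t2 := t1 + B ^ 2).
  destruct (mean_value_le (fun t => f t ^ 2) (fun t => 2 * (p t - k * f t ^ 2)) t1 t2 ltac:(unfold t2; lra)) as [c [Hc E]].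
  { intros u Hu. apply D2. lra. }
  
  assert (Hpc : p t1 <= p c) by (apply Mp; lra).
  assert (HBc := HB c ltac:(lra)). assert (HB2 := HB t2 ltac:(unfold t2; lra)).
  pose proof (pow2_ge_0 (f t1)).
  assert (k * f c ^ 2 <= k * B ^ 2) by (apply Rmult_le_compat_l; lra).
  replace (t2 - t1) with (B ^ 2) in E by (unfold t2; ring).
  assert (2 * B ^ 2 <= 2 * (p c - k * f c ^ 2) * B ^ 2) by (apply Rmult_le_compat_r; lra). lra. }
intros t Ht. split.
- intros E. destruct (Hnz t Ht) as [u [Hu Hfu]].
  destruct (mean_value_le (fun t => f t ^ 2) (fun t => 2 * (p t - k * f t ^ 2)) t u ltac:(lra)) as [c [Hc E']].
  { intros v Hv. apply D2. lra. }
  rewrite E in E'.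
  specialize (Np c ltac:(lra)). pose proof (pow2_ge_0 (f c)).
  assert (0 <= k * f c ^ 2) by (apply Rmult_le_pos; lra).
  pose proof (Rlt_0_sqr _ Hfu). unfold Rsqr in *. nra.
- specialize (Np t Ht). unfold p in Np. lra.
Qed.

(** The product f f' is nondecreasing. Once positive it makes f^2 grow at least linearly; if it is
    never positive, f^2 is nonincreasing. *)
Lemma unbounded_or_bounded (q f f1 : R -> R) (beta : R) :
  (forall t, beta <= t -> is_derive f t (f1 t) /\ is_derive f1 t (q t * f t) /\ 0 <= q t) ->
  (exists T, forall t, T <= t -> 1 <= Rabs (f t)) \/ forall t, beta <= t -> Rabs (f t) <= Rabs (f beta).
Proof.
intros Hf. destruct (classic (exists t0, beta <= t0 /\ 0 < f t0 * f1 t0)) as [[t0 [Ht0 Hp]]|Hn].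
- left. set (p0 := f t0 * f1 t0) in *. exists (t0 + / p0). intros t Ht.
  assert (Hi := Rinv_0_lt_compat _ Hp).
  assert (Dp : forall t, beta <= t -> is_derive (fun t => f t * f1 t) t (f1 t ^ 2 + q t * f t ^ 2)).
  { intros u Hu. destruct (Hf u Hu) as (D1 & D2 & _).
    auto_derive; [derive_side|].
    derive_subst D1. derive_subst D2. ring. }
  destruct (mean_value_le (fun t => f t ^ 2) (fun t => 2 * (f t * f1 t)) t0 t ltac:(lra)) as [c [Hc E]].
  { intros u Hu. destruct (Hf u ltac:(lra)) as (D1 & _).
    auto_derive; [eexists; eassumption|]. derive_subst D1. simpl. ring. }
  
  destruct (mean_value_le (fun t => f t * f1 t) (fun t => f1 t ^ 2 + q t * f t ^ 2) t0 c ltac:(lra)) as [c' [Hc' E']].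
  { intros u Hu. apply Dp. lra. }
  destruct (Hf c' ltac:(lra)) as (_ & _ & Hq).
  assert (Hpc : p0 <= f c * f1 c).
  { pose proof (pow2_ge_0 (f1 c')). pose proof (pow2_ge_0 (f c')).
    assert (0 <= q c' * f c' ^ 2) by (apply Rmult_le_pos; lra).
    assert (0 <= (f1 c' ^ 2 + q c' * f c' ^ 2) * (c - t0)) by (apply Rmult_le_pos; lra).
    unfold p0. lra. }
  assert (H1 : 1 <= f t ^ 2).
  { assert (Hg : 1 <= p0 * (t - t0)).
    { replace 1 with (p0 * / p0) by (field; lra). apply Rmult_le_compat_l; lra. }
    assert (p0 * (t - t0) <= f c * f1 c * (t - t0)) by (apply Rmult_le_compat_r; lra).
    pose proof (pow2_ge_0 (f t0)). lra. }
  rewrite <- (pow2_abs (f t)) in H1. apply Rsqr_incr_0_var; [|apply Rabs_pos]. unfold Rsqr. lra.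
- right. intros t Ht.
  destruct (mean_value_le (fun t => f t ^ 2) (fun t => 2 * (f t * f1 t)) beta t ltac:(lra)) as [c [Hc E]].
  { intros u Hu. destruct (Hf u ltac:(lra)) as (D1 & _).
    auto_derive; [eexists; eassumption|]. derive_subst D1. simpl. ring. }
  
  assert (Hc0 : f c * f1 c <= 0).
  { apply Rnot_lt_le. intros H. apply Hn. exists c. split; [lra | exact H]. }
  apply Rsqr_incr_0_var; [|apply Rabs_pos]. rewrite <- !Rsqr_abs. unfold Rsqr. nra.
Qed.

(** * Hermite polynomials and Hermite functions *)

(** The physicists' polynomials, for which H_n' = 2 n H_(n-1). Occurrences of [pred n] at n = 0 are
    harmless, being multiplied by [INR 0]. *)
Fixpoint hermite (n : nat) (t : R) : R :=
  match n with
  | O => 1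
  | S p => match p with
           | O => 2 * t
           | S k => 2 * t * hermite p t - 2 * INR p * hermite k t
           end
  end.

Lemma hermite_SS (n : nat) (t : R) :
  hermite (S (S n)) t = 2 * t * hermite (S n) t - 2 * INR (S n) * hermite n t.
Proof. reflexivity. Qed.

Lemma hermite_S (n : nat) (t : R) :
  hermite (S n) t = 2 * t * hermite n t - 2 * INR n * hermite (pred n) t.
Proof.
destruct n as [|n]; [simpl; ring | apply hermite_SS].
Qed.

Lemma is_derive_hermite (n : nat) (t : R) :
  is_derive (hermite n) t (2 * INR n * hermite (pred n) t).
Proof.
enough (H : is_derive (hermite n) t (2 * INR n * hermite (pred n) t) /\
  is_derive (hermite (S n)) t (2 * INR (S n) * hermite n t)) by apply H.
induction n as [|n [IH1 IH2]].
- split.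
  + simpl. replace (2 * 0 * 1) with 0 by ring. apply (is_derive_const (V := R_NormedModule)).
  + apply (is_derive_ext (fun t => 2 * t)); [reflexivity|]. simpl. auto_derive; [exact I | ring].
- split; [exact IH2|].
  apply (is_derive_ext (fun t => 2 * t * hermite (S n) t - 2 * INR (S n) * hermite n t)); [reflexivity|].
  assert (E : hermite (S n) t = 2 * t * hermite n t - 2 * INR n * hermite (pred n) t) by apply hermite_S.
  assert (HN := S_INR n). rewrite (S_INR (S n)). simpl pred.
  revert IH1 IH2 E HN. generalize (hermite (pred n) t). generalize (INR (S n)) (hermite (S n)) (hermite n).
  intros N u v r IH1 IH2 E HN.
  auto_derive; [derive_side|].
  derive_subst IH1. derive_subst IH2. rewrite E, HN. ring.
Qed.

(** A crude exponential bound, immediate from the recurrence and |t| <= exp(|t|), is enough because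
    exp(-t^2 / 2) beats it. *)
Lemma hermite_growth (n : nat) :
  exists C, 0 <= C /\ forall t, Rabs (hermite n t) <= C * exp (INR n * Rabs t).
Proof.
assert (Habs : forall t, Rabs t <= exp (Rabs t)).
{ intros t. pose proof (Rabs_pos t). destruct (Req_dec (Rabs t) 0) as [E|E].
  - rewrite E, exp_0. lra.
  - pose proof (exp_ineq1 (Rabs t) E). lra. }
enough (H : (exists C, 0 <= C /\ forall t, Rabs (hermite n t) <= C * exp (INR n * Rabs t)) /\
  (exists C, 0 <= C /\ forall t, Rabs (hermite (S n) t) <= C * exp (INR (S n) * Rabs t))) by apply H.
induction n as [|n [[C0 [P0 H0]] [C1 [P1 H1]]]].
- split.
  + exists 1. split; [lra|]. intros t. simpl. rewrite Rabs_R1, Rmult_0_l, exp_0. lra.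
  + exists 2. split; [lra|]. intros t. simpl. rewrite Rabs_mult, (Rabs_pos_eq 2), Rmult_1_l by lra.
    specialize (Habs t). lra.
- split; [now exists C1|].
  exists (2 * C1 + 2 * INR (S n) * C0).
  assert (HN : 0 <= INR (S n)) by apply pos_INR.
  assert (HNC : 0 <= INR (S n) * C0) by now apply Rmult_le_pos.
  split; [lra|]. intros t. rewrite hermite_SS.
  specialize (H0 t). specialize (H1 t). specialize (Habs t). pose proof (Rabs_pos t) as Ha.
  set (e := exp (Rabs t)) in *. set (e0 := exp (INR n * Rabs t)) in *.
  assert (E1 : exp (INR (S n) * Rabs t) = e0 * e).
  { unfold e, e0. rewrite <- exp_plus, S_INR. f_equal. ring. }
  assert (E2 : exp (INR (S (S n)) * Rabs t) = e0 * e * e).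
  { unfold e, e0. rewrite <- !exp_plus, !S_INR. f_equal. ring. }
  rewrite E1 in H1. rewrite E2.
  assert (Pe : 1 <= e).
  { unfold e. rewrite <- exp_0. destruct Ha as [Ha|Ha]; [apply Rlt_le, exp_increasing, Ha | rewrite <- Ha; lra]. }
  assert (Pe0 : 0 < e0) by apply exp_pos.
  eapply Rle_trans; [apply Rabs_triang|]. rewrite Rabs_Ropp, !Rabs_mult.
  rewrite (Rabs_pos_eq 2), (Rabs_pos_eq (INR (S n))) by lra.
  rewrite Rmult_plus_distr_r. apply Rplus_le_compat.
  + apply Rle_trans with (2 * e * (C1 * (e0 * e))); [|apply Req_le; ring].
    apply Rmult_le_compat; [lra | apply Rabs_pos | lra | exact H1].
  + apply Rle_trans with (2 * INR (S n) * (C0 * e0)); [apply Rmult_le_compat_l; lra|].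
    assert (H : 0 <= 2 * INR (S n) * C0 * e0) by (apply Rmult_le_pos; lra).
    assert (1 <= e * e) by nra. nra.
Qed.

Definition hermite_fun (n : nat) (t : R) : R := hermite n t * exp (- (t ^ 2 / 2)).

Definition hermite_fun' (n : nat) (t : R) : R :=
  (2 * INR n * hermite (pred n) t - t * hermite n t) * exp (- (t ^ 2 / 2)).

Lemma is_derive_hermite_fun (n : nat) (t : R) :
  is_derive (hermite_fun n) t (hermite_fun' n t) /\
  is_derive (hermite_fun' n) t ((t ^ 2 - (2 * INR n + 1)) * hermite_fun n t).
Proof.
unfold hermite_fun, hermite_fun'.
assert (H0 := is_derive_hermite n t). assert (H1 := is_derive_hermite (pred n) t).
split.
- revert H0. generalize (hermite (pred n) t) (hermite n). intros r u H0.
  auto_derive; [derive_side|].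
  derive_subst H0. replace (t * (t * 1) * / 2) with (t ^ 2 / 2) by (simpl; field). simpl. field.
- assert (E : INR n * hermite n t = INR n * (2 * t * hermite (pred n) t - 2 * INR (pred n) * hermite (pred (pred n)) t)).
  { destruct n as [|n]; [simpl; ring|]. f_equal. apply hermite_S. }
  revert H0 H1 E. generalize (hermite (pred (pred n)) t) (hermite (pred n)) (hermite n).
  intros r v u H0 H1 E.
  auto_derive; [derive_side|].
  derive_subst H0. derive_subst H1. replace (t * (t * 1) * / 2) with (t ^ 2 / 2) by (simpl; field).
  set (e := exp (- (t ^ 2 / 2))).
  replace ((t ^ 2 - (2 * INR n + 1)) * (u t * e)) with ((t ^ 2 * u t - u t - 2 * (INR n * u t)) * e) by ring.
  rewrite E. simpl. field.
Qed.

Lemma hermite_fun_bounded (n : nat) : exists B, forall t, Rabs (hermite_fun n t) <= B.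
Proof.
destruct (hermite_growth n) as [C [HC H]]. exists (C * exp (INR n ^ 2 / 2)). intros t.
unfold hermite_fun. rewrite Rabs_mult, (Rabs_pos_eq (exp _)) by (apply Rlt_le, exp_pos).
apply Rle_trans with (C * exp (INR n * Rabs t) * exp (- (t ^ 2 / 2))).
- apply Rmult_le_compat_r; [apply Rlt_le, exp_pos | apply H].
- rewrite Rmult_assoc, <- exp_plus. apply Rmult_le_compat_l; [exact HC|].
  assert (Hle : INR n * Rabs t + - (t ^ 2 / 2) <= INR n ^ 2 / 2).
  { rewrite <- (pow2_abs t). pose proof (pow2_ge_0 (INR n - Rabs t)). lra. }
  destruct Hle as [Hlt|Heq]; [apply Rlt_le, exp_increasing, Hlt | rewrite Heq; lra].
Qed.

(** Rolle: y and the k zeros after it enclose k zeros of the derivative, a nonzero multiple of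
    H_n. *)
Lemma zero_chain_hermite_rolle (n k : nat) (B y : R) :
  hermite (S n) y = 0 -> zero_chain (hermite (S n)) B k y -> zero_chain (hermite n) B k y.
Proof.
revert y. induction k as [|k IH]; intros y Hy Hc; [exact I|].
destruct Hc as (y2 & Hy2 & E2 & Hc).
destruct (MVT_cor2 (hermite (S n)) (fun t => 2 * INR (S n) * hermite n t) y y2) as [z [Ez Hz]]; [lra | |].
{ intros c _. apply is_derive_Reals. apply (is_derive_hermite (S n)). }
assert (HN : 0 < INR (S n)) by (apply lt_0_INR; lia).
exists z. split; [lra|]. split.
- rewrite Hy, E2 in Ez. apply Rmult_eq_reg_l with (2 * INR (S n) * (y2 - y)); [lra|].
  apply Rgt_not_eq. apply Rmult_lt_0_compat; lra.
- apply (zero_chain_weaken _ _ _ _ y2); [lra | now apply IH].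
Qed.

(** Repeated use of Rolle descends to H_0 = 1, which has no zero. This is the upper count that the
    comparison will contradict. *)
Lemma hermite_zeros (n : nat) (B x : R) : ~ zero_chain (hermite n) B (S n) x.
Proof.
revert x. induction n as [|n IH]; intros x (y & Hy & Ey & Hc).
- simpl in Ey. lra.
- apply (IH y). now apply zero_chain_hermite_rolle.
Qed.

Lemma hermite_nonzero (n : nat) (t : R) : exists u, t <= u /\ hermite n u <> 0.
Proof.
apply NNPP. intros Hn.
assert (Hz : forall u, t <= u -> hermite n u = 0).
{ intros u Hu. apply NNPP. intros H. apply Hn. now exists u. }
apply (hermite_zeros n (t + 1) t).
enough (H : forall k x, t <= x < t + 1 -> zero_chain (hermite n) (t + 1) k x) by (apply H; lra).
intros k. induction k as [|k IH]; intros x Hx; [exact I|].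
exists ((x + (t + 1)) / 2). split; [lra|]. split; [apply Hz; lra | apply IH; lra].
Qed.

Lemma hermite_opp (n : nat) (t : R) : hermite n (- t) = (- 1) ^ n * hermite n t.
Proof.
enough (H : hermite n (- t) = (- 1) ^ n * hermite n t /\
  hermite (S n) (- t) = (- 1) ^ S n * hermite (S n) t) by apply H.
induction n as [|n [IH1 IH2]].
- simpl. split; ring.
- split; [exact IH2|]. rewrite !hermite_SS, IH1, IH2. simpl pow. ring.
Qed.

(** For |t| >= beta the Weber potential t^2 - (2 n + 1) is at least k^2, so the bounded solution
    decays at rate k. The left side is the same by reflection, parity giving nonzero values
    arbitrarily far out. *)
Lemma hermite_fun_decays (n : nat) (k beta t : R) :
  0 < k -> 0 <= beta -> k ^ 2 + (2 * INR n + 1) <= beta ^ 2 ->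
  (beta <= t -> hermite_fun n t <> 0 /\
    hermite_fun n t * hermite_fun' n t <= - k * hermite_fun n t ^ 2) /\
  (t <= - beta -> hermite_fun n t <> 0 /\
    k * hermite_fun n t ^ 2 <= hermite_fun n t * hermite_fun' n t).
Proof.
intros Hk Hb Hkb. destruct (hermite_fun_bounded n) as [B HB].
assert (Hnz : forall t0, exists t, t0 <= t /\ hermite_fun n t <> 0).
{ intros t0. destruct (hermite_nonzero n t0) as [u [Hu Hn]]. exists u. split; [exact Hu|].
  unfold hermite_fun. apply Rmult_integral_contrapositive. split; [exact Hn|].
  apply Rgt_not_eq, exp_pos. }
assert (Hr : forall t, beta <= t -> hermite_fun n t <> 0 /\
    hermite_fun n t * hermite_fun' n t <= - k * hermite_fun n t ^ 2).
{ apply (bounded_solution_decays (fun t => t ^ 2 - (2 * INR n + 1)) _ _ beta k B Hk); [|auto].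
  intros u Hu. destruct (is_derive_hermite_fun n u) as [D1 D2].
  split; [exact D1|]. split; [exact D2|]. split; [|apply HB].
  assert (beta ^ 2 <= u ^ 2) by (apply pow_incr; lra). lra. }
assert (Hl : forall t, beta <= t -> hermite_fun n (- t) <> 0 /\
    hermite_fun n (- t) * (- hermite_fun' n (- t)) <= - k * hermite_fun n (- t) ^ 2).
{ apply (bounded_solution_decays (fun t => t ^ 2 - (2 * INR n + 1)) (fun t => hermite_fun n (- t))
    (fun t => - hermite_fun' n (- t)) beta k B Hk).
  - intros u Hu. destruct (is_derive_hermite_fun n (- u)) as [D1 D2].
    split; [|split; [|split; [|apply HB]]].
    + revert D1. generalize (hermite_fun n) (hermite_fun' n). intros f f1 D1.
      auto_derive; [eexists; eassumption|]. derive_subst D1. ring.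
    + revert D2. generalize (hermite_fun n) (hermite_fun' n). intros f f1 D2.
      auto_derive; [eexists; eassumption|]. derive_subst D2. ring.
    + assert (beta ^ 2 <= u ^ 2) by (apply pow_incr; lra). lra.
  - intros t0 _. destruct (Hnz t0) as [u [Hu Hn]]. exists u. split; [exact Hu|].
    unfold hermite_fun in *. rewrite hermite_opp.
    apply Rmult_integral_contrapositive. split; [|apply Rgt_not_eq, exp_pos].
    apply Rmult_integral_contrapositive. split; [apply pow_nonzero; lra|].
    intros E. apply Hn. rewrite E. ring. }
split; intros Ht; [now apply Hr|].
destruct (Hl (- t) ltac:(lra)) as [H1 H2]. rewrite Ropp_involutive in H1, H2.
split; [exact H1 | lra].
Qed.

(** * Quantization *)

Definition model_fun (a z : R -> R) (c : R) (n : nat) (s : R) : R :=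
  a s * hermite_fun n (c * z s).

Definition model_fun' (a a1 z : R -> R) (c : R) (n : nat) (s : R) : R :=
  a1 s * hermite_fun n (c * z s) + c * hermite_fun' n (c * z s) / a s.

(** The potential obtained from the Weber equation by the Liouville transformation with z' = a^(-2):
    the factor a^(-4) is z'^2, and a''/a is the Schwarzian term. *)
Definition model_pot (a a2 z : R -> R) (c : R) (n : nat) (s : R) : R :=
  a2 s / a s + c ^ 2 * ((c * z s) ^ 2 - (2 * INR n + 1)) / a s ^ 4.

(** The choice z' = a^(-2) is what cancels the terms in the first derivative of the Hermite
    function. *)
Lemma model_fun_solves (b c : R) (a a1 a2 z : R -> R) (n : nat) :
  (forall s, - b < s < b -> is_derive z s (/ (a s) ^ 2) /\ is_derive a s (a1 s) /\
     is_derive a1 s (a2 s) /\ 0 < a s) ->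
  solves (model_pot a a2 z c n) b (model_fun a z c n) (model_fun' a a1 z c n).
Proof.
intros H s Hs. destruct (H s Hs) as (Dz & Da & Da1 & Pa).
destruct (is_derive_hermite_fun n (c * z s)) as [D1 D2].
unfold model_fun, model_fun', model_pot.
revert D1 D2. generalize (hermite_fun n) (hermite_fun' n). intros f f1 D1 D2.
set (g := fun s => f (c * z s)). set (g1 := fun s => f1 (c * z s)).
assert (C1 : is_derive g s (c * / a s ^ 2 * f1 (c * z s))).
{ apply (is_derive_comp f (fun s => c * z s)); [exact D1|].
  auto_derive; [eexists; eassumption|]. derive_subst Dz. ring. }
assert (C2 : is_derive g1 s
  (c * / a s ^ 2 * (((c * z s) ^ 2 - (2 * INR n + 1)) * f (c * z s)))).
{ apply (is_derive_comp f1 (fun s => c * z s)); [exact D2|].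
  auto_derive; [eexists; eassumption|]. derive_subst Dz. ring. }
change (f (c * z s)) with (g s) in *. change (f1 (c * z s)) with (g1 s) in *.
split.
- apply (is_derive_ext (fun s => a s * g s)); [reflexivity|]. clearbody g g1.
  auto_derive; [derive_side|].
  derive_subst Da. derive_subst C1. field. lra.
- apply (is_derive_ext (fun s => a1 s * g s + c * g1 s / a s)); [reflexivity|]. clearbody g g1.
  auto_derive; [derive_side|].
  derive_subst Da. derive_subst Da1. derive_subst C1. derive_subst C2. field. lra.
Qed.

Lemma strictly_increasing_of_derive (b : R) (z z1 : R -> R) :
  (forall s, - b < s < b -> is_derive z s (z1 s) /\ 0 < z1 s) ->
  forall x y, - b < x -> x < y -> y < b -> z x < z y.
Proof.
intros H x y Hx Hxy Hy. destruct (mean_value_le z z1 x y ltac:(lra)) as [t [Ht E]].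
- intros t Ht. apply H. lra.
- destruct (H t ltac:(lra)) as [_ Hp]. nra.
Qed.

(** As a is positive and z increasing, the zeros go over in order to zeros of H_n. *)
Lemma model_fun_zeros (b c B : R) (a z : R -> R) (n : nat) :
  0 < c -> (forall s, - b < s < b -> 0 < a s) ->
  (forall x y, - b < x -> x < y -> y < b -> z x < z y) ->
  (forall s, - b < s < b -> z s < B) ->
  0 < b -> ~ zero_chain (model_fun a z c n) b (S n) (- b).
Proof.
intros Hc Ha Hz HB Hb (y & Hy & Ey & Hch).
assert (Hroot : forall s, - b < s < b -> model_fun a z c n s = 0 -> hermite n (c * z s) = 0).
{ intros s Hs E. unfold model_fun, hermite_fun in E. specialize (Ha s Hs).
  pose proof (exp_pos (- ((c * z s) ^ 2 / 2))).
  apply Rmult_integral in E. destruct E as [E|E]; [lra|].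
  apply Rmult_integral in E. destruct E as [E|E]; [exact E | lra]. }
assert (Hmap : forall k x, - b < x < b -> zero_chain (model_fun a z c n) b k x ->
  zero_chain (hermite n) (c * B) k (c * z x)).
{ intros k. induction k as [|k IH]; intros x Hx Hk; [exact I|].
  destruct Hk as (u & Hu & Eu & Hk). exists (c * z u). split; [|split].
  - specialize (Hz x u ltac:(lra) ltac:(lra) ltac:(lra)). specialize (HB u ltac:(lra)).
    split; apply Rmult_lt_compat_l; lra.
  - apply Hroot; [lra | exact Eu].
  - apply IH; [lra | exact Hk]. }
apply (hermite_zeros n (c * B) (c * z y - 1)).
exists (c * z y). split; [|split].
- specialize (HB y Hy). split; [lra | apply Rmult_lt_compat_l; lra].
- now apply Hroot.
- apply Hmap; [exact Hy | exact Hch].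
Qed.

(** For |s| >= b/2 one has |z| >= b/4, since z stays within |s|/25 of s. There the Hermite function
    decays at rate k = c b / 6 because 1/36 + 1/32 <= 1/16. The logarithmic derivative of the model
    function is then at most (M^2 - c k) / a^2 on the right, and symmetrically on the left. Now c k
    = kap^2 b / (6 eps) is at least b / (6 M^2 eps): one half of this absorbs M^2 and the other
    gives the rate kap1 / eps, whence the bounds b / (12 M^4) on eps and on kap1. *)
Lemma model_fun_confined (b c K kap eps l M kap1 : R) (f a a1 a2 z : R -> R) (n : nat) :
  0 < eps -> 1 <= M -> 0 < l <= b / 8 -> / M <= kap <= M ->
  c ^ 2 = kap ^ 2 / eps -> 0 < c ->
  0 < kap1 <= b / (12 * M ^ 4) -> eps <= b / (12 * M ^ 4) ->
  (forall s, - b < s < b -> is_derive z s (/ (a s) ^ 2) /\ is_derive a s (a1 s) /\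
     is_derive a1 s (a2 s) /\ / M <= a s <= M /\ Rabs (a1 s) <= M /\ Rabs (a2 s) <= M /\
     (a s) ^ 4 * f s = kap ^ 4 * ((z s) ^ 2 - l ^ 2) /\
     Rabs (z s - s) <= Rmax (Rabs s) l / 25 /\ Rabs (f s) <= K) ->
  (2 * INR n + 1) * eps <= kap ^ 2 * b ^ 2 / 32 ->
  confined (model_pot a a2 z c n) b (b / 2) (kap1 / eps) (model_fun a z c n) (model_fun' a a1 z c n).
Proof.
intros Heps HM Hl Hkap Ec Hc Hk1 Heps2 H Hn.
assert (HiM : 0 < / M) by (apply Rinv_0_lt_compat; lra).
assert (HM4 : 0 < M ^ 4) by (apply pow_lt; lra).
assert (Hc2 : 0 < c ^ 2) by now apply pow_lt.
assert (Hn' : 2 * INR n + 1 <= c ^ 2 * b ^ 2 / 32).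
{ apply Rmult_le_reg_r with eps; [exact Heps|].
  replace (c ^ 2 * b ^ 2 / 32 * eps) with (c ^ 2 * eps * b ^ 2 / 32) by field.
  rewrite Ec. replace (kap ^ 2 / eps * eps) with (kap ^ 2) by (field; lra). exact Hn. }
assert (Hherm := hermite_fun_decays n (c * (b / 2) / 3) (c * (b / 4))).
assert (Hb : 0 < b) by lra.
assert (Hk2 : (c * (b / 2) / 3) ^ 2 + (2 * INR n + 1) <= (c * (b / 4)) ^ 2).
{ apply Rle_trans with ((c * (b / 2) / 3) ^ 2 + c ^ 2 * b ^ 2 / 32); [lra|].
  assert (0 < c ^ 2 * b ^ 2) by (apply Rmult_lt_0_compat; [exact Hc2 | now apply pow_lt]).
  replace ((c * (b / 2) / 3) ^ 2) with (c ^ 2 * b ^ 2 / 36) by field.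
  replace ((c * (b / 4)) ^ 2) with (c ^ 2 * b ^ 2 / 16) by field. lra. }
assert (Hkp : 0 < c * (b / 2) / 3) by nra.
assert (Hbp : 0 <= c * (b / 4)) by nra.
set (k := c * (b / 2) / 3) in *.
assert (Hck : forall s, - b < s < b -> M ^ 2 + kap1 / eps * a s ^ 2 <= c * k).
{ intros s Hs. destruct (H s Hs) as (_ & _ & _ & [A1 A2] & _).
  replace (c * k) with (c ^ 2 * b / 6) by (unfold k; field). rewrite Ec.
  assert (HkM : / M ^ 2 <= kap ^ 2).
  { rewrite <- pow_inv. apply pow_incr. lra. }
  assert (Hie : 0 < / eps) by now apply Rinv_0_lt_compat.
  assert (HM2 : 0 < M ^ 2) by (apply pow_lt; lra).
  assert (E1 : M ^ 2 <= b / (12 * M ^ 2) * / eps).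
  { apply Rmult_le_reg_r with eps; [exact Heps|]. rewrite Rmult_assoc, Rinv_l, Rmult_1_r by lra.
    apply Rle_trans with (M ^ 2 * (b / (12 * M ^ 4))); [apply Rmult_le_compat_l; lra|].
    apply Req_le. field. lra. }
  assert (E2 : kap1 / eps * a s ^ 2 <= b / (12 * M ^ 2) * / eps).
  { apply Rle_trans with (b / (12 * M ^ 4) / eps * M ^ 2).
    - apply Rmult_le_compat; [apply Rlt_le, Rdiv_lt_0_compat; lra | apply pow2_ge_0 | |].
      + unfold Rdiv at 1 2. apply Rmult_le_compat_r; lra.
      + apply pow_incr. lra.
    - apply Req_le. field. lra. }
  assert (E3 : b / (12 * M ^ 2) * / eps + b / (12 * M ^ 2) * / eps <= kap ^ 2 / eps * b / 6).
  { apply Rle_trans with (/ M ^ 2 * (/ eps * b / 6)).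
    - apply Req_le. field. lra.
    - replace (kap ^ 2 / eps * b / 6) with (kap ^ 2 * (/ eps * b / 6)) by (field; lra).
      apply Rmult_le_compat_r; [|exact HkM].
      assert (0 < / eps * b) by (apply Rmult_lt_0_compat; lra). lra. }
  lra. }
assert (Haa : forall s, - b < s < b -> - M ^ 2 <= a s * a1 s <= M ^ 2).
{ intros s Hs. destruct (H s Hs) as (_ & _ & _ & [A1 A2] & A3 & _).
  apply Rabs_le_between in A3. nra. }
assert (EY : forall s, - b < s < b -> model_fun a z c n s * model_fun' a a1 z c n s =
  a s * a1 s * hermite_fun n (c * z s) ^ 2 + c * (hermite_fun n (c * z s) * hermite_fun' n (c * z s))).
{ intros s Hs. destruct (H s Hs) as (_ & _ & _ & [A1 A2] & _). unfold model_fun, model_fun'. field. lra. }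
assert (EY2 : forall s, model_fun a z c n s ^ 2 = a s ^ 2 * hermite_fun n (c * z s) ^ 2)
  by (intros s; unfold model_fun; ring).
assert (Hnz : forall s, - b < s < b -> hermite_fun n (c * z s) <> 0 -> model_fun a z c n s <> 0).
{ intros s Hs Hh. destruct (H s Hs) as (_ & _ & _ & [A1 A2] & _). unfold model_fun.
  apply Rmult_integral_contrapositive. split; lra. }
split; [|split; [|split]].
- apply model_fun_solves. intros s Hs.
  destruct (H s Hs) as (B1 & B2 & B3 & [B4 _] & _).
  split; [exact B1|]. split; [exact B2|]. split; [exact B3 | lra].
- intros s Hs. assert (Hs' : - b < s < b) by lra.
  destruct (H s Hs') as (_ & _ & _ & _ & _ & _ & _ & Hz & _).
  rewrite (Rabs_pos_eq s), Rmax_left in Hz by lra. apply Rabs_le_between in Hz.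
  destruct (Hherm (c * z s) Hkp Hbp Hk2) as [Hr _].
  destruct Hr as [Hr1 Hr2]; [apply Rmult_le_compat_l; lra|].
  split; [now apply Hnz|]. rewrite EY, EY2 by exact Hs'.
  specialize (Hck s Hs'). specialize (Haa s Hs').
  pose proof (pow2_ge_0 (hermite_fun n (c * z s))) as Hp.
  set (h := hermite_fun n (c * z s)) in *. set (h' := hermite_fun' n (c * z s)) in *.
  assert (c * (h * h') <= - (c * k) * h ^ 2) by nra.
  assert ((M ^ 2 + kap1 / eps * a s ^ 2) * h ^ 2 <= c * k * h ^ 2) by (apply Rmult_le_compat_r; lra).
  assert (a s * a1 s * h ^ 2 <= M ^ 2 * h ^ 2) by (apply Rmult_le_compat_r; lra).
  lra.
- intros t Ht. set (s := - t). assert (Hs' : - b < s < b) by (unfold s; lra).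
  destruct (H s Hs') as (_ & _ & _ & _ & _ & _ & _ & Hz & _).
  rewrite (Rabs_left1 s), Rmax_left in Hz by (unfold s; lra). apply Rabs_le_between in Hz.
  destruct (Hherm (c * z s) Hkp Hbp Hk2) as [_ Hr].
  destruct Hr as [Hr1 Hr2].
  { apply Rle_trans with (c * - (b / 4)); [apply Rmult_le_compat_l; unfold s in *; lra | lra]. }
  split; [now apply Hnz|].
  rewrite Ropp_mult_distr_r_reverse, EY, EY2 by exact Hs'.
  specialize (Hck s Hs'). specialize (Haa s Hs').
  pose proof (pow2_ge_0 (hermite_fun n (c * z s))) as Hp.
  set (h := hermite_fun n (c * z s)) in *. set (h' := hermite_fun' n (c * z s)) in *.
  assert ((c * k) * h ^ 2 <= c * (h * h')) by nra.
  assert ((M ^ 2 + kap1 / eps * a s ^ 2) * h ^ 2 <= c * k * h ^ 2) by (apply Rmult_le_compat_r; lra).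
  assert (- M ^ 2 * h ^ 2 <= a s * a1 s * h ^ 2) by (apply Rmult_le_compat_r; lra).
  lra.
- exists (M * M + c ^ 2 * (c ^ 2 * (4 * b ^ 2) + (2 * INR n + 1)) * M ^ 4).
  intros s Hs. destruct (H s Hs) as (_ & _ & _ & [A1 A2] & _ & A3 & _ & Hz & _).
  assert (Hia : 0 < / a s <= M).
  { split; [apply Rinv_0_lt_compat; lra|]. rewrite <- (Rinv_inv M). apply Rinv_le_contravar; lra. }
  unfold model_pot, Rdiv. eapply Rle_trans; [apply Rabs_triang|]. rewrite !Rabs_mult.
  rewrite <- pow_inv, (Rabs_pos_eq (/ a s)), (Rabs_pos_eq (c ^ 2)), (Rabs_pos_eq ((/ a s) ^ 4)) by
    (try (apply pow_le); lra).
  assert (Hi4 : (/ a s) ^ 4 <= M ^ 4) by (apply pow_incr; lra).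
  assert (Hi40 : 0 <= (/ a s) ^ 4) by (apply pow_le; lra).
  assert (Hzb : Rabs (z s) <= 2 * b).
  { replace (z s) with ((z s - s) + s) by ring. eapply Rle_trans; [apply Rabs_triang|].
    assert (Rabs s <= b) by (apply Rabs_le; lra).
    assert (Rmax (Rabs s) l <= b) by (apply Rmax_lub; lra). lra. }
  assert (HN : 0 <= INR n) by apply pos_INR.
  apply Rplus_le_compat.
  + apply Rmult_le_compat; try lra. apply Rabs_pos.
  + apply Rmult_le_compat; [apply Rmult_le_pos; [lra | apply Rabs_pos] | exact Hi40 | | exact Hi4].
    apply Rmult_le_compat_l; [lra|].
    eapply Rle_trans; [apply Rabs_triang|]. rewrite Rabs_Ropp, (Rabs_pos_eq (2 * INR n + 1)) by lra.
    apply Rplus_le_compat_r. rewrite Rpow_mult_distr, Rabs_mult, (Rabs_pos_eq (c ^ 2)) by lra.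
    apply Rmult_le_compat_l; [lra|]. rewrite <- RPow_abs.
    replace (4 * b ^ 2) with ((2 * b) ^ 2) by ring. apply pow_incr. split; [apply Rabs_pos | exact Hzb].
Qed.

Lemma quantization (b K M kap1 : R) :
  0 < b -> 1 <= M -> 0 < kap1 <= b / (12 * M ^ 4) ->
  exists C0 eps0, 0 < C0 /\ 0 < eps0 /\
  forall eps kap l (f a a1 a2 z psi psi1 : R -> R),
  0 < eps < eps0 -> 0 < l <= b / 8 -> / M <= kap <= M ->
  (forall s, - b < s < b -> is_derive z s (/ (a s) ^ 2) /\ is_derive a s (a1 s) /\
     is_derive a1 s (a2 s) /\ / M <= a s <= M /\ Rabs (a1 s) <= M /\ Rabs (a2 s) <= M /\
     (a s) ^ 4 * f s = kap ^ 4 * ((z s) ^ 2 - l ^ 2) /\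
     Rabs (z s - s) <= Rmax (Rabs s) l / 25 /\ Rabs (f s) <= K) ->
  confined (fun s => f s / eps ^ 2) b (b / 2) (kap1 / eps) psi psi1 ->
  exists n : nat, Rabs ((kap * l) ^ 2 - (2 * INR n + 1) * eps) <= C0 * eps ^ 2.
Proof.
intros Hb HM Hk1.
(* M^2 absorbs a''/a, 1 is the gap used in the comparison, and M^(-6) is a lower bound for kap^2 /
   a^4. *)
set (C0 := M ^ 6 * (M ^ 2 + 1)).
assert (HM2 : 1 <= M ^ 2) by (apply pow_R1_Rle; lra).
assert (HM4 : 1 <= M ^ 4) by (apply pow_R1_Rle; lra).
assert (HM6 : 1 <= M ^ 6) by (apply pow_R1_Rle; lra).
assert (HC0 : 0 < C0) by (unfold C0; nra).
set (d := b / 8). assert (Hd : 0 < d) by (unfold d; lra).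
assert (Hd3 : 0 < d ^ 3) by now apply pow_lt.
(* [e1] serves the decay of the model functions and makes kap1 d^3 / eps > 1 in the Sturm lemma at
   the ends. [e2] makes neighbouring model potentials differ by at least 1, keeps C0 eps^2 below the
   half-spacing eps, and keeps all levels up to E + 3 eps within reach of [model_fun_confined]. *)
set (e1 := Rmin (b / (12 * M ^ 4)) (kap1 * d ^ 3)).
set (e2 := Rmin (/ M ^ 6) (Rmin (/ C0) (b ^ 2 / (192 * M ^ 2)))).
exists C0, (Rmin e1 e2). split; [exact HC0|].
assert (Hb2 : 0 < b ^ 2) by now apply pow_lt.
split.
{ repeat apply Rmin_pos; try (apply Rinv_0_lt_compat; lra); try (apply Rdiv_lt_0_compat; lra).
  apply Rmult_lt_0_compat; lra. }
intros eps kap l f a a1 a2 z psi psi1 Heps Hl Hkap H Hpsi.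
change (0 < l <= b / 8) in Hl.
assert (L1 : eps < b / (12 * M ^ 4)).
{ eapply Rlt_le_trans; [apply Heps|]. eapply Rle_trans; [apply Rmin_l | apply Rmin_l]. }
assert (L2 : eps < kap1 * d ^ 3).
{ eapply Rlt_le_trans; [apply Heps|]. eapply Rle_trans; [apply Rmin_l | apply Rmin_r]. }
assert (L3 : eps < / M ^ 6).
{ eapply Rlt_le_trans; [apply Heps|]. eapply Rle_trans; [apply Rmin_r | apply Rmin_l]. }
assert (L4 : eps < / C0).
{ eapply Rlt_le_trans; [apply Heps|]. eapply Rle_trans; [apply Rmin_r|].
  eapply Rle_trans; [apply Rmin_r | apply Rmin_l]. }
assert (L5 : eps < b ^ 2 / (192 * M ^ 2)).
{ eapply Rlt_le_trans; [apply Heps|]. eapply Rle_trans; [apply Rmin_r|].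
  eapply Rle_trans; [apply Rmin_r | apply Rmin_r]. }
assert (He : 0 < eps) by lra.
assert (HiM : 0 < / M) by (apply Rinv_0_lt_compat; lra).
assert (Hkp : 0 < kap) by lra.
assert (Hse := sqrt_lt_R0 _ He). assert (Ese := sqrt_sqrt eps ltac:(lra)).
set (c := kap / sqrt eps).
assert (Hc : 0 < c) by (apply Rdiv_lt_0_compat; lra).
assert (Ec : c ^ 2 = kap ^ 2 / eps).
{ unfold c. rewrite <- Ese at 2. field. lra. }
set (E := (kap * l) ^ 2).
assert (HE0 : 0 <= E) by apply pow2_ge_0.
assert (Hk2 : 0 < kap ^ 2) by now apply pow_lt.
assert (Hk2M : / M ^ 2 <= kap ^ 2) by (rewrite <- pow_inv; apply pow_incr; lra).
assert (HEb : E + 3 * eps <= kap ^ 2 * b ^ 2 / 32).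
{ assert (E <= kap ^ 2 * b ^ 2 / 64).
  { unfold E. replace (kap ^ 2 * b ^ 2 / 64) with ((kap * (b / 8)) ^ 2) by field.
    apply pow_incr. split; [apply Rmult_le_pos; lra | apply Rmult_le_compat_l; lra]. }
  assert (3 * eps <= kap ^ 2 * b ^ 2 / 64).
  { apply Rle_trans with (/ M ^ 2 * (b ^ 2 / 64)).
    - apply Rle_trans with (3 * (b ^ 2 / (192 * M ^ 2))); [lra|]. apply Req_le. field. lra.
    - replace (kap ^ 2 * b ^ 2 / 64) with (kap ^ 2 * (b ^ 2 / 64)) by field.
      apply Rmult_le_compat_r; lra. }
  lra. }
(* The Langer equation a^4 f = kap^4 (z^2 - l^2) makes the z-dependence cancel: the model potential
   differs from f / eps^2 by a''/a and a positive multiple of E minus the n-th level. *)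
assert (Epot : forall n s, - b < s < b -> model_pot a a2 z c n s =
  f s / eps ^ 2 + (a2 s / a s + kap ^ 2 / a s ^ 4 * ((E - (2 * INR n + 1) * eps) / eps ^ 2))).
{ intros n s Hs. destruct (H s Hs) as (_ & _ & _ & [A1 _] & _ & _ & Ef & _).
  assert (Ef' : f s = kap ^ 4 * ((z s) ^ 2 - l ^ 2) / a s ^ 4).
  { rewrite <- Ef. field. lra. }
  unfold model_pot. rewrite Ef', (Rpow_mult_distr c), Ec. unfold E. field. lra. }
assert (Hlow : forall s, - b < s < b -> / M ^ 6 <= kap ^ 2 / a s ^ 4 /\ - M ^ 2 <= a2 s / a s <= M ^ 2).
{ intros s Hs. destruct (H s Hs) as (_ & _ & _ & [A1 A2] & _ & A3 & _).
  assert (Ha4 : 0 < a s ^ 4) by (apply pow_lt; lra).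
  assert (Hia : 0 < / a s <= M).
  { split; [apply Rinv_0_lt_compat; lra|]. rewrite <- (Rinv_inv M). apply Rinv_le_contravar; lra. }
  split.
  - replace (/ M ^ 6) with (/ M ^ 2 * / M ^ 4) by (field; lra).
    apply Rmult_le_compat; [apply Rlt_le, Rinv_0_lt_compat; lra | apply Rlt_le, Rinv_0_lt_compat; lra | lra |].
    apply Rinv_le_contravar; [exact Ha4 | apply pow_incr; lra].
  - apply Rabs_le_between. unfold Rdiv. rewrite Rabs_mult, (Rabs_pos_eq (/ a s)) by lra.
    replace (M ^ 2) with (M * M) by ring. apply Rmult_le_compat; try lra. apply Rabs_pos. }
assert (Hie2 : 0 < eps ^ 2) by now apply pow_lt.
assert (HK0 : 0 < kap1 / eps) by (apply Rdiv_lt_0_compat; lra).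
assert (HKd : 1 < 1 * d ^ 2 * (1 + 2 * (kap1 / eps) * d)).
{ assert (1 < kap1 / eps * d ^ 3).
  { apply Rmult_lt_reg_r with eps; [exact He|]. replace (kap1 / eps * d ^ 3 * eps) with (kap1 * d ^ 3) by (field; lra).
    lra. }
  assert (0 < d ^ 2) by now apply pow_lt.
  replace (1 * d ^ 2 * (1 + 2 * (kap1 / eps) * d)) with (d ^ 2 + 2 * (kap1 / eps * d ^ 3)) by ring. lra. }
set (Y := model_fun a z c). set (Y1 := model_fun' a a1 z c). set (q := model_pot a a2 z c).
assert (HY : forall n, (2 * INR n + 1) * eps <= E + 3 * eps -> confined (q n) b (b / 2) (kap1 / eps) (Y n) (Y1 n)).
{ intros n Hn. apply (model_fun_confined b c K kap eps l M kap1 f a a1 a2 z n); auto; lra. }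
assert (Hzero : forall n, ~ zero_chain (Y n) b (S n) (- b)).
{ intros n. apply (model_fun_zeros b c (2 * b)); auto.
  - intros s Hs. destruct (H s Hs) as (_ & _ & _ & [A1 _] & _). lra.
  - apply (strictly_increasing_of_derive b z (fun s => / a s ^ 2)). intros s Hs.
    destruct (H s Hs) as (D & _ & _ & [A1 _] & _). split; [exact D|].
    apply Rinv_0_lt_compat, pow_lt. lra.
  - intros s Hs. destruct (H s Hs) as (_ & _ & _ & _ & _ & _ & _ & Hz & _).
    assert (Rmax (Rabs s) l <= b) by (apply Rmax_lub; [apply Rabs_le|]; lra).
    apply Rabs_le_between in Hz. lra. }
assert (Hinter : forall qf qg g g1 h h1 n,
  confined qf b (b / 2) (kap1 / eps) g g1 -> confined qg b (b / 2) (kap1 / eps) h h1 ->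
  (forall t, - b < t < b -> qf t + 1 <= qg t) -> zero_chain h b n (- b) -> zero_chain g b (S n) (- b)).
{ intros qf qg g g1 h h1 n Hg Hh Hq. 
  apply (sturm_interlacing qf qg b (b / 2) d (kap1 / eps) 1 g g1 h h1 n); auto; unfold d in *; lra. }
(* Y_0 needs no zero to start, and each comparison with the next level adds one. Levels are 2 eps
   apart, so the potentials differ by at least 2 / (M^6 eps). *)
assert (Hchain : forall n, (2 * INR n + 1) * eps <= E + 3 * eps -> zero_chain (Y n) b n (- b)).
{ intros n. induction n as [|n IH]; intros Hn; [exact I|].
  assert (Hn' : (2 * INR n + 1) * eps <= E + 3 * eps) by (rewrite S_INR in Hn; lra).
  apply (Hinter (q (S n)) (q n) _ (Y1 (S n)) (Y n) (Y1 n)); auto.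
  intros s Hs. unfold q. rewrite !Epot by exact Hs. destruct (Hlow s Hs) as [Hw _].
  assert (Hd1 : (E - (2 * INR n + 1) * eps) / eps ^ 2 = (E - (2 * INR (S n) + 1) * eps) / eps ^ 2 + 2 / eps).
  { rewrite S_INR. field. lra. }
  rewrite Hd1. assert (H2e : M ^ 6 <= 2 / eps).
  { apply Rmult_le_reg_r with eps; [exact He|]. replace (2 / eps * eps) with 2 by (field; lra).
    assert (HM1 : M ^ 6 * eps < M ^ 6 * / M ^ 6) by (apply Rmult_lt_compat_l; lra).
    rewrite Rinv_r in HM1 by lra. lra. }
  assert (1 <= kap ^ 2 / a s ^ 4 * (2 / eps)).
  { replace 1 with (/ M ^ 6 * M ^ 6) by (field; lra).
    assert (0 < / M ^ 6) by (apply Rinv_0_lt_compat; lra). apply Rmult_le_compat; lra. }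
  lra. }
assert (Hgap : forall x, C0 * eps ^ 2 <= x -> forall s, - b < s < b -> M ^ 2 + 1 <= kap ^ 2 / a s ^ 4 * (x / eps ^ 2)).
{ intros x Hx s Hs. destruct (Hlow s Hs) as [Hw _].
  assert (C0 <= x / eps ^ 2).
  { apply Rmult_le_reg_r with (eps ^ 2); [exact Hie2|].
    replace (x / eps ^ 2 * eps ^ 2) with x by (field; lra). exact Hx. }
  replace (M ^ 2 + 1) with (/ M ^ 6 * C0) by (unfold C0; field; lra).
  assert (0 < / M ^ 6) by (apply Rinv_0_lt_compat; lra). apply Rmult_le_compat; lra. }
assert (Habove : forall n, (2 * INR n + 1) * eps + C0 * eps ^ 2 <= E ->
  forall s, - b < s < b -> f s / eps ^ 2 + 1 <= q n s).
{ intros n Hn s Hs. unfold q. rewrite Epot by exact Hs. destruct (Hlow s Hs) as [_ Hw].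
  specialize (Hgap (E - (2 * INR n + 1) * eps) ltac:(lra) s Hs). lra. }
assert (Hbelow : forall n, E + C0 * eps ^ 2 <= (2 * INR n + 1) * eps ->
  forall s, - b < s < b -> q n s + 1 <= f s / eps ^ 2).
{ intros n Hn s Hs. unfold q. rewrite Epot by exact Hs. destruct (Hlow s Hs) as [_ Hw].
  specialize (Hgap ((2 * INR n + 1) * eps - E) ltac:(lra) s Hs).
  replace ((E - (2 * INR n + 1) * eps) / eps ^ 2) with (- (((2 * INR n + 1) * eps - E) / eps ^ 2)) by (field; lra).
  lra. }
assert (HCe : C0 * eps ^ 2 <= eps).
{ replace (C0 * eps ^ 2) with (C0 * eps * eps) by ring.
  assert (HC1 : C0 * eps < C0 * / C0) by (apply Rmult_lt_compat_l; lra).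
  rewrite Rinv_r in HC1 by lra. nra. }
(* N is the index of the level (2 N + 1) eps nearest to E, which lies within eps of it; the
   neighbouring levels are at least eps >= C0 eps^2 away. *)
destruct (nfloor_ex (E / (2 * eps))) as [N [HN1 HN2]].
{ apply Rdiv_le_0_compat; lra. }
assert (EN : E = E / (2 * eps) * (2 * eps)) by (field; lra).
assert (HNl : 2 * INR N * eps <= E).
{ rewrite EN. apply (Rmult_le_compat_r (2 * eps)) in HN1; lra. }
assert (HNu : E < (2 * INR N + 2) * eps).
{ rewrite EN. apply (Rmult_lt_compat_r (2 * eps)) in HN2; lra. }
exists N. apply Rnot_lt_le. intros Hlt. unfold Rabs in Hlt.
destruct (Rcase_abs (E - (2 * INR N + 1) * eps)) as [Hs|Hs].
(* E lies below its level: the chain is Y_(N-1), psi, Y_N, beginning with psi when N = 0. *)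
- assert (Hpz : zero_chain psi b N (- b)).
  { destruct N as [|p]; [exact I|]. rewrite S_INR in HNl, HNu.
    apply (Hinter (fun s => f s / eps ^ 2) (q p) psi psi1 (Y p) (Y1 p)); auto.
    - apply HY. lra.
    - apply Habove. lra.
    - apply Hchain. lra. }
  apply (Hzero N). apply (Hinter (q N) (fun s => f s / eps ^ 2) (Y N) (Y1 N) psi psi1); auto.
  + apply HY. lra.
  + apply Hbelow. lra.
(* E lies above its level, and the indices move up by one: Y_N, psi, Y_(N+1). *)
- assert (Hpz : zero_chain psi b (S N) (- b)).
  { apply (Hinter (fun s => f s / eps ^ 2) (q N) psi psi1 (Y N) (Y1 N)); auto.
    - apply HY. lra.
    - apply Habove. lra.
    - apply Hchain. lra. }
  apply (Hzero (S N)).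
  apply (Hinter (q (S N)) (fun s => f s / eps ^ 2) (Y (S N)) (Y1 (S N)) psi psi1); auto.
  + apply HY. rewrite S_INR. lra.
  + apply Hbelow. rewrite S_INR. lra.
Qed.

(** * Eigenfunctions *)

Module L2Large.
Import all_boot all_order all_algebra all_classical all_reals all_analysis.
Import measurable_realfun Rstruct Rstruct_topology.
Import Order.TTheory GRing.Theory Num.Theory numFieldNormedType.Exports.
Local Open Scope classical_set_scope.
Local Open Scope ring_scope.

(** Chebyshev's inequality for f^2. Since half-lines have infinite measure, a square integrable
    function cannot stay at least 1 in absolute value on one of them. *)
Lemma L2_of_measure_lty (T : realType) (f : T -> T) (A : set T) :
  measurable A -> RealL2.L2_of T f -> (forall x, A x -> 1 <= `|f x|) ->
  (lebesgue_measure A < +oo)%E.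
Proof.
move=> mA Lf Af.
have /integrableP[mf2 if2] := Lfun2_integrable_sqr Lf.
have mf2' := measurableT_comp (@abse_measurable T setT) mf2.
apply: le_lt_trans if2.
have <- : (\int[lebesgue_measure]_(x in A) (1%:E : \bar T) = lebesgue_measure A)%E.
  by rewrite integral_cst// mul1e.
apply: (@le_trans _ _ (\int[lebesgue_measure]_(x in A) `|(((f x) ^+ 2)%:E : \bar T)|)%E).
  apply: ge0_le_integral => //.
  - exact: (measurable_funS measurableT (@subsetT _ A) mf2').
  - move=> x Ax; rewrite lee_fin; apply: le_trans (ler_norm _).
    by rewrite -real_normK ?num_real// exprn_ege1// Af.
by apply: ge0_subset_integral.
Qed.

Lemma L2_not_ge1_right (f : R -> R) (t0 : R) :
  RealL2.L2 f -> ~ (forall t, Rle t0 t -> Rle 1 (Rabs (f t))).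
Proof.
move=> Lf Hf.
have : (lebesgue_measure (`[t0, +oo[%classic : set R) < +oo)%E.
  apply: (@L2_of_measure_lty _ f) => // x /=; rewrite in_itv/= andbT => /RleP tx.
  by apply/RleP; exact: Hf.
by rewrite lebesgue_measure_itv/= ltry.
Qed.

Lemma L2_not_ge1_left (f : R -> R) (t0 : R) :
  RealL2.L2 f -> ~ (forall t, Rle t t0 -> Rle 1 (Rabs (f t))).
Proof.
move=> Lf Hf.
have : (lebesgue_measure (`]-oo, t0]%classic : set R) < +oo)%E.
  apply: (@L2_of_measure_lty _ f) => // x /=; rewrite in_itv/= => /RleP tx.
  by apply/RleP; exact: Hf.
by rewrite lebesgue_measure_itv/= ltNyr.
Qed.
End L2Large.

(** * Reduction to small energies *)

(* If g is locally at least delta(u, v) on the delta(u, v)-square around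
   (u, v), then the uniform d <= delta(u, v) of the compactness theorem bounds g
   from below. *)
Lemma rectangle_lower_bound (g : R -> R -> R) (x1 x2 y1 y2 : R) :
  (forall u v, x1 <= u <= x2 -> y1 <= v <= y2 -> exists d, 0 < d /\
     forall x y, x1 <= x <= x2 -> y1 <= y <= y2 -> Rabs (x - u) < d -> Rabs (y - v) < d -> d <= g x y) ->
  exists m, 0 < m /\ forall x y, x1 <= x <= x2 -> y1 <= y <= y2 -> m <= g x y.
Proof.
intros H.
destruct (functional_choice (fun (p : R * R) (d : posreal) =>
  x1 <= fst p <= x2 -> y1 <= snd p <= y2 ->
     forall x y, x1 <= x <= x2 -> y1 <= y <= y2 -> Rabs (x - fst p) < d -> Rabs (y - snd p) < d -> d <= g x y))
  as [delta Hdelta].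
{ intros [u v]. destruct (classic (x1 <= u <= x2 /\ y1 <= v <= y2)) as [[Hu Hv]|Hn].
  - destruct (H u v Hu Hv) as (d & Hd & Hg). exists (mkposreal d Hd). intros _ _. exact Hg.
  - exists (mkposreal 1 Rlt_0_1). simpl. intros Hu Hv. now elim Hn. }
destruct (compactness_value_2d x1 x2 y1 y2 (fun u v => delta (u, v))) as [d Hd].
exists d. split; [apply cond_pos|]. intros x y Hx Hy. apply NNPP. intros Hn.
apply (Hd x y Hx Hy). intros (u & v & Hu & Hv & Hxu & Hyv & Hle). apply Hn.
eapply Rle_trans; [exact Hle|]. now apply (Hdelta (u, v)).
Qed.

(** Continuity relative to the closed rectangle, as only one side is available at lam = 0 and at lam
    = lmax. *)
Definition rectangle_continuous (f : R -> R -> R) (x1 x2 y1 y2 : R) : Prop :=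
  forall u v, x1 <= u <= x2 -> y1 <= v <= y2 -> forall e, 0 < e -> exists d, 0 < d /\
    forall x y, x1 <= x <= x2 -> y1 <= y <= y2 -> Rabs (x - u) < d -> Rabs (y - v) < d ->
      Rabs (f x y - f u v) < e.

(** An upper bound on |f| is a positive lower bound on 1 / (1 + |f|), so a single compactness
    argument covers both kinds of bound. *)
Lemma rectangle_bounded (f : R -> R -> R) (x1 x2 y1 y2 : R) :
  rectangle_continuous f x1 x2 y1 y2 ->
  exists K, 0 < K /\ forall x y, x1 <= x <= x2 -> y1 <= y <= y2 -> Rabs (f x y) <= K.
Proof.
intros Hf. destruct (rectangle_lower_bound (fun x y => / (1 + Rabs (f x y))) x1 x2 y1 y2) as [m [Hm H]].
- intros u v Hu Hv. destruct (Hf u v Hu Hv 1 Rlt_0_1) as (d & Hd & Hc).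
  pose proof (Rabs_pos (f u v)).
  assert (Hi : 0 < / (2 + Rabs (f u v))) by (apply Rinv_0_lt_compat; lra).
  exists (Rmin d (/ (2 + Rabs (f u v)))). split; [now apply Rmin_pos|].
  intros x y Hx Hy Hxu Hyv.
  specialize (Hc x y Hx Hy (Rlt_le_trans _ _ _ Hxu (Rmin_l _ _)) (Rlt_le_trans _ _ _ Hyv (Rmin_l _ _))).
  eapply Rle_trans; [apply Rmin_r|]. pose proof (Rabs_pos (f x y)).
  apply Rinv_le_contravar; [lra|].
  pose proof (Rabs_triang_inv (f x y) (f u v)). lra.
- exists (/ m). split; [now apply Rinv_0_lt_compat|]. intros x y Hx Hy. specialize (H x y Hx Hy).
  cbv beta in H. pose proof (Rabs_pos (f x y)).
  apply Rinv_le_contravar in H; [|exact Hm]. rewrite Rinv_inv in H. lra.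
Qed.

Lemma rectangle_positive (f : R -> R -> R) (x1 x2 y1 y2 : R) :
  rectangle_continuous f x1 x2 y1 y2 ->
  (forall x y, x1 <= x <= x2 -> y1 <= y <= y2 -> 0 < f x y) ->
  exists m, 0 < m /\ forall x y, x1 <= x <= x2 -> y1 <= y <= y2 -> m <= f x y.
Proof.
intros Hf Hp. apply rectangle_lower_bound. intros u v Hu Hv.
specialize (Hp u v Hu Hv). destruct (Hf u v Hu Hv (f u v / 2)) as (d & Hd & Hc); [lra|].
exists (Rmin d (f u v / 2)). split; [apply Rmin_pos; lra|]. intros x y Hx Hy Hxu Hyv.
specialize (Hc x y Hx Hy (Rlt_le_trans _ _ _ Hxu (Rmin_l _ _)) (Rlt_le_trans _ _ _ Hyv (Rmin_l _ _))).
eapply Rle_trans; [apply Rmin_r|]. apply Rabs_def2 in Hc. lra.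
Qed.

(** Halving [delta] gives a compact rectangle inside the strip, which is open in x. *)
Lemma continuous_partials_rectangle (M N n : nat) (delta lmax : R) (V : R -> R -> R) :
  continuous_partials M N delta lmax V -> (n <= N)%nat -> 0 < delta ->
  rectangle_continuous (dx n V) (- (delta / 2)) (delta / 2) 0 lmax.
Proof.
intros (D & D0 & _ & Dc) Hn Hd u v Hu Hv e He.
specialize (Dc 0%nat n (Nat.le_0_l M) Hn (u, v)). simpl in Dc.
assert (Hlim := Dc ltac:(split; lra)).
destruct (proj1 (filterlim_locally _ _) Hlim (mkposreal e He)) as [d Hball].
exists d. split; [apply cond_pos|]. intros x y Hx Hy Hxu Hyv.
assert (Hb : ball (u, v) d (x, y)) by (split; [exact Hxu | exact Hyv]).
specialize (Hball (x, y) Hb). simpl in Hball. specialize (Hball ltac:(split; lra)).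
rewrite <- !(D0 n) by (try exact Hn; split; simpl; lra). exact Hball.
Qed.

Lemma uniform_derivative_bounds (N : nat) (M : nat) (delta lmax : R) (V : R -> R -> R) :
  continuous_partials M N delta lmax V -> 0 < delta ->
  exists K, 0 < K /\ forall n x lam, (n <= N)%nat -> - (delta / 2) <= x <= delta / 2 -> 0 <= lam <= lmax ->
    Rabs (dx n V x lam) <= K.
Proof.
intros HV Hd.
enough (H : forall m, (m <= N)%nat -> exists K, 0 < K /\ forall n x lam, (n <= m)%nat ->
  - (delta / 2) <= x <= delta / 2 -> 0 <= lam <= lmax -> Rabs (dx n V x lam) <= K) by (apply (H N); lia).
intros m. induction m as [|m IH]; intros Hm.
- destruct (rectangle_bounded _ _ _ _ _ (continuous_partials_rectangle M N 0 delta lmax V HV Hm Hd)) as [K [HK H]].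
  exists K. split; [exact HK|]. intros n x lam Hn Hx Hl. replace n with 0%nat by lia. now apply H.
- destruct (rectangle_bounded _ _ _ _ _ (continuous_partials_rectangle M N (S m) delta lmax V HV Hm Hd)) as [K [HK H]].
  destruct (IH ltac:(lia)) as [K' [HK' H']].
  exists (K + K'). split; [lra|]. intros n x lam Hn Hx Hl.
  destruct (Nat.eq_dec n (S m)) as [->|Hne].
  + specialize (H x lam Hx Hl). lra.
  + specialize (H' n x lam ltac:(lia) Hx Hl). lra.
Qed.

Lemma uniform_convexity (M N : nat) (delta lmax : R) (V : R -> R -> R) :
  continuous_partials M N delta lmax V -> (2 <= N)%nat -> 0 < delta ->
  (forall lam, 0 <= lam <= lmax -> 0 < dx 2 V 0 lam) ->
  exists c, 0 < c /\ forall lam, 0 <= lam <= lmax -> c <= dx 2 V 0 lam.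
Proof.
intros HV HN Hd Hp.
assert (Hc := continuous_partials_rectangle M N 2 delta lmax V HV HN Hd).
(* The rectangle is degenerate in x: compactness is used along the segment x = 0. *)
destruct (rectangle_positive (fun _ y => dx 2 V 0 y) 0 0 0 lmax) as [m [Hm H]].
- intros u v Hu Hv e He. destruct (Hc 0 v ltac:(lra) Hv e He) as (d & Hdp & H).
  exists d. split; [exact Hdp|]. intros x y Hx Hy Hxu Hyv. apply H; try lra.
  rewrite Rminus_diag, Rabs_R0. exact Hdp.
- intros x y _ Hy. now apply Hp.
- exists m. split; [exact Hm|]. intros lam Hl. apply (H 0 lam); lra.
Qed.

(** * Shape of the potential and turning points *)

Lemma class_C_is_derive (k : nat) (V : R -> R -> R) (lam : R) :
  class_C k (fun x => V x lam) -> forall n x, (n < k)%nat ->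
  is_derive (fun x => dx n V x lam) x (dx (S n) V x lam).
Proof.
intros H n x Hn. destruct (H (S n) x Hn) as [Hex _]. simpl in Hex.
apply (Derive_correct (Derive_n (fun y => V y lam) n) x Hex).
Qed.

Lemma potential_monotone (V : R -> R -> R) (lam : R) :
  (forall x, is_derive (fun x => V x lam) x (dx 1 V x lam)) ->
  (forall x, (0 < x -> 0 < dx 1 V x lam) /\ (x < 0 -> dx 1 V x lam < 0)) ->
  forall x y, (0 <= x -> x < y -> V x lam < V y lam) /\ (x < y -> y <= 0 -> V y lam < V x lam).
Proof.
intros HD HS x y. split; intros H1 H2.
- destruct (MVT_cor2 (fun x => V x lam) (fun x => dx 1 V x lam) x y H2) as [c [E Hc]].
  { intros c _. apply is_derive_Reals, HD. }
  destruct (HS c) as [Hp _]. specialize (Hp ltac:(lra)). nra.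
- destruct (MVT_cor2 (fun x => V x lam) (fun x => dx 1 V x lam) x y H1) as [c [E Hc]].
  { intros c _. apply is_derive_Reals, HD. }
  destruct (HS c) as [_ Hp]. specialize (Hp ltac:(lra)). nra.
Qed.

Lemma turning_points (V : R -> R -> R) (lam rho : R) :
  (forall x, is_derive (fun x => V x lam) x (dx 1 V x lam)) ->
  (forall x, (0 < x -> 0 < dx 1 V x lam) /\ (x < 0 -> dx 1 V x lam < 0)) ->
  V 0 lam = 0 -> 0 < lam -> 0 < rho -> lam < V rho lam -> lam < V (- rho) lam ->
  exists xm xp, - rho < xm < 0 /\ 0 < xp < rho /\ V xm lam = lam /\ V xp lam = lam /\
    forall x, V x lam = lam <-> x = xm \/ x = xp.
Proof.
intros HD HS H0 Hl Hr Hp Hm. assert (Mon := potential_monotone V lam HD HS).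
assert (Hc : forall x, continuity_pt (fun x => V x lam - lam) x).
{ intros x. apply continuity_pt_minus; [|apply continuity_pt_const; now intros u v].
  apply continuity_pt_filterlim, (derive_continuous _ _ _ (HD x)). }
destruct (IVT_interv (fun x => V x lam - lam) 0 rho) as [xp [Hxp Exp]]; auto; try lra.
destruct (IVT_interv (fun x => - (V x lam - lam)) (- rho) 0) as [xm [Hxm Exm]]; try lra.
{ intros x _. now apply continuity_pt_opp. }
assert (xp <> 0) by (intros E; rewrite E, H0 in Exp; lra).
assert (xp <> rho) by (intros E; rewrite E in Exp; lra).
assert (xm <> 0) by (intros E; rewrite E, H0 in Exm; lra).
assert (xm <> - rho) by (intros E; rewrite E in Exm; lra).
exists xm, xp. split; [lra|]. split; [lra|]. split; [lra|]. split; [lra|].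
intros x. split; [|intros [-> | ->]; lra]. intros Ex.
destruct (Rle_dec 0 x) as [P|P].
- right. destruct (Rtotal_order x xp) as [Q|[Q|Q]]; [|exact Q|].
  + destruct (Mon x xp) as [A _]. specialize (A P Q). lra.
  + destruct (Mon xp x) as [A _]. specialize (A ltac:(lra) Q). lra.
- left. destruct (Rtotal_order x xm) as [Q|[Q|Q]]; [|exact Q|].
  + destruct (Mon x xm) as [_ A]. specialize (A Q ltac:(lra)). lra.
  + destruct (Mon xm x) as [_ A]. specialize (A Q ltac:(lra)). lra.
Qed.

Lemma convex_lower_bound (f f1 f2 : R -> R) (r c : R) :
  (forall x, - r <= x <= r -> is_derive f x (f1 x) /\ is_derive f1 x (f2 x) /\ c <= f2 x) ->
  f 0 = 0 -> f1 0 = 0 -> forall x, - r <= x <= r -> c / 2 * x ^ 2 <= f x.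
Proof.
intros H H0 H1 x Hx.
assert (Hin : forall y t, - r <= y <= r -> Rmin 0 y <= t <= Rmax 0 y -> - r <= t <= r).
{ intros y t Hy. unfold Rmin, Rmax. destruct (Rle_dec 0 y); lra. }
assert (Hsg : forall y, - r <= y <= r -> 0 <= (f1 y - c * y) * y).
{ intros y Hy. destruct (mean_value f1 f2 0 y) as [t [Ht E]].
  - intros t Ht. apply H. now apply (Hin y).
  - destruct (H t (Hin y t Hy Ht)) as (_ & _ & Hc). rewrite H1 in E.
    replace (f1 y) with (f2 t * (y - 0)) by lra.
    replace ((f2 t * (y - 0) - c * y) * y) with ((f2 t - c) * y ^ 2) by ring.
    apply Rmult_le_pos; [lra | apply pow2_ge_0]. }
destruct (mean_value (fun x => f x - c / 2 * x ^ 2) (fun x => f1 x - c * x) 0 x) as [t [Ht E]].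
- intros t Ht. destruct (H t (Hin x t Hx Ht)) as (D & _). auto_derive; [eexists; eassumption|].
  derive_subst D. simpl. field.
- specialize (Hsg t (Hin x t Hx Ht)). rewrite H0 in E.
  assert (0 <= (f1 t - c * t) * x).
  { revert Ht. unfold Rmin, Rmax. destruct (Rle_dec 0 x) as [P|P]; intros Ht.
    - destruct (Req_dec t 0) as [->|Q]; [rewrite H1; lra|]. assert (0 < t) by lra.
      assert (0 <= f1 t - c * t) by nra. nra.
    - destruct (Req_dec t 0) as [->|Q]; [rewrite H1; lra|]. assert (t < 0) by lra.
      assert (f1 t - c * t <= 0) by nra. nra. }
  lra.
Qed.

(** * Real eigenfunctions and their decay *)

Lemma is_derive_linear (U W : NormedModule R_AbsRing) (f : R -> U) (L : U -> W) (x : R) (l : U) :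
  is_linear L -> is_derive f x l -> is_derive (fun y => L (f y)) x (L l).
Proof.
intros HL Hf. unfold is_derive.
apply (filterdiff_ext_lin (U := AbsRing_NormedModule R_AbsRing) (fun y => L (f y)) (fun y : R_AbsRing => L (scal y l))).
- apply (filterdiff_comp (U := AbsRing_NormedModule R_AbsRing) f L (fun y : R_AbsRing => scal y l) L Hf).
  now apply filterdiff_linear.
- intros y. now apply linear_scal.
Qed.

(** The coefficients are real, so real and imaginary parts solve the equation separately. At a point
    where w is nonzero, one of the two has nonzero Cauchy data. *)
Lemma real_eigenfunction (V : R -> R -> R) (eps lam : R) :
  0 < eps -> is_eigenvalue eps (schrodinger V) lam ->
  exists psi psi1 : R -> R,
    (forall x, is_derive psi x (psi1 x) /\
       is_derive psi1 x ((V x lam - lam) / eps ^ 2 * psi x)) /\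
    (exists x, psi x <> 0 \/ psi1 x <> 0) /\ RealL2.L2 psi.
Proof.
intros He (w & Hw & [x0 Hx0] & (L1 & L2 & L3 & L4)).
assert (D : forall x,
  is_derive (fun x => Re (fst (w x))) x (Re (snd (w x)) / eps) /\
  is_derive (fun x => Im (fst (w x))) x (Im (snd (w x)) / eps) /\
  is_derive (fun x => Re (snd (w x))) x ((V x lam - lam) * Re (fst (w x)) / eps) /\
  is_derive (fun x => Im (snd (w x))) x ((V x lam - lam) * Im (fst (w x)) / eps)).
{ intros x. destruct (Hw x) as [dw [Hd E]].
  assert (Df := is_derive_linear _ _ w fst x dw (@is_linear_fst R_AbsRing _ _) Hd).
  assert (Ds := is_derive_linear _ _ w snd x dw (@is_linear_snd R_AbsRing _ _) Hd).
  assert (Dff := is_derive_linear _ R_NormedModule _ fst x _ (@is_linear_fst R_AbsRing R_NormedModule R_NormedModule) Df).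
  assert (Dfs := is_derive_linear _ R_NormedModule _ snd x _ (@is_linear_snd R_AbsRing R_NormedModule R_NormedModule) Df).
  assert (Dsf := is_derive_linear _ R_NormedModule _ fst x _ (@is_linear_fst R_AbsRing R_NormedModule R_NormedModule) Ds).
  assert (Dss := is_derive_linear _ R_NormedModule _ snd x _ (@is_linear_snd R_AbsRing R_NormedModule R_NormedModule) Ds).
  destruct dw as [[d1 d2] [d3 d4]]. destruct (w x) as [[u1 u2] [v1 v2]].
  simpl in *. unfold scal in E; simpl in E. unfold prod_scal, scal, mult in E; simpl in E.
  unfold mulmv, schrodinger, Cplus, Cmult, RtoC in E; simpl in E. unfold mult in E; simpl in E.
  injection E. intros E4 E3 E2 E1.
  change (eps * d1 = 0 * u1 - 0 * u2 + (1 * v1 - 0 * v2)) in E1.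
  change (eps * d2 = 0 * u2 + 0 * u1 + (1 * v2 + 0 * v1)) in E2.
  change (eps * d3 = (V x lam - lam) * u1 - 0 * u2 + (0 * v1 - 0 * v2)) in E3.
  change (eps * d4 = (V x lam - lam) * u2 + 0 * u1 + (0 * v2 + 0 * v1)) in E4.
  assert (F1 : d1 = v1 / eps) by (apply Rmult_eq_reg_l with eps; [rewrite E1; field|]; lra).
  assert (F2 : d2 = v2 / eps) by (apply Rmult_eq_reg_l with eps; [rewrite E2; field|]; lra).
  assert (F3 : d3 = (V x lam - lam) * u1 / eps) by (apply Rmult_eq_reg_l with eps; [rewrite E3; field|]; lra).
  assert (F4 : d4 = (V x lam - lam) * u2 / eps) by (apply Rmult_eq_reg_l with eps; [rewrite E4; field|]; lra).
  rewrite <- F1, <- F2, <- F3, <- F4. unfold Re, Im. simpl. auto. }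
assert (Hscal : forall (f g : R -> R) x, is_derive g x ((V x lam - lam) * f x / eps) ->
  is_derive (fun x => g x / eps) x ((V x lam - lam) / eps ^ 2 * f x)).
{ intros f g x Hg. auto_derive; [now eexists; apply Hg|]. derive_subst Hg. field. lra. }
destruct (classic (Re (fst (w x0)) <> 0 \/ Re (snd (w x0)) <> 0)) as [Hre|Hre].
- exists (fun x => Re (fst (w x))), (fun x => Re (snd (w x)) / eps). split; [|split; [|exact L1]].
  + intros x. destruct (D x) as (D1 & _ & D3 & _). split; [exact D1|].
    apply (Hscal (fun x => Re (fst (w x))) (fun x => Re (snd (w x)))); exact D3.
  + exists x0. destruct Hre as [H|H]; [now left|]. right. intros E. apply H.
    apply Rmult_eq_reg_r with (/ eps); [|apply Rinv_neq_0_compat; lra].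
    unfold Rdiv in E. rewrite E. ring.
- exists (fun x => Im (fst (w x))), (fun x => Im (snd (w x)) / eps). split; [|split; [|exact L2]].
  + intros x. destruct (D x) as (_ & D1 & _ & D3). split; [exact D1|].
    apply (Hscal (fun x => Im (fst (w x))) (fun x => Im (snd (w x)))); exact D3.
  + exists x0. apply NNPP. intros Hn. apply Hx0.
    assert (R1 : Re (fst (w x0)) = 0) by (apply NNPP; intros H; apply Hre; now left).
    assert (R2 : Re (snd (w x0)) = 0) by (apply NNPP; intros H; apply Hre; now right).
    assert (I1 : Im (fst (w x0)) = 0) by (apply NNPP; intros H; apply Hn; now left).
    assert (I2 : Im (snd (w x0)) / eps = 0) by (apply NNPP; intros H; apply Hn; now right).
    assert (I3 : Im (snd (w x0)) = 0).
    { apply Rmult_eq_reg_r with (/ eps); [|apply Rinv_neq_0_compat; lra].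
      unfold Rdiv in I2. rewrite I2. ring. }
    destruct (w x0) as [[u1 u2] [v1 v2]]. unfold Re, Im in *. simpl in *. subst. reflexivity.
Qed.

(** Square integrability enters as the failure of |psi| >= 1 on half-lines; this excludes growth and
    leaves psi bounded. If psi vanished near infinity, its Cauchy data there would be zero, and
    uniqueness on a bounded interval reaching x0, where q is bounded, would contradict
    nontriviality. *)
Lemma global_solution_decays (q psi psi1 : R -> R) (beta k : R) :
  0 < k -> (forall x, continuous q x) ->
  (forall x, is_derive psi x (psi1 x) /\ is_derive psi1 x (q x * psi x)) ->
  (exists x, psi x <> 0 \/ psi1 x <> 0) ->
  (forall t, beta <= t -> k ^ 2 <= q t) ->
  (forall T, ~ (forall t, T <= t -> 1 <= Rabs (psi t))) ->
  forall t, beta <= t -> psi t <> 0 /\ psi t * psi1 t <= - k * psi t ^ 2.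
Proof.
intros Hk Hq Hd [x0 Hx0] Hlow Hn1.
assert (Hk2 : 0 < k ^ 2) by now apply pow_lt.
destruct (unbounded_or_bounded q psi psi1 beta) as [[T HT]|HB].
{ intros t Ht. destruct (Hd t) as [D1 D2]. specialize (Hlow t Ht). split; [exact D1|]. split; [exact D2 | lra]. }
{ now elim (Hn1 T). }
apply (bounded_solution_decays q psi psi1 beta k (Rabs (psi beta)) Hk).
{ intros t Ht. destruct (Hd t) as [D1 D2]. auto. }
intros t0 Ht0. apply NNPP. intros Hn.
assert (Hz : forall t, t0 <= t -> psi t = 0).
{ intros t Ht. apply NNPP. intros H. apply Hn. now exists t. }
assert (D0 : forall lo hi x, lo < x < hi -> (forall t, lo < t < hi -> psi t = 0) -> psi1 x = 0).
{ intros lo hi x Hx Hzero.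
  assert (D : is_derive psi x 0).
  { apply (is_derive_ext_loc (fun _ => 0)); [|apply (is_derive_const (V := R_NormedModule))].
    apply (locally_open_interval lo hi); [exact Hx|]. intros t Ht. now rewrite Hzero. }
  rewrite <- (is_derive_unique _ _ _ (proj1 (Hd x))). now apply is_derive_unique. }
set (B := Rabs t0 + Rabs x0 + 3).
assert (Ht0' := Rabs_le_between t0 (Rabs t0)). assert (Hx0' := Rabs_le_between x0 (Rabs x0)).
assert (- Rabs t0 <= t0 <= Rabs t0) by (apply Ht0'; lra).
assert (- Rabs x0 <= x0 <= Rabs x0) by (apply Hx0'; lra).
pose proof (Rabs_pos t0). pose proof (Rabs_pos x0).
destruct (continuity_ab_maj (fun x => Rabs (q x)) (- B) B) as [Mx [HMx _]].
{ unfold B. lra. }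
{ intros c _. apply continuity_pt_filterlim.
  apply (continuous_comp q Rabs); [apply Hq | apply (continuous_Rabs (q c))]. }
assert (Hall : forall x, - B < x < B -> psi x = 0).
{ apply (cauchy_zero q B (Rabs (q Mx)) psi psi1 (t0 + 1)).
  - intros x _. apply Hd.
  - intros x Hx. apply (HMx x). lra.
  - unfold B. lra.
  - apply Hz. lra.
  - apply (D0 t0 (t0 + 2)); [lra|]. intros t Ht. apply Hz. lra. }
destruct Hx0 as [H'|H']; apply H'.
- apply Hall. unfold B. lra.
- apply (D0 (- B) B); [unfold B; lra | exact Hall].
Qed.

Lemma eigenfunction_confined (V : R -> R -> R) (eps lam m b k K : R) (psi psi1 : R -> R) :
  0 < k -> (forall x, continuous (fun x => V x lam) x) ->
  (forall x, is_derive psi x (psi1 x) /\ is_derive psi1 x ((V x lam - lam) / eps ^ 2 * psi x)) ->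
  (exists x, psi x <> 0 \/ psi1 x <> 0) -> RealL2.L2 psi ->
  (forall s, b / 2 <= Rabs s -> k ^ 2 <= (V (m + s) lam - lam) / eps ^ 2) ->
  (forall s, - b < s < b -> Rabs ((V (m + s) lam - lam) / eps ^ 2) <= K) -> 0 < b ->
  confined (fun s => (V (m + s) lam - lam) / eps ^ 2) b (b / 2) k
    (fun s => psi (m + s)) (fun s => psi1 (m + s)).
Proof.
intros Hk HV Hd [x0 Hx0] HL Hlow HK Hb.
set (q := fun x => (V x lam - lam) / eps ^ 2).
assert (Cq : forall x, continuous q x).
{ intros x. unfold q, Rdiv. apply (continuous_mult (K := R_AbsRing)); [|apply continuous_const].
  apply (continuous_minus (V := R_NormedModule)); [apply HV | apply continuous_const]. }
assert (Dr : forall s, is_derive (fun s => psi (m + s)) s (psi1 (m + s)) /\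
  is_derive (fun s => psi1 (m + s)) s (q (m + s) * psi (m + s))).
{ intros s. destruct (Hd (m + s)) as [D1 D2]. split.
  - auto_derive; [now eexists; apply D1|]. derive_subst D1. ring.
  - auto_derive; [now eexists; apply D2|]. derive_subst D2. unfold q. ring. }
assert (Dl : forall s, is_derive (fun s => psi (m + - s)) s (- psi1 (m + - s)) /\
  is_derive (fun s => - psi1 (m + - s)) s (q (m + - s) * psi (m + - s))).
{ intros s. destruct (Hd (m + - s)) as [D1 D2]. split.
  - auto_derive; [now eexists; apply D1|]. derive_subst D1. ring.
  - auto_derive; [now eexists; apply D2|]. derive_subst D2. unfold q. ring. }
split; [intros s _; apply Dr|]. split; [|split; [|now exists K]].
- intros t Ht.
  apply (global_solution_decays (fun s => q (m + s)) (fun s => psi (m + s)) (fun s => psi1 (m + s)) (b / 2) k);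
    auto; try lra.
  + intros x. apply (continuous_comp (fun s => m + s) q); [|apply Cq].
    apply (derive_continuous _ _ 1). auto_derive; [exact I | ring].
  + exists (x0 - m). now replace (m + (x0 - m)) with x0 by ring.
  + intros u Hu. apply Hlow. rewrite Rabs_pos_eq; lra.
  + intros T HT. apply (L2Large.L2_not_ge1_right psi (m + T) HL). intros u Hu.
    replace u with (m + (u - m)) by ring. apply HT. lra.
- intros t Ht.
  apply (global_solution_decays (fun s => q (m + - s)) (fun s => psi (m + - s)) (fun s => - psi1 (m + - s)) (b / 2) k);
    auto; try lra.
  + intros x. apply (continuous_comp (fun s => m + - s) q); [|apply Cq].
    apply (derive_continuous _ _ (- (1))). auto_derive; [exact I | ring].
  + exists (m - x0). replace (m + - (m - x0)) with x0 by ring. destruct Hx0; [now left | right; lra].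
  + intros u Hu. apply Hlow. rewrite Rabs_Ropp, Rabs_pos_eq; lra.
  + intros T HT. apply (L2Large.L2_not_ge1_left psi (m - T) HL). intros u Hu.
    replace u with (m + - (m - u)) by ring. apply HT. lra.
Qed.

(** The Lipschitz bound on the derivative of order n + j uses one derivative more, hence n + j <= 4
    with five derivatives at hand. *)
Lemma lip_class_dx (V : R -> R -> R) (lam m b K r : R) :
  0 < b -> (forall n x, (n < 5)%nat -> is_derive (fun x => dx n V x lam) x (dx (S n) V x lam)) ->
  (forall n x, (n <= 5)%nat -> - r <= x <= r -> Rabs (dx n V x lam) <= K) ->
  (forall s, - b < s < b -> - r <= m + s <= r) ->
  forall j n, (n + j <= 4)%nat -> lip_class j b K (fun s => dx n V (m + s) lam).
Proof.
intros Hb Hd HK Hm.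
assert (Dn : forall n s, (n < 5)%nat -> is_derive (fun s => dx n V (m + s) lam) s (dx (S n) V (m + s) lam)).
{ intros n s Hn. evar_last.
  - apply (is_derive_comp (fun x => dx n V x lam) (fun s => m + s)); [now apply Hd|].
    instantiate (1 := 1). auto_derive; [exact I | ring].
  - unfold scal; simpl; unfold mult; simpl. ring. }
intros j. induction j as [|j IH]; intros n Hn; split.
- intros s Hs. apply HK; [lia | now apply Hm].
- apply (bounded_derive_lipschitz _ (fun s => dx (S n) V (m + s) lam)).
  + intros s _. apply Dn. lia.
  + intros s Hs. apply HK; [lia | now apply Hm].
- intros s Hs. apply HK; [lia | now apply Hm].
- exists (fun s => dx (S n) V (m + s) lam). split; [intros s _; apply Dn; lia | apply IH; lia].
Qed.

Lemma cos_near_half_odd_pi (n : nat) (t : R) : Rabs (cos ((2 * INR n + 1) * (PI / 2) + t)) <= Rabs t.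
Proof.
assert (H : Rabs (cos ((2 * INR n + 1) * (PI / 2) + t)) = Rabs (sin t)).
{ induction n as [|n IH].
  - simpl. replace ((2 * 0 + 1) * (PI / 2) + t) with (PI / 2 + t) by ring.
    rewrite <- (Rabs_Ropp (sin t)). f_equal. rewrite cos_plus, cos_PI2, sin_PI2. ring.
  - rewrite <- IH, <- (Rabs_Ropp (cos ((2 * INR n + 1) * (PI / 2) + t))). f_equal.
    rewrite <- neg_cos. f_equal. rewrite S_INR. field. }
rewrite H. destruct (mean_value sin cos 0 t) as [c [_ E]].
- intros x _. apply is_derive_Reals, derivable_pt_lim_sin.
- rewrite sin_0, !Rminus_0_r in E. rewrite E, Rabs_mult.
  assert (Rabs (cos c) <= 1) by (apply Rabs_le, COS_bound). pose proof (Rabs_pos t). nra.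
Qed.

Lemma RInt_shift (f : R -> R) (m l : R) :
  0 <= l -> (forall x, m - l <= x <= m + l -> continuous f x) ->
  RInt f (m - l) (m + l) = RInt (fun s => f (m + s)) (- l) l.
Proof.
intros Hl Hf.
assert (E := RInt_comp_lin (V := R_CompleteNormedModule) f 1 m (- l) l).
replace (1 * - l + m) with (m - l) in E by ring. replace (1 * l + m) with (m + l) in E by ring.
rewrite <- E.
- apply RInt_ext. intros s _. unfold scal; simpl; unfold mult; simpl. rewrite Rmult_1_l. f_equal. ring.
- apply ex_RInt_continuous_interval; [lra | exact Hf].
Qed.

(** All constants are fixed before [lam], from one rectangle of regularity; the conclusion then
    covers every smaller range of energies. *)
Lemma small_energy_quantization (V : R -> R -> R) (d0 l0 : R) :
  0 < d0 -> 0 < l0 ->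
  (forall lam, 0 <= lam <= l0 -> class_C 5 (fun x => V x lam)) ->
  (forall lam, 0 <= lam <= l0 -> V 0 lam = 0 /\ dx 1 V 0 lam = 0 /\ 0 < dx 2 V 0 lam) ->
  (forall lam x, 0 <= lam <= l0 ->
     (0 < x -> 0 < dx 1 V x lam) /\ (x < 0 -> dx 1 V x lam < 0)) ->
  continuous_partials 2 5 d0 l0 V ->
  exists lstar C0 eps0, 0 < lstar <= l0 /\ 0 < C0 /\ 0 < eps0 /\
  forall lam, 0 < lam <= lstar -> exists xm xp, xm < 0 < xp /\
    (forall x, V x lam = lam <-> x = xm \/ x = xp) /\
    forall eps, 0 < eps < eps0 -> is_eigenvalue eps (schrodinger V) lam ->
      Rabs (cos (1 / eps * RInt (fun x => sqrt (lam - V x lam)) xm xp)) <= C0 * eps.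
Proof.
intros Hd0 Hl0 HC H0 HS HP.
destruct (uniform_derivative_bounds 5 2 d0 l0 V HP Hd0) as [K [HK BK]].
destruct (uniform_convexity 2 5 d0 l0 V HP ltac:(lia) Hd0) as [c [Hc Bc]].
{ intros lam Hl. now apply H0. }
assert (HcK : 0 < c / (2 * K)) by (apply Rdiv_lt_0_compat; lra).
(* On [-r, r] the bound K on the third derivative lets V'' fall by at most c / 2 from its value at
   0, so V'' >= c / 2 there. *)
set (r := Rmin (d0 / 2) (c / (2 * K))).
assert (Hr : 0 < r) by (apply Rmin_pos; lra).
assert (Hr1 : r <= d0 / 2) by apply Rmin_l.
assert (Hr2 : K * r <= c / 2).
{ apply Rle_trans with (K * (c / (2 * K))); [apply Rmult_le_compat_l; [lra | apply Rmin_r] | apply Req_le; field; lra]. }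
set (K' := K + l0).
destruct (langer_transform K' (c / 2) (r / 2) ltac:(lra) ltac:(lra)) as (b & M & Hb & HM & Langer).
(* A bound for the turning points: b / 8 makes l admissible for [quantization], and r / 2 keeps the
   recentred interval inside [-r, r]. *)
set (rho := Rmin (r / 2) (b / 8)).
assert (Hrho : 0 < rho) by (apply Rmin_pos; lra).
assert (Hrho1 : rho <= r / 2) by apply Rmin_l.
assert (Hrho2 : rho <= b / 8) by apply Rmin_r.
assert (HM4 : 0 < M ^ 4) by (apply pow_lt; lra).
assert (Hsc := sqrt_lt_R0 c Hc). assert (Esc := sqrt_sqrt c ltac:(lra)).
(* The first bound is that of [quantization]. The second gives kap1^2 <= c b^2 / 64, a lower bound
   for V - lam at distance b / 2 from the centre. *)
set (kap1 := Rmin (b / (12 * M ^ 4)) (b * sqrt c / 8)).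
assert (Hkap1 : 0 < kap1).
{ apply Rmin_pos; [apply Rdiv_lt_0_compat; lra|]. assert (0 < b * sqrt c) by nra. lra. }
assert (Hkap1' : kap1 <= b / (12 * M ^ 4)) by apply Rmin_l.
assert (Hkap1c : kap1 ^ 2 <= c * b ^ 2 / 64).
{ replace (c * b ^ 2 / 64) with ((b * sqrt c / 8) ^ 2) by (rewrite <- Esc at 2; field).
  apply pow_incr. split; [lra | apply Rmin_r]. }
destruct (quantization b K' M kap1 ltac:(lra) HM ltac:(lra)) as (C0 & eps0 & HC0 & Heps0 & Quant).
assert (Hcr : 0 < c * rho ^ 2) by (apply Rmult_lt_0_compat; [exact Hc | now apply pow_lt]).
(* Half of the lower bound c rho^2 / 4 for V at -rho and rho, so both turning points lie strictly
   between them. The factor 2 of [C0] bounds PI / 2. *)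
exists (Rmin l0 (c * rho ^ 2 / 8)), (2 * C0), eps0.
split; [split; [apply Rmin_pos; lra | apply Rmin_l]|]. split; [lra|]. split; [exact Heps0|].
intros lam Hlam.
assert (Hlam0 : 0 <= lam <= l0) by (split; [lra | eapply Rle_trans; [apply Hlam | apply Rmin_l]]).
assert (Hlamr : lam <= c * rho ^ 2 / 8) by (eapply Rle_trans; [apply Hlam | apply Rmin_r]).
destruct (H0 lam Hlam0) as (V0 & V1 & V2). specialize (Bc lam Hlam0).
assert (HD := class_C_is_derive 5 V lam (HC lam Hlam0)).
assert (HSl := fun x => HS lam x Hlam0).
assert (DV : forall x, is_derive (fun x => V x lam) x (dx 1 V x lam)) by (intros x; apply (HD 0%nat); lia).
assert (DV1 : forall x, is_derive (fun x => dx 1 V x lam) x (dx 2 V x lam)) by (intros x; apply HD; lia).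
assert (Hconv : forall x, - r <= x <= r -> c / 2 <= dx 2 V x lam).
{ intros x Hx. destruct (mean_value (fun x => dx 2 V x lam) (fun x => dx 3 V x lam) 0 x) as [t [Ht E]].
  - intros t _. apply HD. lia.
  - assert (Ht' : - r <= t <= r).
    { revert Ht. unfold Rmin, Rmax. destruct (Rle_dec 0 x); lra. }
    assert (HB := BK 3%nat t lam ltac:(lia) ltac:(lra) Hlam0).
    assert (Hdiff : Rabs (dx 2 V x lam - dx 2 V 0 lam) <= K * r).
    { rewrite E, Rabs_mult, Rminus_0_r. apply Rmult_le_compat; try apply Rabs_pos; [exact HB|].
      apply Rabs_le. lra. }
    apply Rabs_le_between in Hdiff. lra. }
assert (Hquad : forall x, - r <= x <= r -> c / 4 * x ^ 2 <= V x lam).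
{ intros x Hx. replace (c / 4) with (c / 2 / 2) by field.
  apply (convex_lower_bound (fun x => V x lam) (fun x => dx 1 V x lam) (fun x => dx 2 V x lam) r (c / 2)); auto. }
destruct (turning_points V lam rho DV HSl V0 ltac:(lra) Hrho) as (xm & xp & Hxm & Hxp & Em & Ep & Hiff).
{ specialize (Hquad rho ltac:(lra)). lra. }
{ specialize (Hquad (- rho) ltac:(lra)). replace ((- rho) ^ 2) with (rho ^ 2) in Hquad by ring. lra. }
exists xm, xp. split; [lra|]. split; [exact Hiff|]. intros eps Heps Heig.
set (m := (xm + xp) / 2). set (l := (xp - xm) / 2).
assert (Hl : 0 < l <= b / 8) by (unfold l; lra).
assert (Hm : - rho < m < rho) by (unfold m; lra).
assert (Eml : m - l = xm) by (unfold m, l; field). assert (Epl : m + l = xp) by (unfold m, l; field).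
assert (Hms : forall s, - (r / 2) < s < r / 2 -> - r <= m + s <= r) by (intros s Hs; lra).
set (f := fun s => V (m + s) lam - lam).
assert (Df : forall s, is_derive f s (dx 1 V (m + s) lam)).
{ intros s. unfold f. specialize (DV (m + s)).
  auto_derive; [now eexists; apply DV|]. derive_subst DV. ring. }
assert (Df1 : forall s, is_derive (fun s => dx 1 V (m + s) lam) s (dx 2 V (m + s) lam)).
{ intros s. specialize (DV1 (m + s)).
  auto_derive; [now eexists; apply DV1|]. derive_subst DV1. ring. }
assert (Hf : lip_class 4 (r / 2) K' f).
{ apply (diff_class_plus true 4 (r / 2) K l0 (fun s => V (m + s) lam) (fun _ => - lam)).
  - apply (lip_class_dx V lam m (r / 2) K r ltac:(lra) (fun n x Hn => HD n x Hn)) with (n := 0%nat) (j := 4%nat); auto.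
    intros n x Hn Hx. apply BK; [exact Hn | lra | exact Hlam0].
  - apply diff_class_const. rewrite Rabs_Ropp, Rabs_pos_eq; lra. }
assert (Fm : f (- l) = 0) by (unfold f; replace (m + - l) with xm by lra; lra).
assert (Fp : f l = 0) by (unfold f; rewrite Epl; lra).
assert (Dfc : forall s, - (r / 2) < s < r / 2 -> is_derive f s (dx 1 V (m + s) lam) /\
  is_derive (fun s => dx 1 V (m + s) lam) s (dx 2 V (m + s) lam) /\ c / 2 <= dx 2 V (m + s) lam).
{ intros s Hs. split; [apply Df|]. split; [apply Df1|]. now apply Hconv, Hms. }
destruct (Langer l f (fun s => dx 1 V (m + s) lam) (fun s => dx 2 V (m + s) lam) ltac:(lra) Fm Fp Hf Dfc)
  as (kap & z & a & a1 & a2 & Hkap & HI & HL).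
assert (HfK : forall s, - b < s < b -> Rabs (f s) <= K').
{ intros s Hs. apply (diff_class_bound true 4 (r / 2) K' f Hf). lra. }
destruct (real_eigenfunction V eps lam ltac:(lra) Heig) as (psi & psi1 & Dpsi & Npsi & L2psi).
assert (Mon := potential_monotone V lam DV HSl).
(* Convexity gives f >= (c / 4) (s^2 - l^2), with l <= b / 8. Monotonicity of V on each side then
   extends the bound to all |s| >= b / 2, so the decay argument covers the whole half-lines. *)
assert (Hfb : forall s, Rabs s = b / 2 -> c * b ^ 2 / 64 <= f s).
{ intros s Hs. assert (Hs' : - (r / 2) < s < r / 2).
  { apply Rabs_lt_between. lra. }
  destruct (convex_two_zeros (r / 2) (c / 2) l f _ _ ltac:(lra) Fm Fp Dfc s Hs') as [Hout _].
  specialize (Hout ltac:(lra)). rewrite <- (pow2_abs s), Hs in Hout.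
  assert (l ^ 2 <= (b / 8) ^ 2) by (apply pow_incr; lra).
  eapply Rle_trans; [|exact Hout]. nra. }
assert (Hconf : confined (fun s => f s / eps ^ 2) b (b / 2) (kap1 / eps)
  (fun s => psi (m + s)) (fun s => psi1 (m + s))).
{ assert (He2 : 0 < eps ^ 2) by (apply pow_lt; lra).
  apply (eigenfunction_confined V eps lam m b (kap1 / eps) (K' / eps ^ 2)); auto; try lra.
  - apply Rdiv_lt_0_compat; lra.
  - intros x. apply (derive_continuous _ _ _ (DV x)).
  - intros s Hs. replace ((kap1 / eps) ^ 2) with (kap1 ^ 2 / eps ^ 2) by (field; lra).
    apply Rmult_le_compat_r; [apply Rlt_le, Rinv_0_lt_compat; lra|].
    eapply Rle_trans; [exact Hkap1c|].
    destruct (Rle_dec 0 s) as [P|P].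
    + rewrite Rabs_pos_eq in Hs by lra.
      eapply Rle_trans; [apply (Hfb (b / 2)); rewrite Rabs_pos_eq; lra|]. unfold f.
      destruct (Req_dec s (b / 2)) as [->|Q]; [lra|].
      destruct (Mon (m + b / 2) (m + s)) as [A _]. specialize (A ltac:(lra) ltac:(lra)). lra.
    + rewrite Rabs_left in Hs by lra.
      eapply Rle_trans; [apply (Hfb (- (b / 2))); rewrite Rabs_Ropp, Rabs_pos_eq; lra|]. unfold f.
      destruct (Req_dec s (- (b / 2))) as [->|Q]; [lra|].
      destruct (Mon (m + s) (m + - (b / 2))) as [_ A]. specialize (A ltac:(lra) ltac:(lra)). lra.
  - intros s Hs. specialize (HfK s Hs). unfold f in HfK.
    unfold Rdiv. rewrite Rabs_mult, (Rabs_pos_eq (/ eps ^ 2)) by (apply Rlt_le, Rinv_0_lt_compat; lra).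
    apply Rmult_le_compat_r; [apply Rlt_le, Rinv_0_lt_compat; lra | exact HfK]. }
destruct (Quant eps kap l f a a1 a2 z (fun s => psi (m + s)) (fun s => psi1 (m + s)) Heps Hl Hkap) as [n Hn];
  [|exact Hconf|].
{ intros s Hs. destruct (HL s Hs) as (A1 & A2 & A3 & A4 & A5 & A6 & A7 & A8).
  repeat (split; [assumption|]). now apply HfK. }
assert (EI : RInt (fun x => sqrt (lam - V x lam)) xm xp = PI / 2 * (kap * l) ^ 2).
{ rewrite <- Eml, <- Epl, RInt_shift; [|lra|].
  2:{ intros x _. apply (continuous_comp (fun x => lam - V x lam) sqrt); [|apply continuous_sqrt].
      apply (continuous_minus (V := R_NormedModule)); [apply continuous_const|].
      apply (derive_continuous _ _ _ (DV x)). }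
  rewrite <- HI. apply RInt_ext. intros s _. f_equal. unfold f. ring. }
rewrite EI.
(* The distance of the phase from an odd multiple of PI / 2, where the cosine vanishes; the cosine
   is at most |t| in absolute value. *)
set (t := PI / 2 * (((kap * l) ^ 2 - (2 * INR n + 1) * eps) / eps)).
replace (1 / eps * (PI / 2 * (kap * l) ^ 2)) with ((2 * INR n + 1) * (PI / 2) + t) by (unfold t; field; lra).
eapply Rle_trans; [apply cos_near_half_odd_pi|]. unfold t.
assert (HPI := PI_RGT_0). assert (HPI4 := PI_4).
unfold Rdiv at 2. rewrite !Rabs_mult, (Rabs_pos_eq (PI / 2)), (Rabs_pos_eq (/ eps)) by
  (try (apply Rlt_le, Rinv_0_lt_compat); lra).
replace (2 * C0 * eps) with (2 * (C0 * eps ^ 2 * / eps)) by (field; lra).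
apply Rmult_le_compat; [lra | | lra |].
- apply Rmult_le_pos; [apply Rabs_pos | apply Rlt_le, Rinv_0_lt_compat; lra].
- apply Rmult_le_compat_r; [apply Rlt_le, Rinv_0_lt_compat; lra | exact Hn].
Qed.

Theorem theorem1 :
  forall (Lambda : R) (V : R -> R -> R) (pm pp Vm Vp : R),
  0 < Lambda ->
  (forall lam, 0 <= lam <= Lambda -> class_C 5 (fun x => V x lam)) ->
  (forall lam, 0 <= lam <= Lambda ->
     V 0 lam = 0 /\ dx 1 V 0 lam = 0 /\ 0 < dx 2 V 0 lam) ->
  (forall lam x, 0 <= lam <= Lambda ->
     (0 < x -> 0 < dx 1 V x lam) /\ (x < 0 -> dx 1 V x lam < 0)) ->
  0 <= pm -> 0 <= pp -> 0 < Vm -> 0 < Vp ->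
  (exists lam0, 0 < lam0 <= Lambda /\
     unif_equiv m_infty lam0 V (fun x => Vm * Rpower (Rabs x) pm) /\
     unif_bigO m_infty lam0 (dx 1 V) (fun x => Rpower (Rabs x) (pm - 1)) /\
     unif_bigO m_infty lam0 (dx 2 V) (fun x => Rpower (Rabs x) (pm - 2)) /\
     unif_equiv p_infty lam0 V (fun x => Vp * Rpower (Rabs x) pp) /\
     unif_bigO p_infty lam0 (dx 1 V) (fun x => Rpower (Rabs x) (pp - 1)) /\
     unif_bigO p_infty lam0 (dx 2 V) (fun x => Rpower (Rabs x) (pp - 2))) ->
  exists lstar dstar : R, 0 < lstar <= Lambda /\ 0 < dstar /\
  forall lmax delta : R, 0 < lmax <= lstar -> 0 < delta <= dstar ->
  continuous_partials 2 5 delta lmax V ->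
  exists xm xp : R -> R,
    (forall lam, 0 < lam <= lmax ->
       xm lam < 0 < xp lam /\
       forall x, V x lam = lam <-> x = xm lam \/ x = xp lam) /\
    exists C0 eps0 : R, 0 < C0 /\ 0 < eps0 /\
    forall eps lam, 0 < eps < eps0 -> 0 < lam <= lmax ->
      is_eigenvalue eps (schrodinger V) lam ->
      Rabs (cos (1 / eps * RInt (fun x => sqrt (lam - V x lam)) (xm lam) (xp lam)))
        <= C0 * eps.
Proof.
intros Lambda V pm pp Vm Vp HL HC H0 HS _ _ _ _ _.
(* Regularity near (0, 0) is a hypothesis on the eventual delta and lmax, but a
   single instance of it suffices, and lstar may depend on that instance. *)
destruct (classic (exists d0 l0, 0 < d0 /\ 0 < l0 <= Lambda /\ continuous_partials 2 5 d0 l0 V))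
  as [(d0 & l0 & Hd0 & Hl0 & HP)|Hn].
- destruct (small_energy_quantization V d0 l0 Hd0 ltac:(lra)) as (lstar & C0 & eps0 & Hls & HC0 & He0 & Hq);
    [intros; apply HC; lra | intros; apply H0; lra | intros; apply HS; lra | exact HP |].
  exists lstar, 1. split; [lra|]. split; [lra|]. intros lmax delta Hlmax _ _.
  destruct (functional_choice (fun lam (x : R * R) => 0 < lam <= lmax ->
    fst x < 0 < snd x /\ (forall y, V y lam = lam <-> y = fst x \/ y = snd x) /\
    forall eps, 0 < eps < eps0 -> is_eigenvalue eps (schrodinger V) lam ->
      Rabs (cos (1 / eps * RInt (fun y => sqrt (lam - V y lam)) (fst x) (snd x))) <= C0 * eps)) as [X HX].
  { intros lam. destruct (classic (0 < lam <= lmax)) as [Hlam|Hlam].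
    - destruct (Hq lam ltac:(lra)) as (xm & xp & Hx). exists (xm, xp). intros _. exact Hx.
    (* A default pair for energies outside (0, lmax], about which nothing is claimed. *)
    - exists (0, 0). intros H. now elim Hlam. }
  exists (fun lam => fst (X lam)), (fun lam => snd (X lam)). split.
  + intros lam Hlam. destruct (HX lam Hlam) as (A1 & A2 & _). auto.
  + exists C0, eps0. split; [exact HC0|]. split; [exact He0|].
    intros eps lam Heps Hlam. now apply (HX lam Hlam).
- exists Lambda, 1. split; [lra|]. split; [lra|]. intros lmax delta Hlmax Hdelta HP.
  exfalso. apply Hn. exists delta, lmax. split; [lra|]. split; [lra | exact HP].
Qed.
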